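(* Suppose $S=(S_t)_{t\ge0}\sim RSM(\mathbf{m},\mathbf{c},\mathbf{F_0})$ is recurrent. Then there exists a random characteristic couple $(\mathbf{P},\mathbf{F})$ such that: 1. conditional on $(\mathbf{P},\mathbf{F})$, $S\sim SM(\mathbf{P},\mathbf{F})$; 2. $(\mathbf{P},\mathbf{F})\sim SMBS(\mathbf{m},\mathbf{c},\mathbf{F_0})$.
   Context: $E$ is a non-empty finite or countably infinite set, with a fixed element $l_0\in E$. $I\{\cdot\}$ denotes an indicator. $x_{a:b}=(x_a,\dots,x_b)$ if $a\le b$, and the empty sequence if $a>b$. A non-decreasing function on the integers and its associated measure are denoted by the same symbol; e.g. $F(x)=F((-\infty,x])$, and $(a,b]$ denotes a set of integers. Empty sums are $0$ and empty products are $1$. Semi-Markov processes. A characteristic couple is a pair $(\mathbf{P},\mathbf{F})$ where $\mathbf{P}=(P^{i,j})_{i,j\in E}$ is a transition matrix on $E$ with $P^{i,i}=0$ for all $i$, and $\mathbf{F}=(F^i)_{i\in E}$ is a collection of probability distributions on the positive integers (for a random couple these properties are required almost surely). The $i$-th row of $\mathbf{P}$ is identified with the probability measure $P^i(\{j\})=P^{i,j}$ on $E$. A Markov renewal process starting at $l_0$ with characteristic couple $(\mathbf{P},\mathbf{F})$ is a process $(L_n,T_n)_{n\ge 0}$ with $L_0=l_0$ a.s. and $$\mathbb{P}(L_{n+1}=j,T_n\le t\mid L_n=i,L_{0:n-1},T_{0:n-1},(\mathbf{P},\mathbf{F}))=F^i(t)P^{i,j}$$ for all $n\ge0$, $t\ge1$,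 $i,j\in E$. With $\tau_0=0$, $\tau_{n+1}=\sum_{h=0}^nT_h$ and $N(t)=\sum_{n\ge1}I\{\tau_n\le t\}$, the process $S_t=L_{N(t)}$, $t=0,1,2,\dots$, is the associated semi-Markov process, written $S\sim SM(\mathbf{P},\mathbf{F})$. Beta-Stacy process. Given $c(t)>0$ for all integers $t>0$ and a probability distribution $F_0$ with support on the positive integers, a random distribution $F$ is $BS(c,F_0)$ if there are independent random variables $(U_t)_{t\ge1}$ with $U_t\sim Beta(c(t)F_0(\{t\}),c(t)F_0((t,+\infty)))$ and $F((t,+\infty))=\prod_{k=1}^t(1-U_k)$ for all integers $t\ge0$. It is assumed that $F_0((t,+\infty))>0$ for all $t\ge 0$, and $Beta(0,b)$ with $b>0$ is read as the point mass at $0$. Dirichlet process. For a measure $m$ on $E$ with $0<m(E)<\infty$, a random probability measure $P$ on $E$ is $Dir(m)$ if $(P(A_1),\dots,P(A_n))\sim Dirichlet(m(A_1),\dots,m(A_n))$ for every finite partition $A_1,\dots,A_n$ of $E$ (coordinates with zero parameter are a.s. $0$). Semi-Markov beta-Stacy process. For each $i\in E$ let $m^i$ be a measure on $E$ with $0<m^i(E)<\infty$ and $m^i(\{i\})=0$, let $c^i(t)>0$ for all integers $t>0$, and let $F_0^i$ be a distribution with support on the positive integers; put $\mathbf{m}=(m^i)_{i\in E}$, $\mathbf{c}=(c^i)_{i\in E}$, $\mathbf{F_0}=(F_0^i)_{i\in E}$. A random characteristic couple satisfies $(\mathbf{P},\mathbf{F})\sim SMBS(\mathbf{m},\mathbf{c},\mathbf{F_0})$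 if: $\mathbf{P}$ and $\mathbf{F}$ are independent; the rows $P^i$, $i\in E$, are independent; the $F^i$, $i\in E$, are independent; $P^i\sim Dir(m^i)$ for all $i$; and $F^i\sim BS(c^i,F_0^i)$ for all $i$. Path statistics of $S_{0:t}$. $l(t)=\max\{k\in\{0,\dots,t\}:S_t=S_{t-1}=\cdots=S_{t-k}\}$ and $x(t)=l(t)+1$. For $i\ne j$, $M^{i,j}(t)=\sum_{k=1}^tI\{S_{k-1}=i,S_k=j\}$. $N^{i,t}(A)$ is the number of completed visits to $i$ in $S_{0:t}$ (maximal constant stretches at $i$ that end with a jump at or before time $t$) with length in $A$. Reinforced semi-Markov process. An $E$-valued process $S=(S_t)_{t\ge0}$ satisfies $S\sim RSM(\mathbf{m},\mathbf{c},\mathbf{F_0})$ if $\mathbb{P}(S_0=l_0)=1$ and $\mathbb{P}(S_{t+1}=j\mid S_{0:t})=k_t(S_{0:t};j)$ a.s. for all $j\in E$ and $t\ge0$, where, if $S_t=i\ne j$, $$k_t(S_{0:t};i)= \frac{c^{i}(x(t))F_0^i((x(t),+\infty))+N^{i,t}((x(t),+\infty))}{c^i(x(t))F_0^i([x(t),+\infty))+N^{i,t}([x(t),+\infty))},$$ $$k_t(S_{0:t};j)= \frac{c^i(x(t))F_0^i(\{x(t)\})+N^{i,t}(\{x(t)\})}{c^i(x(t))F_0^i([x(t),+\infty))+N^{i,t}([x(t),+\infty))} \cdot \frac{m^i(\{j\})+M^{i,j}(t)}{m^i(E)+\sum_{h\neq i} M^{i,h}(t)}.$$ Recurrence. For $S\sim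 RSM(\mathbf{m},\mathbf{c},\mathbf{F_0})$, let $\tau_0=0$, $\tau_{n+1}=\min\{t>\tau_n:S_t\ne S_{\tau_n}\}$, $L_n=S_{\tau_n}$ and $T_n=\tau_{n+1}-\tau_n$, so that $(L_n)_{n\ge0}$ is the sequence of successive states visited and $(T_n)_{n\ge0}$ the holding times. $S$ is recurrent if $(L_n)_{n\ge0}$ visits every state in $E$ infinitely many times with probability $1$. *)

(* Defs.v *)
From HB Require Import structures.
From mathcomp Require Import all_boot all_order all_algebra.
From mathcomp Require Import all_classical all_reals all_analysis.
From mathcomp Require Import measurable_realfun.

Set Implicit Arguments.
Unset Strict Implicit.
Unset Printing Implicit Defensive.

Import Order.TTheory GRing.Theory Num.Theory.
Import numFieldNormedType.Exports.

Local Open Scope classical_set_scope.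
Local Open Scope ring_scope.

(* Conventions: the state space E is a measurableType, assumed in the theorem
   to be countable and to have all its subsets measurable; laws on the positive
   integers are laws on nat giving mass 0 to {0}; a random probability measure
   on T, defined on the sample space Omega, is a probability kernel
   R.-pker Omega ~> T. *)

Section sigma_algebras.

Definition sigma_rv {d'} {Omega : Type} {T : measurableType d'}
    (X : Omega -> T) : set (set Omega) :=
  preimage_set_system setT X measurable.

(* sigma-algebra generated by the random variables w |-> K w A *)
Definition sigma_rpm {d d'} {Omega : measurableType d} {T : measurableType d'}
    {R : realType} (K : R.-pker Omega ~> T) : set (set Omega) :=
  <<s \bigcup_(A in @measurable _ T) sigma_rv (fun w => K w A) >>.

Definition sigma_join {I Omega : Type} (D : set I)
    (G : I -> set (set Omega)) : set (set Omega) :=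
  <<s \bigcup_(i in D) G i >>.

End sigma_algebras.

Section independence.
Context {d} {Omega : measurableType d} {R : realType} (Pr : probability Omega R).
Local Open Scope ereal_scope.

Definition indep (I : choiceType) (G : I -> set (set Omega)) : Prop :=
  forall (J : seq I) (A : I -> set Omega), uniq J ->
    (forall i, i \in J -> G i (A i)) ->
    Pr (\bigcap_(i in [set` J]) A i) = \prod_(i <- J) Pr (A i).

Definition indep2 (G H : set (set Omega)) : Prop :=
  forall A B, G A -> H B -> Pr (A `&` B) = Pr A * Pr B.

(* f is a version of the conditional probability of A given the
   sigma-algebra G *)
Definition cond_prob (G : set (set Omega)) (A : set Omega)
    (f : Omega -> \bar R) : Prop :=
  (forall B, measurable B -> G (f @^-1` B)) /\
  (forall B, G B -> Pr (A `&` B) = \int[Pr]_(w in B) f w).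

End independence.

Section laws.
Context {R : realType}.
Local Notation mu := (@lebesgue_measure R).

Definition normalized (D : set R) (f : R -> R) (B : set R) : \bar R :=
  ((\int[mu]_(x in D) f x)^-1%:E * \int[mu]_(x in B `&` D) (f x)%:E)%E.

(* The library's beta_prob only has integer parameters.  Intended for
   0 <= a and 0 < b; Beta(0, b) is the point mass at 0. *)
Definition beta_law (a b : R) (B : set R) : \bar R :=
  if a == 0 then \d_(0 : R) B
  else normalized `]0, 1[ (fun x => x `^ (a - 1) * (1 - x) `^ (b - 1)) B.

(* Gamma law with shape a and rate 1; the point mass at 0 when a = 0. *)
Definition gamma_law (a : R) (B : set R) : \bar R :=
  if a == 0 then \d_(0 : R) B
  else normalized `]0, +oo[ (fun x => x `^ (a - 1) * expR (- x)) B.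

(* Dirichlet(a_1, ..., a_n) is the joint law of (Z_j / sum_h Z_h)_j for
   independent Z_j ~ Gamma(a_j, 1), with Z_j = 0 a.s. when a_j = 0 (Ferguson).
   The Z_j may live on another probability space: only the law of X matters. *)
Definition dirichlet {d} {Omega : measurableType d} (Pr : probability Omega R)
    (n : nat) (a : 'I_n -> R) (X : 'I_n -> Omega -> R) : Prop :=
  exists (d' : measure_display) (Omega' : measurableType d')
    (Q : probability Omega' R) (Z : 'I_n -> {RV Q >-> R}),
  [/\ indep Q (fun j => sigma_rv (Z j)),
      forall j B, measurable B -> distribution Q (Z j) B = gamma_law (a j) B &
      forall B : set (n.-tuple R), measurable B ->
        Pr ((fun w => [tuple X j w | j < n]) @^-1` B) =
        Q ((fun w => [tuple Z j w / \sum_h Z h w | j < n]) @^-1` B)].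

End laws.

Section priors.
Context {d} {Omega : measurableType d} {R : realType} (Pr : probability Omega R).

Definition beta_stacy (c : nat -> R) (F0 : probability nat R)
    (F : R.-pker Omega ~> nat) : Prop :=
  exists U : nat -> {RV Pr >-> R},
  [/\ indep Pr (fun t => sigma_rv (U t.+1)),
      forall t B, (0 < t)%N -> measurable B ->
        distribution Pr (U t) B =
        beta_law (c t * fine (F0 [set t]))
                 (c t * fine (F0 [set n | (t < n)%N])) B &
      {ae Pr, forall w, forall t, F w [set n | (t < n)%N] =
                (\prod_(1 <= k < t.+1) (1 - U k w))%:E}].

Definition dirichlet_process {dE} {E : measurableType dE}
    (m : {measure set E -> \bar R}) (P : R.-pker Omega ~> E) : Prop :=
  forall (n : nat) (A : 'I_n -> set E),
    (forall j, measurable (A j)) -> trivIset setT A ->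
    \bigcup_j A j = setT ->
    dirichlet Pr (fun j => fine (m (A j))) (fun j w => fine (P w (A j))).

Definition characteristic_couple {dE} {E : measurableType dE}
    (P : E -> R.-pker Omega ~> E) (F : E -> R.-pker Omega ~> nat) : Prop :=
  {ae Pr, forall w, forall i, P i w [set i] = 0%E /\ F i w [set 0%N] = 0%E}.

Definition SMBS {dE} {E : measurableType dE}
    (m : E -> {measure set E -> \bar R}) (c : E -> nat -> R)
    (F0 : E -> probability nat R)
    (P : E -> R.-pker Omega ~> E) (F : E -> R.-pker Omega ~> nat) : Prop :=
  [/\ indep2 Pr (sigma_join setT (fun i => sigma_rpm (P i)))
                (sigma_join setT (fun i => sigma_rpm (F i))),
      indep Pr (fun i => sigma_rpm (P i)),
      indep Pr (fun i => sigma_rpm (F i)),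
      forall i, dirichlet_process (m i) (P i) &
      forall i, beta_stacy (c i) (F0 i) (F i)].

End priors.

Section semi_markov.
Context {d} {Omega : measurableType d} {R : realType} (Pr : probability Omega R).
Context {dE} {E : measurableType dE}.

(* sigma-algebra of L_0, ..., L_n, T_0, ..., T_{n-1} and (P, F) *)
Definition renewal_history (P : E -> R.-pker Omega ~> E)
    (F : E -> R.-pker Omega ~> nat)
    (L : nat -> Omega -> E) (T : nat -> Omega -> nat) (n : nat) :
    set (set Omega) :=
  <<s (\bigcup_(k in [set k | (k <= n)%N]) sigma_rv (L k)) `|`
      (\bigcup_(k in [set k | (k < n)%N]) sigma_rv (T k)) `|`
      (\bigcup_i sigma_rpm (P i)) `|` (\bigcup_i sigma_rpm (F i)) >>.

Definition markov_renewal (l0 : E) (P : E -> R.-pker Omega ~> E)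
    (F : E -> R.-pker Omega ~> nat)
    (L : nat -> Omega -> E) (T : nat -> Omega -> nat) : Prop :=
  {ae Pr, forall w, L 0%N w = l0} /\
  forall n t j, (0 < t)%N ->
    cond_prob Pr (renewal_history P F L T n)
      [set w | L n.+1 w = j /\ (T n w <= t)%N]
      (fun w => F (L n w) w [set s | (s <= t)%N] * P (L n w) w [set j])%E.

Definition renewal_time (T : nat -> nat) (n : nat) : nat :=
  (\sum_(0 <= h < n) T h)%N.

(* N(t) = #{n >= 1 : tau_n <= t}; the sum may stop at n = t because tau_n >= n
   when holding times are positive. *)
Definition renewal_count (T : nat -> nat) (t : nat) : nat :=
  (\sum_(1 <= n < t.+1) (renewal_time T n <= t))%N.

(* conditionally on (P, F), S ~ SM(P, F) *)
Definition semi_markov (l0 : E) (P : E -> R.-pker Omega ~> E)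
    (F : E -> R.-pker Omega ~> nat) (S : nat -> Omega -> E) : Prop :=
  exists (L : nat -> {RV Pr >-> E}) (T : nat -> {RV Pr >-> nat}),
  [/\ forall n w, (0 < T n w)%N,
      markov_renewal l0 P F (fun n => L n) (fun n => T n) &
      {ae Pr, forall w, forall t, S t w = L (renewal_count (T ^~ w) t) w}].

End semi_markov.

Section path_statistics.
Context {dE} {E : measurableType dE} (s : nat -> E).

(* l(t) *)
Definition elapsed (t : nat) : nat :=
  \max_(k < t.+1 | [forall h : 'I_t.+1, (h <= k)%N ==> (s (t - h)%N == s t)]) k.

(* x(t) *)
Definition age (t : nat) : nat := (elapsed t).+1.

(* M^{i,j}(t) *)
Definition transitions (i j : E) (t : nat) : nat :=
  (\sum_(1 <= k < t.+1) ((s k.-1 == i) && (s k == j)))%N.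

(* The visit (a, b) is the maximal constant stretch s_a = ... = s_{b-1} = i,
   ended by a jump at time b <= t; its length is b - a. *)
Definition completed_visits (i : E) (t : nat) : {set 'I_t.+1 * 'I_t.+1} :=
  [set ab : 'I_t.+1 * 'I_t.+1 |
    [&& (ab.1 < ab.2)%N,
        [forall h : 'I_t.+1, (ab.1 <= h < ab.2)%N ==> (s h == i)],
        (ab.1 == 0%N :> nat) || (s ab.1.-1 != i) & s ab.2 != i]]%SET.

(* N^{i,t}(A) *)
Definition visit_count (i : E) (t : nat) (A : pred nat) : nat :=
  #|[set ab in completed_visits i t | A (ab.2 - ab.1)%N]%SET|.

End path_statistics.

Section reinforced.
Context {R : realType} {dE} {E : measurableType dE}.

(* k_t(s_{0:t}; j) *)
Definition rsm_kernel (m : E -> {measure set E -> \bar R}) (c : E -> nat -> R)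
    (F0 : E -> probability nat R) (s : nat -> E) (t : nat) (j : E) : R :=
  let i := s t in
  let x := age s t in
  let den := c i x * fine (F0 i [set n | (x <= n)%N])
             + (visit_count s i t (fun n => (x <= n)%N))%:R in
  if j == i then
    (c i x * fine (F0 i [set n | (x < n)%N])
     + (visit_count s i t (fun n => (x < n)%N))%:R) / den
  else
    (c i x * fine (F0 i [set x]) + (visit_count s i t (pred1 x))%:R) / den
    * ((fine (m i [set j]) + (transitions s i j t)%:R)
       / (fine (m i setT)
          + \sum_(h \in [set h | h != i]) ((transitions s i h t)%:R : R))).

Definition RSM {d} {Omega : measurableType d} (Pr : probability Omega R)
    (l0 : E) (m : E -> {measure set E -> \bar R}) (c : E -> nat -> R)
    (F0 : E -> probability nat R) (S : nat -> Omega -> E) : Prop :=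
  {ae Pr, forall w, S 0%N w = l0} /\
  forall t j,
    cond_prob Pr (sigma_join [set k | (k <= t)%N] (fun k => sigma_rv (S k)))
      [set w | S t.+1 w = j]
      (fun w => (rsm_kernel m c F0 (S ^~ w) t j)%:E).

(* All tau_n are finite, tau being the successive jump times of the path s. *)
Definition jump_times (s : nat -> E) (tau : nat -> nat) : Prop :=
  tau 0%N = 0%N /\
  forall n, [/\ (tau n < tau n.+1)%N, s (tau n.+1) <> s (tau n) &
    forall u, (tau n < u < tau n.+1)%N -> s u = s (tau n)].

(* The sequence L_n = s_{tau_n} is infinite and visits every state infinitely
   often. *)
Definition recurrent_path (s : nat -> E) : Prop :=
  exists2 tau, jump_times s tau &
    forall i, infinite_set [set n | s (tau n) = i].

Definition recurrent {d} {Omega : measurableType d} (Pr : probability Omega R)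
    (S : nat -> Omega -> E) : Prop :=
  {ae Pr, forall w, recurrent_path (S ^~ w)}.

End reinforced.

(* Main.v *)
(* The reinforced path is driven by independent Polya urns: one for each state [i], whose colours are
   the successors of [i], and one two-coloured urn for each state [i] and age [y], which decides
   whether a visit to [i] that has reached age [y] goes on. Recurrence makes every urn be drawn
   infinitely often. Its predictive probabilities are a bounded martingale, so they converge in L1 to a
   limit [theta], and by the exchangeability of the urns the joint moments of the limits and of the
   path up to time [t] are probabilities of sequences of draws. Moments of bounded variables determine
   their joint law. Hence the limits of different urns are independent, those of the age urns are Beta
   variables, those of the successor urns are jointly Dirichlet (normalised independent gamma variables
   have the same moments, by the recursion E[X f(X)] = E[a f(X) + X f'(X)]), and given the limits the
   path up to time [t] has as probability the product of the limits along its draws, which is the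
   semi-Markov law. *)

Require Import Defs.
From HB Require Import structures.
From mathcomp Require Import all_boot all_order all_algebra.
From mathcomp Require Import all_classical all_reals all_analysis.
From mathcomp Require Import measurable_realfun.
From mathcomp Require Import ring lra zify.

Set Implicit Arguments.
Unset Strict Implicit.
Unset Printing Implicit Defensive.

Import Order.TTheory GRing.Theory Num.Theory.
Import numFieldNormedType.Exports.

Local Open Scope classical_set_scope.
Local Open Scope ring_scope.

(** All that is used of the limits [theta] is one identity, [theta_moment]: the joint moment of a
    cylinder of the path and a list of limits is the probability of a list of draws. The obstacle is
    that the posterior probability of a list [phi] given the past is an exact martingale, whereas
    the product of the one-draw predictive probabilities is what converges to the product of the
    limits. The two differ because the draws of [phi] reinforce each other, an error of order size
    of [phi] over number of past draws; so every urn, also at large ages, must be drawn infinitely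
    often. Recurrence gives this directly for the successor urns and for age zero; it is propagated
    from one age to the next because an urn whose stay colour has positive weight cannot show only
    jumps from some moment on. The second obstacle is an infinite [E]. Laws of successors are
    handled as countably additive set functions compared on points, and the total mass of a random
    row is recovered almost surely from its first two moments. *)

Lemma indic_bool {R : pzRingType} {T : Type} (A : set T) (b : bool) x :
  (A x <-> b) -> \1_A x = b%:R :> R.
Proof.
move=> Ab; rewrite indicE; congr (nat_of_bool _)%:R.
by apply/idP/idP; rewrite inE => /Ab.
Qed.

Lemma cvg_eq {R : realType} (u v : nat -> R) (a b : R) :
  u n @[n --> \oo] --> a -> v n @[n --> \oo] --> b -> u =1 v -> a = b.
Proof.
move=> ua vb /funext uv; rewrite -(cvg_lim (@Rhausdorff R) ua) uv.
exact: (cvg_lim (@Rhausdorff R) vb).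
Qed.

(** * Moments determine the joint law of bounded variables *)

Section bounded_expectation.
Context {d} {T : measurableType d} {R : realType} (mu : probability T R).
Implicit Types f g : T -> R.

(** The variables attached to the process are bounded, so a class of bounded measurable functions
    closed under the algebraic operations replaces integrability conditions, and expectations can
    live in [R]. *)
Definition bmf f := measurable_fun setT f /\ exists M, forall x, `|f x| <= M.

Definition Ex f : R := \int[mu]_x f x.

Lemma bmf_cst (c : R) : bmf (fun=> c).
Proof. by split => //; exists `|c|. Qed.

Lemma bmfD f g : bmf f -> bmf g -> bmf (fun x => f x + g x).
Proof.
move=> [mf [M Mf]] [mg [N Ng]]; split; first exact: measurable_funD.
by exists (M + N) => x; rewrite (le_trans (ler_normD _ _))// lerD.
Qed.

Lemma bmfN f : bmf f -> bmf (fun x => - f x).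
Proof.
move=> [mf [M Mf]]; split; first exact: measurableT_comp.
by exists M => x; rewrite normrN.
Qed.

Lemma bmfB f g : bmf f -> bmf g -> bmf (fun x => f x - g x).
Proof. by move=> bf bg; apply: bmfD => //; exact: bmfN. Qed.

Lemma bmfM f g : bmf f -> bmf g -> bmf (fun x => f x * g x).
Proof.
move=> [mf [M Mf]] [mg [N Ng]]; split; first exact: measurable_funM.
by exists (M * N) => x; rewrite normrM ler_pM.
Qed.

Lemma bmf_norm f : bmf f -> bmf (fun x => `|f x|).
Proof.
move=> [mf [M Mf]]; split; first exact: measurableT_comp.
by exists M => x; rewrite normr_id.
Qed.

Lemma bmf_indic (A : set T) : measurable A -> bmf \1_A.
Proof.
move=> mA; split; first exact: measurable_indic.
by exists 1 => x; rewrite indicE; case: (_ \in _); rewrite ?normr0 ?normr1.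
Qed.

Lemma bmf_01 f : measurable_fun setT f -> (forall x, 0 <= f x <= 1) -> bmf f.
Proof.
by move=> mf f01; split => //; exists 1 => x; have /andP[? ?] := f01 x; rewrite ger0_norm.
Qed.

Lemma bmf_prod I (s : seq I) (f : I -> T -> R) :
  (forall i, bmf (f i)) -> bmf (fun x => \prod_(i <- s) f i x).
Proof.
move=> bf; elim: s => [|i s ih].
  by under eq_fun do rewrite big_nil; exact: bmf_cst.
by under eq_fun do rewrite big_cons; exact: bmfM.
Qed.

Lemma bmf_sum I (s : seq I) (f : I -> T -> R) :
  (forall i, bmf (f i)) -> bmf (fun x => \sum_(i <- s) f i x).
Proof.
move=> bf; elim: s => [|i s ih].
  by under eq_fun do rewrite big_nil; exact: bmf_cst.
by under eq_fun do rewrite big_cons; exact: bmfD.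
Qed.

Lemma bmf_exp f n : bmf f -> bmf (fun x => f x ^+ n).
Proof.
move=> bf; elim: n => [|n ih]; first by under eq_fun do rewrite expr0; exact: bmf_cst.
by under eq_fun do rewrite exprS; exact: bmfM.
Qed.

Lemma bmf_int f : bmf f -> mu.-integrable setT (EFin \o f).
Proof.
move=> [mf [M Mf]]; apply: measurable_bounded_integrable => //.
  by rewrite -ge0_fin_numE// fin_num_measure.
exists M; split; first exact: num_real.
by move=> N MN x _ /=; rewrite (le_trans (Mf x))// ltW.
Qed.

Lemma Ex_EFin f : bmf f -> (\int[mu]_x (f x)%:E)%E = (Ex f)%:E.
Proof. by move=> bf; rewrite /Ex /Rintegral fineK//; apply: integrable_fin_num => //; exact: bmf_int. Qed.

Lemma ExD f g : bmf f -> bmf g -> Ex (fun x => f x + g x) = Ex f + Ex g.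
Proof. by move=> bf bg; rewrite /Ex RintegralD//; exact: bmf_int. Qed.

Lemma ExB f g : bmf f -> bmf g -> Ex (fun x => f x - g x) = Ex f - Ex g.
Proof. by move=> bf bg; rewrite /Ex RintegralB//; exact: bmf_int. Qed.

Lemma ExZl c f : bmf f -> Ex (fun x => c * f x) = c * Ex f.
Proof. by move=> bf; rewrite /Ex RintegralZl//; exact: bmf_int. Qed.

Lemma ExZr c f : bmf f -> Ex (fun x => f x * c) = Ex f * c.
Proof. by move=> bf; rewrite /Ex RintegralZr//; exact: bmf_int. Qed.

Lemma Ex_cst c : Ex (fun=> c) = c.
Proof. by rewrite /Ex Rintegral_cst// [X in fine X](_ : _ = 1%E) ?mulr1//; exact: probability_setT. Qed.

Lemma Ex_ge0 f : (forall x, 0 <= f x) -> 0 <= Ex f.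
Proof. by move=> f0; exact: Rintegral_ge0. Qed.

Lemma le_Ex f g : bmf f -> bmf g -> (forall x, f x <= g x) -> Ex f <= Ex g.
Proof. by move=> bf bg fg; apply: le_Rintegral => //; exact: bmf_int. Qed.

Lemma le_norm_Ex f : bmf f -> `|Ex f| <= Ex (fun x => `|f x|).
Proof. by move=> bf; apply: le_normr_Rintegral => //; exact: bmf_int. Qed.

Lemma Ex_indic A : measurable A -> Ex \1_A = fine (mu A).
Proof. by move=> mA; rewrite /Ex /Rintegral integral_indic// setIT. Qed.

Lemma eq_Ex f g : f =1 g -> Ex f = Ex g.
Proof. by move=> fg; congr Ex; apply/funext. Qed.

Lemma Ex_sum I (s : seq I) (f : I -> T -> R) : (forall i, bmf (f i)) ->
  Ex (fun x => \sum_(i <- s) f i x) = \sum_(i <- s) Ex (f i).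
Proof.
move=> bf; elim: s => [|i s ih].
  by rewrite big_nil; under eq_Ex do rewrite big_nil; exact: Ex_cst.
by rewrite big_cons -ih -ExD//; [under eq_Ex do rewrite big_cons|exact: bmf_sum].
Qed.

Lemma ae_Ex f g : bmf f -> bmf g -> {ae mu, forall x, f x = g x} -> Ex f = Ex g.
Proof.
move=> [mf _] [mg _] fg; rewrite /Ex /Rintegral; congr fine.
apply: ae_eq_integral => //; [exact/measurable_EFinP|exact/measurable_EFinP|].
by apply: filterS fg => x /= -> _.
Qed.

Lemma Ex_eq0 f : bmf f -> (forall x, 0 <= f x) -> Ex f = 0 ->
  {ae mu, forall x, f x = 0}.
Proof.
move=> bf f0 Ef; have [mf _] := bf.
have : (\int[mu]_x `|(f x)%:E| = 0)%E.
  under eq_integral do rewrite gee0_abs ?lee_fin//.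
  by rewrite Ex_EFin// Ef.
have mf' : measurable_fun setT (EFin \o f) by exact/measurable_EFinP.
move/(ae_eq_integral_abs mu measurableT mf').
by apply: filterS => x /= /(_ I) [].
Qed.

Lemma Ex_cvg (M : R) (f : nat -> T -> R) g :
  (forall n, measurable_fun setT (f n)) -> (forall n x, `|f n x| <= M) ->
  bmf g -> {ae mu, forall x, f n x @[n --> \oo] --> g x} ->
  Ex (f n) @[n --> \oo] --> Ex g.
Proof.
move=> mf Mf [mg bg] fg.
have bf n : bmf (f n) by split => //; exists M.
have [||||| _ _ h] := @dominated_convergence _ _ _ mu setT measurableT
    (fun n => EFin \o f n) (EFin \o g) (EFin \o cst M).
- by move=> n; apply/measurable_EFinP.
- exact/measurable_EFinP.
- by apply: filterS fg => x fgx _; apply: cvg_EFin => //; exact: nearW.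
- exact: (bmf_int (bmf_cst M)).
- by apply: aeW => x n _ /=; rewrite lee_fin.
rewrite (_ : (fun n => Ex (f n)) = fine \o (fun n => \int[mu]_x (EFin \o f n) x)%E)//.
apply: fine_cvg; rewrite -Ex_EFin//.
Qed.

End bounded_expectation.

(** * Bernstein approximation on the unit interval *)

Section bernstein.
Context {R : realType}.
Implicit Types (h : nat -> R) (x : R).

(** The mean of [h] at a binomial variable with parameters [n] and [x], that is the Bernstein
    polynomial with nodes at the integers, computed by conditioning on one trial instead of with
    binomial coefficients. *)
Fixpoint bern n h x : R :=
  if n is n'.+1 then x * bern n' (h \o S) x + (1 - x) * bern n' h x else h 0%N.

Lemma le_bern n h1 h2 x : 0 <= x <= 1 -> (forall k, h1 k <= h2 k) ->
  bern n h1 x <= bern n h2 x.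
Proof.
move=> /andP[x0 x1]; elim: n h1 h2 => [|n ih] h1 h2 h12 //=.
by rewrite lerD// ler_wpM2l ?subr_ge0//; apply: ih => k /=; exact: h12.
Qed.

Lemma bern_lin n a b h1 h2 x :
  bern n (fun k => a * h1 k + b * h2 k) x = a * bern n h1 x + b * bern n h2 x.
Proof.
elim: n h1 h2 => [|n ih] h1 h2 //=.
have -> : bern n ((fun k => a * h1 k + b * h2 k) \o S) x =
  a * bern n (h1 \o S) x + b * bern n (h2 \o S) x by rewrite -ih.
by rewrite ih; ring.
Qed.

Lemma bern_cst n c x : bern n (fun=> c) x = c.
Proof.
elim: n => //= n ih.
by rewrite (_ : _ \o S = fun=> c)// ih; ring.
Qed.

(** Variance plus squared bias of the binomial law. The centre [c] is free because conditioning on a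
    successful trial replaces it by [c - 1]. *)
Lemma bern_var n c x :
  bern n (fun k => (k%:R - c) ^+ 2) x = n%:R * x * (1 - x) + (n%:R * x - c) ^+ 2.
Proof.
elim: n c => [|n ih] c /=; first by ring.
rewrite ih (_ : _ \o S = fun k => (k%:R - (c - 1)) ^+ 2); last first.
  by apply/funext => k /=; rewrite -natr1; ring.
by rewrite ih -natr1; ring.
Qed.

(** Quantitative Weierstrass theorem: [|u| <= e + u ^+ 2 / e] for [u = k / n - x], and the mean of
    [u ^+ 2] under the binomial law is at most [1 / n]. The two terms of the bound come from
    there. *)
Lemma bern_approx (phi : R -> R) L n e x : 0 <= L -> 0 <= x <= 1 -> 0 < e -> (0 < n)%N ->
  (forall y z, `|phi y - phi z| <= L * `|y - z|) ->
  `|bern n (fun k => phi (k%:R / n%:R)) x - phi x| <= L * (e + (n%:R * e)^-1).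
Proof.
move=> L0 x01 e0 n0 lip; have nR : 0 < n%:R :> R by rewrite ltr0n.
have bd k : `|phi (k%:R / n%:R) - phi x| <= L * e + L / e / n%:R ^+ 2 * (k%:R - n%:R * x) ^+ 2.
  apply: (le_trans (lip _ _)).
  have -> : L * e + L / e / n%:R ^+ 2 * (k%:R - n%:R * x) ^+ 2
     = L * (e + (k%:R / n%:R - x) ^+ 2 / e) by field; rewrite !gt_eqF.
  apply: ler_wpM2l => //; set u := _ - x.
  have -> : e + u ^+ 2 / e = (e ^+ 2 + `|u| ^+ 2) / e.
    by rewrite real_normK ?num_real//; field; rewrite gt_eqF.
  rewrite ler_pdivlMr//; have := sqr_ge0 (e - `|u|); have := normr_ge0 u; nra.
have lin : bern n (fun k => L * e + L / e / n%:R ^+ 2 * (k%:R - n%:R * x) ^+ 2) x =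
   L * e + L / e / n%:R * (x * (1 - x)).
  transitivity (bern n (fun k => (L * e) * 1 + L / e / n%:R ^+ 2 * (k%:R - n%:R * x) ^+ 2) x).
    by congr bern; apply/funext => k; rewrite mulr1.
  rewrite (@bern_lin n (L * e) _ (fun=> 1)) bern_cst bern_var.
  by field; rewrite !gt_eqF.
have up : L * e + L / e / n%:R * (x * (1 - x)) <= L * (e + (n%:R * e)^-1).
  have -> : L * (e + (n%:R * e)^-1) = L * e + L / e / n%:R by field; rewrite !gt_eqF.
  rewrite lerD2l ler_piMr//; first by rewrite !divr_ge0// ltW.
  by case/andP: x01 => *; nra.
have -> : bern n (fun k => phi (k%:R / n%:R)) x - phi x =
    bern n (fun k => 1 * phi (k%:R / n%:R) + (-1) * phi x) x.
  by rewrite (@bern_lin n 1 (-1) _ (fun=> phi x)) bern_cst; ring.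
rewrite (le_trans _ up)// -lin ler_norml; apply/andP; split.
  set h := (fun k => L * e + _).
  have -> : - bern n h x = bern n (fun k => (-1) * h k + 0 * 0) x.
    by rewrite (@bern_lin n (-1) 0 _ (fun=> 0)); ring.
  apply: le_bern => // k.
  by have := bd k; rewrite ler_norml => /andP[+ _]; rewrite -/(h k); lra.
apply: le_bern => // k.
by have := bd k; rewrite ler_norml => /andP[_ +]; lra.
Qed.

End bernstein.

Section moments_determine.
Context {d1 d2} {T1 : measurableType d1} {T2 : measurableType d2} {R : realType}.
Context (mu1 : probability T1 R) (mu2 : probability T2 R).

Lemma bern_moments (f X : T1 -> R) (g Y : T2 -> R) :
  bmf f -> bmf X -> bmf g -> bmf Y ->
  (forall n, Ex mu1 (fun x => f x * X x ^+ n) = Ex mu2 (fun y => g y * Y y ^+ n)) ->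
  forall n h, Ex mu1 (fun x => f x * bern n h (X x)) =
              Ex mu2 (fun y => g y * bern n h (Y y)).
Proof.
move=> bf bX bg bY fg n h.
have bbern d (T : measurableType d) (Z : T -> R) : bmf Z ->
    forall k l, bmf (fun x => bern k l (Z x)).
  move=> bZ; elim=> [|k ih] l /=; first exact: bmf_cst.
  by apply: bmfD; apply: bmfM => //; apply: bmfB => //; exact: bmf_cst.
(* The recursion of [bern] multiplies by [X], so the induction carries a free power of [X]. *)
suff : forall p, Ex mu1 (fun x => f x * X x ^+ p * bern n h (X x)) =
                 Ex mu2 (fun y => g y * Y y ^+ p * bern n h (Y y)).
  by move/(_ 0%N); under eq_Ex do rewrite mulr1; under [RHS]eq_Ex do rewrite mulr1.
elim: n h => [|n ih] h p /=.
  by rewrite !ExZr; do ?[apply: bmfM => //; exact: bmf_exp]; rewrite fg.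
have split d (T : measurableType d) (mu : probability T R) (u Z : T -> R) : bmf u -> bmf Z ->
    Ex mu (fun x => u x * Z x ^+ p * (Z x * bern n (h \o S) (Z x) + (1 - Z x) * bern n h (Z x)))
    = Ex mu (fun x => u x * Z x ^+ p.+1 * bern n (h \o S) (Z x)) +
      (Ex mu (fun x => u x * Z x ^+ p * bern n h (Z x)) -
       Ex mu (fun x => u x * Z x ^+ p.+1 * bern n h (Z x))).
  move=> bu bZ; have bm q l : bmf (fun x => u x * Z x ^+ q * bern n l (Z x)).
    by apply: bmfM; [apply: bmfM => //; exact: bmf_exp|exact: bbern].
  rewrite -ExB// -ExD//; last exact: bmfB.
  by apply: eq_Ex => x; rewrite exprS; ring.
by rewrite !split// !ih.
Qed.

Lemma lipschitz_moments (f X : T1 -> R) (g Y : T2 -> R) :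
  bmf f -> measurable_fun setT X -> (forall x, 0 <= X x <= 1) ->
  bmf g -> measurable_fun setT Y -> (forall x, 0 <= Y x <= 1) ->
  (forall n, Ex mu1 (fun x => f x * X x ^+ n) = Ex mu2 (fun y => g y * Y y ^+ n)) ->
  forall L phi, 0 <= L -> (forall y z, `|phi y - phi z| <= L * `|y - z|) ->
  bmf (phi \o X) -> bmf (phi \o Y) ->
  Ex mu1 (fun x => f x * phi (X x)) = Ex mu2 (fun y => g y * phi (Y y)).
Proof.
move=> bf mX X01 bg mY Y01 fg L phi L0 lip bphiX bphiY.
have bX := bmf_01 mX X01; have bY := bmf_01 mY Y01.
have eb := bern_moments bf bX bg bY fg.
have bbern d (T : measurableType d) (Z : T -> R) : bmf Z ->
    forall k l, bmf (fun x => bern k l (Z x)).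
  move=> bZ; elim=> [|k ih] l /=; first exact: bmf_cst.
  by apply: bmfD; apply: bmfM => //; apply: bmfB => //; exact: bmf_cst.
have [M [M0 Mf Mg]] : exists M, [/\ 0 <= M, forall x, `|f x| <= M & forall x, `|g x| <= M].
  have [_ [M1 h1]] := bf; have [_ [M2 h2]] := bg; exists (`|M1| + `|M2|); split => [|x|x].
  - by rewrite addr_ge0.
  - by rewrite (le_trans (h1 x))// (le_trans (ler_norm _))// lerDl.
  - by rewrite (le_trans (h2 x))// (le_trans (ler_norm _))// lerDr.
have bound d (T : measurableType d) (mu : probability T R) (u Z : T -> R) : bmf u ->
    (forall x, `|u x| <= M) -> (forall x, 0 <= Z x <= 1) -> bmf (phi \o Z) -> bmf Z ->
    forall e n, 0 < e -> (0 < n)%N ->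
    `|Ex mu (fun x => u x * bern n (fun k => phi (k%:R / n%:R)) (Z x)) -
      Ex mu (fun x => u x * phi (Z x))| <= M * (L * (e + (n%:R * e)^-1)).
  move=> bu uM Z01 bphiZ bZ e n e0 n0; rewrite -ExB; last 2 first.
    by apply: bmfM => //; exact: bbern.
    exact: bmfM.
  have bdiff : bmf (fun x => u x * bern n (fun k => phi (k%:R / n%:R)) (Z x) - u x * phi (Z x)).
    by apply: bmfB; apply: bmfM => //; exact: bbern.
  rewrite (le_trans (le_norm_Ex _ _))//.
  rewrite -[leRHS](Ex_cst mu); apply: le_Ex; [exact: bmf_norm|exact: bmf_cst|move=> x].
  by rewrite -mulrBr normrM ler_pM// bern_approx.
apply/eqP; rewrite -subr_eq0 -normr_le0; apply/ler_addgt0Pl => e e0; rewrite addr0.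
(* With [n > e1 ^- 2] both terms of the Bernstein error are at most [e1], so each side is within
   [e / 2] of its Bernstein mean. The [+ 1] keeps the quotient meaningful when [M * L = 0]. *)
pose e1 := e / (4 * (M * L + 1)).
have ML : 0 <= M * L by rewrite mulr_ge0.
have e10 : 0 < e1 by rewrite divr_gt0// mulr_gt0//; lra.
pose n := (Num.trunc (e1 ^-2)).+1.
have ne1 : (n%:R * e1)^-1 <= e1.
  have := truncnS_gt (e1 ^- 2); rewrite -/n => h.
  have ne0 : 0 < n%:R * e1 by rewrite mulr_gt0// ltr0n.
  rewrite invf_ple ?posrE//.
  by rewrite -ler_pdivrMr// -invfM -expr2 ltW.
have key : M * (L * (e1 + (n%:R * e1)^-1)) <= e / 2.
  have -> : e / 2 = (M * L + 1) * (e1 + e1) by rewrite /e1; field; rewrite gt_eqF//; lra.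
  rewrite mulrA (@le_trans _ _ (M * L * (e1 + e1)))//.
    by rewrite ler_wpM2l// lerD2l.
  by rewrite ler_wpM2r ?addr_ge0 ?(ltW e10)//; lra.
have b1 := bound _ _ mu1 f X bf Mf X01 bphiX bX _ n e10 (ltn0Sn _).
have b2 := bound _ _ mu2 g Y bg Mg Y01 bphiY bY _ n e10 (ltn0Sn _).
rewrite -eb in b2; move: b1 b2 => /ler_normlP[? ?] /ler_normlP[? ?].
by apply/ler_normlP; split; lra.
Qed.

(** The indicator of []c, +oo[] is the pointwise limit of the ramps [phi k], which are [k]-Lipschitz
    with values in the unit interval; dominated convergence passes to the limit. *)
Lemma ray_moments (f X : T1 -> R) (g Y : T2 -> R) :
  bmf f -> measurable_fun setT X -> (forall x, 0 <= X x <= 1) ->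
  bmf g -> measurable_fun setT Y -> (forall x, 0 <= Y x <= 1) ->
  (forall n, Ex mu1 (fun x => f x * X x ^+ n) = Ex mu2 (fun y => g y * Y y ^+ n)) ->
  forall c, Ex mu1 (fun x => f x * (c < X x)%R%:R) = Ex mu2 (fun y => g y * (c < Y y)%R%:R).
Proof.
move=> bf mX X01 bg mY Y01 fg c.
pose phi k (x : R) := Num.min 1 (k%:R * Num.max 0 (x - c)).
have phi01 k x : 0 <= phi k x <= 1.
  by rewrite /phi le_min ler01 mulr_ge0 ?le_max ?lexx//= ge_min lexx.
have lip k y z : `|phi k y - phi k z| <= k%:R * `|y - z|.
  have minL (a b : R) : `|Num.min 1 a - Num.min 1 b| <= `|a - b|.
    rewrite /Num.min; case: ltP => ?; case: ltP => ?; rewrite ?subrr ?normr0//;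
      rewrite ler_norml; apply/andP; split; case: (ler0P (a - b)); lra.
  have maxL (a b : R) : `|Num.max 0 a - Num.max 0 b| <= `|a - b|.
    rewrite /Num.max; case: ltP => ?; case: ltP => ?; rewrite ?subrr ?normr0//;
      rewrite ler_norml; apply/andP; split; case: (ler0P (a - b)); lra.
  rewrite (le_trans (minL _ _))// -mulrBr normrM ger0_norm// ler_wpM2l//.
  by rewrite (le_trans (maxL _ _))// (_ : _ - _ = y - z)//; ring.
have mphi d (T : measurableType d) (Z : T -> R) k : measurable_fun setT Z -> bmf (phi k \o Z).
  move=> mZ; apply: bmf_01 => [|x]; last exact: phi01.
  apply: measurable_minr => //; apply: measurable_funM => //.
  by apply: measurable_maxr => //; exact: measurable_funB.
have lim d (T : measurableType d) (mu : probability T R) (u Z : T -> R) :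
    bmf u -> measurable_fun setT Z ->
    Ex mu (fun x => u x * phi k (Z x)) @[k --> \oo] --> Ex mu (fun x => u x * (c < Z x)%R%:R).
  move=> bu mZ; have [mu' [M uM]] := bu; apply: (@Ex_cvg _ _ _ _ M).
  - by move=> n; have [] := bmfM bu (mphi _ _ _ n mZ).
  - move=> n x; rewrite normrM -[leRHS]mulr1 ler_pM//.
    by have /andP[? ?] := phi01 n (Z x); rewrite ger0_norm.
  - apply: bmfM => //; rewrite (_ : (fun x => _) = \1_(Z @^-1` `]c, +oo[)).
      by apply: bmf_indic; rewrite -[X in measurable X]setTI; apply: mZ.
    by apply/funext => x; rewrite (@indic_bool _ _ _ (c < Z x)%R)//= in_itv/= andbT.
  apply: aeW => x /=; apply: cvgM; first exact: cvg_cst.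
  have [cZ|Zc] := ltP c (Z x); last first.
    rewrite (_ : (fun k => phi k (Z x)) = fun=> 0); first exact: cvg_cst.
    by apply/funext => k; rewrite /phi max_l ?subr_le0// mulr0 min_r.
  apply: (@cvg_near_cst); near=> k; rewrite /phi min_l//.
  rewrite max_r ?subr_ge0 ?(ltW cZ)// -ler_pdivrMr ?subr_gt0// div1r.
  near: k; exact: nbhs_infty_ger.
have h1 := lim _ _ mu1 f X bf mX; have h2 := lim _ _ mu2 g Y bg mY.
apply: (cvg_eq h1 h2) => k.
by apply: (@lipschitz_moments _ X _ Y _ _ _ _ _ _ _ k%:R) => //; exact: mphi.
Unshelve. all: by end_near. Qed.

Context (Z : Type) (I : Type) (z : I -> Z -> R) (p1 : T1 -> Z) (p2 : T2 -> Z).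
Hypotheses (mz1 : forall i, measurable_fun setT (z i \o p1))
           (mz2 : forall i, measurable_fun setT (z i \o p2)).
Hypotheses (z01 : forall i x, 0 <= z i (p1 x) <= 1) (z02 : forall i x, 0 <= z i (p2 x) <= 1).

(* [p1] and [p2] let the lemma compare laws on two different sample spaces. *)
Lemma moments_determine (f : T1 -> R) (g : T2 -> R) : bmf f -> bmf g ->
  (forall s : seq I, Ex mu1 (fun x => f x * \prod_(i <- s) z i (p1 x)) =
                     Ex mu2 (fun x => g x * \prod_(i <- s) z i (p2 x))) ->
  forall B, <<s \bigcup_i sigma_rv (z i) >> B ->
  [/\ measurable (p1 @^-1` B), measurable (p2 @^-1` B) &
     Ex mu1 (fun x => f x * \1_(p1 @^-1` B) x) = Ex mu2 (fun x => g x * \1_(p2 @^-1` B) x)].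
Proof.
move=> bf bg fg.
pose cyl (r : seq (I * R)) := [set u | all (fun ic => ic.2 < z ic.1 u) r].
have m1 i : bmf (fun x => z i (p1 x)) by exact: (bmf_01 (mz1 i) (z01 i)).
have m2 i : bmf (fun x => z i (p2 x)) by exact: (bmf_01 (mz2 i) (z02 i)).
have mc d (T : measurableType d) (p : T -> Z) : (forall i, bmf (fun x => z i (p x))) ->
    forall r, measurable (p @^-1` (cyl r)).
  move=> mp; elim=> [|[i c] r ih]; first by rewrite (_ : _ @^-1` _ = setT)//; apply/seteqP; split.
  rewrite (_ : _ @^-1` _ = (fun x => z i (p x)) @^-1` `]c, +oo[ `&` p @^-1` cyl r).
    by apply: measurableI => //; rewrite -[X in measurable X]setTI; apply: (mp i).1.
  apply/seteqP; split=> [x /= /andP[? ?]|x /= [+ ?]]; rewrite ?in_itv/= ?andbT => *; first by split.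
  by apply/andP; split.
have indc (r : seq (I * R)) i c u :
    \1_(cyl ((i, c) :: r)) u = \1_(cyl r) u * (c < z i u)%R%:R :> R.
  rewrite (@indic_bool _ _ (cyl r) (all (fun ic => ic.2 < z ic.1 u) r))//.
  rewrite (@indic_bool _ _ (cyl ((i, c) :: r)) ((c < z i u)%R && all (fun ic => ic.2 < z ic.1 u) r))//.
  by case: (c < _)%R; rewrite ?mulr1 ?mulr0.
have indp d (T : measurableType d) (p : T -> Z) B x : \1_(p @^-1` B) x = \1_B (p x) :> R.
  by rewrite !indicE; congr (_ %:R); apply/idP/idP; rewrite !in_setE.
(* Rays are adjoined one at a time: the indicators already obtained go into the bounded factor,
   while the monomial over [s] stays free. Prefixing [s] with [nseq n i] supplies the powers of the
   coordinate being treated. *)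
have cylE r : forall s : seq I,
    Ex mu1 (fun x => f x * \1_(p1 @^-1` cyl r) x * \prod_(i <- s) z i (p1 x)) =
    Ex mu2 (fun x => g x * \1_(p2 @^-1` cyl r) x * \prod_(i <- s) z i (p2 x)).
  elim: r => [|[i c] r ih] s.
    have c0 u : \1_(cyl [::]) u = 1 :> R by rewrite indicE mem_set.
    by under eq_Ex do rewrite indp c0 mulr1; under [RHS]eq_Ex do rewrite indp c0 mulr1.
  have b1 : bmf (fun x => f x * \1_(p1 @^-1` cyl r) x * \prod_(i <- s) z i (p1 x)).
    by apply: bmfM; [apply: bmfM => //; apply: bmf_indic; exact: mc|exact: bmf_prod].
  have b2 : bmf (fun x => g x * \1_(p2 @^-1` cyl r) x * \prod_(i <- s) z i (p2 x)).
    by apply: bmfM; [apply: bmfM => //; apply: bmf_indic; exact: mc|exact: bmf_prod].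
  have := ray_moments b1 (mz1 i) (z01 i) b2 (mz2 i) (z02 i) _ c.
  have e1 : (fun x => f x * \1_(p1 @^-1` cyl ((i, c) :: r)) x * \prod_(i <- s) z i (p1 x)) =
    (fun x => f x * \1_(p1 @^-1` cyl r) x * \prod_(i0 <- s) z i0 (p1 x) * (c < (z i \o p1) x)%R%:R).
    by apply/funext => x; rewrite !indp indc /=; ring.
  have e2 : (fun x => g x * \1_(p2 @^-1` cyl ((i, c) :: r)) x * \prod_(i <- s) z i (p2 x)) =
    (fun x => g x * \1_(p2 @^-1` cyl r) x * \prod_(i0 <- s) z i0 (p2 x) * (c < (z i \o p2) x)%R%:R).
    by apply/funext => x; rewrite !indp indc /=; ring.
  rewrite e1 e2; apply => n; have := ih (nseq n i ++ s).
  have en u : \prod_(j <- nseq n i ++ s) z j u = (\prod_(j <- s) z j u) * z i u ^+ n.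
    by elim: (n) => [|k ihk]; rewrite ?mulr1//= big_cons ihk exprS; ring.
  by under eq_Ex do rewrite en mulrA; under [RHS]eq_Ex do rewrite en mulrA.
set H := [set B | [/\ measurable (p1 @^-1` B), measurable (p2 @^-1` B) &
     Ex mu1 (fun x => f x * \1_(p1 @^-1` B) x) = Ex mu2 (fun x => g x * \1_(p2 @^-1` B) x)]].
pose G := [set B | exists r, B = cyl r].
have GI : setI_closed G.
  move=> _ _ [r ->] [r' ->]; exists (r ++ r'); apply/seteqP; split=> u;
  by rewrite /cyl /= all_cat => /andP.
have GH : G `<=` H.
  move=> _ [r ->]; split; [exact: mc|exact: mc|].
  by have := cylE r [::]; under eq_Ex do rewrite big_nil mulr1; under [in RHS]eq_Ex do rewrite big_nil mulr1.
have lH : lambda_system setT H.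
  split => //.
  - by apply: GH; exists [::]; apply/seteqP; split.
  - move=> A B BA [A1 A2 eA] [B1 B2 eB].
    have iD u : \1_(A `\` B) u = \1_A u - \1_B u :> R.
      rewrite !indicE in_setD; case: (boolP (u \in A)) => uA; case: (boolP (u \in B)) => uB;
        rewrite ?subrr ?subr0//=.
      by move: uA; rewrite (mem_set (BA _ (set_mem uB))).
    split; [exact: (measurableD A1 B1)|exact: (measurableD A2 B2)|].
    have iM d (T : measurableType d) (mu : probability T R) p u : bmf u ->
      measurable (p @^-1` A) -> measurable (p @^-1` B) ->
      Ex mu (fun x => u x * \1_(p @^-1` (A `\` B)) x) =
      Ex mu (fun x => u x * \1_(p @^-1` A) x) - Ex mu (fun x => u x * \1_(p @^-1` B) x).
      move=> bu mA mB; rewrite -ExB; [|by apply: bmfM => //; exact: bmf_indic..].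
      by apply: eq_Ex => x; rewrite !indp iD; ring.
    by rewrite !iM// eA eB.
  - move=> F ndF HF.
    have m1F : measurable (p1 @^-1` \bigcup_i F i).
      by rewrite preimage_bigcup; apply: bigcup_measurable => i _; have [] := HF i.
    have m2F : measurable (p2 @^-1` \bigcup_i F i).
      by rewrite preimage_bigcup; apply: bigcup_measurable => i _; have [] := HF i.
    split => //.
    have lim d (T : measurableType d) (mu : probability T R) (p : T -> Z) u : bmf u ->
      (forall i, measurable (p @^-1` F i)) -> measurable (p @^-1` \bigcup_i F i) ->
      Ex mu (fun x => u x * \1_(p @^-1` F n) x) @[n --> \oo] -->
      Ex mu (fun x => u x * \1_(p @^-1` \bigcup_i F i) x).
      move=> bu mF mUF; have [_ [M uM]] := bu; apply: (@Ex_cvg _ _ _ _ M).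
      + by move=> n; have [] := bmfM bu (bmf_indic (mF n)).
      + move=> n x; rewrite normrM -[leRHS]mulr1 ler_pM//.
        by rewrite indicE; case: (_ \in _); rewrite ?normr0 ?normr1.
      + by apply: bmfM => //; exact: bmf_indic.
      apply: aeW => x; apply: cvgM; first exact: cvg_cst.
      apply: cvg_near_cst.
      have [[i _ Fi]|nF] := pselect ((\bigcup_i F i) (p x)).
        near=> n; have Fn : F n (p x).
          have /subsetPset : (F i <= F n)%O by apply: ndF; near: n; exact: nbhs_infty_ge.
          exact.
        by rewrite !indp !indicE (mem_set Fn) mem_set//; exists i.
      near=> n; rewrite !indp !indicE memNset => [|Fn]; last by apply: nF; exists n.
      by rewrite memNset.
    have h1 := lim _ _ mu1 p1 f bf (fun i => let: And3 a _ _ := HF i in a) m1F.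
    have h2 := lim _ _ mu2 p2 g bg (fun i => let: And3 _ a _ := HF i in a) m2F.
    by apply: (cvg_eq h1 h2) => n; have [] := HF n.
have sub := lambda_system_subset GI lH GH (fun X _ => @subsetT _ X).
move=> B sB; apply: sub; move: B sB; apply: smallest_sub; first exact: smallest_sigma_algebra.
move=> _ [i _ [C mC <-]]; rewrite setTI.
(* The open rays generate the Borel sets, and the preimage of a ray under [z i] is a cylinder with a
   single entry. *)
have : (@RGenOInfty.G R).-sigma.-measurable C by rewrite -RGenOInfty.measurableE.
have := @g_sigma_preimageE Z R setT (z i) (@RGenOInfty.G R).
move=> /seteqP[_ h] hC.
have : preimage_set_system setT (z i) ((@RGenOInfty.G R).-sigma.-measurable) (z i @^-1` C).
  by exists C => //; rewrite setTI.
move/h; apply: sub_smallest2r; first exact: smallest_sigma_algebra.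
move=> _ [_ [c ->] <-]; exists [:: (i, c)]; apply/seteqP; split => u; rewrite /cyl /= in_itv/= !andbT.
  by case.
by [].
Unshelve. all: by end_near. Qed.

End moments_determine.

Lemma prod_01 {R : realType} (I : Type) (r : seq I) (a : I -> R) :
  (forall i, 0 <= a i <= 1) -> 0 <= \prod_(i <- r) a i <= 1.
Proof.
move=> a01; elim: r => [|i r /andP[ih0 ih1]]; first by rewrite big_nil ler01 lexx.
by have /andP[? ?] := a01 i; rewrite big_cons mulr_ge0//= mulr_ile1.
Qed.

(** * Completeness: L2-Cauchy sequences with values in the unit interval *)

Section L1_limit.
Context {d} {T : measurableType d} {R : realType} (mu : probability T R).

(** A subsequence with summable mean increments converges almost everywhere. Its upper limit,
    clamped to [[0, 1]], is measurable and bounded everywhere, including where convergence fails. *)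
Lemma L2_cauchy_L1_limit (X : nat -> T -> R) :
  (forall n, measurable_fun setT (X n)) -> (forall n x, 0 <= X n x <= 1) ->
  (forall e, 0 < e -> exists N, forall n m, (N <= n)%N -> (N <= m)%N ->
     Ex mu (fun x => (X n x - X m x) ^+ 2) <= e) ->
  exists Y : T -> R, [/\ measurable_fun setT Y, forall x, 0 <= Y x <= 1 &
    Ex mu (fun x => `|X n x - Y x|) @[n --> \oo] --> (0 : R)].
Proof.
move=> mX X01 cX.
have bX n : bmf (X n) := bmf_01 (mX n) (X01 n).
have bXX n m : bmf (fun x => `|X n x - X m x|) by apply: bmf_norm; exact: bmfB.
have /choice[N HN] : forall k, exists N, forall n m, (N <= n)%N -> (N <= m)%N ->
    Ex mu (fun x => `|X n x - X m x|) <= 2 * (2^-1) ^+ k.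
  move=> k; have h0 : 0 < (2^-1 : R) ^+ k by rewrite exprn_gt0// invr_gt0.
  have [|N HN] := cX ((2^-1) ^+ k * (2^-1) ^+ k); first exact: mulr_gt0.
  exists N => n m Nn Nm; set h := _ ^+ k in h0 HN *.
  have bsq : bmf (fun x => (X n x - X m x) ^+ 2) by apply: bmf_exp; exact: bmfB.
  (* The inequality [|u| <= h + u ^+ 2 / h] replaces Cauchy-Schwarz; with second moment at most
     [h ^+ 2] it gives the bound [2 * h]. *)
  apply: (@le_trans _ _ (Ex mu (fun x => h + h^-1 * (X n x - X m x) ^+ 2))).
    apply: le_Ex => //.
      by apply: bmfD; [exact: bmf_cst|apply: bmfM => //; exact: bmf_cst].
    move=> x; set u := _ - _.
    have -> : h + h^-1 * u ^+ 2 = (h ^+ 2 + `|u| ^+ 2) / h.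
      by rewrite real_normK ?num_real//; field; rewrite gt_eqF.
    by rewrite ler_pdivlMr//; have := sqr_ge0 (h - `|u|); have := normr_ge0 u; nra.
  rewrite ExD; [|exact: bmf_cst|by apply: bmfM => //; exact: bmf_cst].
  rewrite Ex_cst ExZl// (_ : 2 * h = h + h^-1 * (h * h)); last by field; rewrite gt_eqF.
  by rewrite lerD2l ler_wpM2l ?invr_ge0 ?(ltW h0)// HN.
(* Partial sums of [N] are nondecreasing, so every index from [g k] on dominates all earlier
   thresholds. *)
pose g k := (\sum_(j < k.+1) N j)%N.
have Ng k : (N k <= g k)%N by rewrite /g big_ord_recr/= leq_addl.
have Ngm k j : (k <= j)%N -> (N k <= g j)%N.
  move=> kj; rewrite (leq_trans (Ng k))// /g.
  by rewrite -!(big_mkord xpredT N)/= [leqRHS](@big_cat_nat _ _ _ k.+1)//= leq_addr.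
pose Y0 k := X (g k).
pose Y x := Num.max 0 (Num.min 1 (limn_sup (Y0 ^~ x))).
have ub t : has_ubound (range (Y0 ^~ t)).
  by exists 1 => _ [n _ <-]; have /andP[] := X01 (g n) t.
have lb t : has_lbound (range (Y0 ^~ t)).
  by exists 0 => _ [n _ <-]; have /andP[] := X01 (g n) t.
have mY : measurable_fun setT Y.
  apply: measurable_maxr => //; apply: measurable_minr => //.
  by apply: measurable_fun_limn_sup => // n; exact: mX.
have cvgY x : cvgn (Y0 ^~ x) -> Y0 n x @[n --> \oo] --> Y x.
  move=> c; have l : limn_sup (Y0 ^~ x) = limn (Y0 ^~ x).
    by apply: cvg_lim => //; exact: cvg_sups.
  rewrite /Y l min_r ?max_r//.
    by apply: limr_ge => //; apply: nearW => n; have /andP[] := X01 (g n) x.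
  by apply: limr_le => //; apply: nearW => n; have /andP[] := X01 (g n) x.
have aeY : {ae mu, forall x, cvgn (Y0 ^~ x)}.
  have mD k : measurable_fun setT (fun x => `|Y0 k.+1 x - Y0 k x|%:E).
    by apply/measurable_EFinP; have [] := bXX (g k.+1) (g k).
  have iD : (\int[mu]_x (\sum_(k <oo) `|Y0 k.+1 x - Y0 k x|%:E) < +oo)%E.
    rewrite integral_nneseries//.
    apply: (@le_lt_trans _ _ (\sum_(k <oo) (2 * (2^-1) ^+ k : R)%:E)%E).
      apply: lee_nneseries => [k *|k *]; first by apply: integral_ge0 => x _; rewrite lee_fin.
      rewrite Ex_EFin; last exact: bXX.
      by rewrite lee_fin; apply: HN; exact: Ngm.
    rewrite (_ : (\sum_(k <oo) _)%E = (2 * (1 - 2^-1)^-1 : R)%:E) ?ltry//.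
    apply/cvg_lim => //.
    apply: cvg_EFin; first by apply: nearW => n; rewrite sumEFin.
    under eq_cvg do rewrite /= sumEFin /=.
    have := @cvg_geometric_series R 2 2^-1.
    have -> : `|2^-1 : R| < 1 by rewrite gtr0_norm ?invr_gt0// invf_lt1// ltr1n.
    by move=> /(_ isT).
  have : mu.-integrable setT (fun x => \sum_(k <oo) `|Y0 k.+1 x - Y0 k x|%:E)%E.
    apply/integrableP; split; first exact: ge0_emeasurable_sum.
    by under eq_integral do rewrite gee0_abs ?nneseries_ge0//.
  move/(integrable_ae measurableT); apply: filterS => x /(_ I) fs.
  have : cvgn (series (fun k => Y0 k.+1 x - Y0 k x)).
    apply: normed_cvg.
    have := fs; rewrite fin_numE => /andP[_ /eqP hy].
    apply: nondecreasing_is_cvgn.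
      by apply/nondecreasing_seqP => n; rewrite /normed_series_of /series/= big_nat_recr//= lerDl.
    exists (fine (\sum_(k <oo) `|Y0 k.+1 x - Y0 k x|%:E)%E) => _ [n _ <-].
    rewrite -lee_fin fineK// /normed_series_of /series/= -sumEFin.
    exact: nneseries_lim_ge.
  move=> /cvg_ex[l hl]; apply/cvg_ex; exists (Y0 0%N x + l).
  rewrite (_ : Y0^~ x = fun n => Y0 0%N x + series (fun k => Y0 k.+1 x - Y0 k x) n).
    by apply: cvgD => //; exact: cvg_cst.
  by apply/funext => n; exact: (eq_sum_telescope (Y0^~x) n).
have Y01 x : 0 <= Y x <= 1.
  by rewrite /Y le_max lexx/= ge_max ler01 ge_min lexx.
exists Y; split => //.
have bY : bmf Y := bmf_01 mY Y01.
have bXY n : bmf (fun x => `|X n x - Y x|) by apply: bmf_norm; exact: bmfB.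
have key k n : (N k <= n)%N -> Ex mu (fun x => `|X n x - Y x|) <= 2 * (2^-1) ^+ k.
  move=> Nn.
  have XY : Ex mu (fun x => `|X n x - Y0 j x|) @[j --> \oo] --> Ex mu (fun x => `|X n x - Y x|).
    apply: (@Ex_cvg _ _ _ _ 1) => //.
    - by move=> j; have [] := bXX n (g j).
    - move=> j x; rewrite normr_id ler_norml.
      have /andP[? ?] := X01 n x; have /andP[? ?] := X01 (g j) x; rewrite /Y0.
      by apply/andP; split; lra.
    apply: filterS aeY => x /cvgY cx; apply: cvg_norm; apply: cvgB => //; exact: cvg_cst.
  rewrite -(cvg_lim (@Rhausdorff R) XY); apply: limr_le; first by apply/cvg_ex; eexists; exact: XY.
  near=> j; apply: HN => //; apply: Ngm; near: j; exact: nbhs_infty_ge.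
apply/cvgrPdist_le => e e0.
have : geometric 2 (2^-1 : R) @ \oo --> (0 : R).
  by apply: cvg_geometric; rewrite gtr0_norm ?invr_gt0// invf_lt1// ltr1n.
move=> /cvgrPdist_le/(_ e e0)[k _ hk].
near=> n; rewrite sub0r normrN ger0_norm; last exact: Ex_ge0.
apply: (le_trans (key k n _)); first by near: n; exact: nbhs_infty_ge.
by have := hk k (leqnn k); rewrite /= sub0r normrN; apply: le_trans; exact: ler_norm.
Unshelve. all: by end_near. Qed.

End L1_limit.

(** * Gamma and Beta laws *)

Section density.
Context {R : realType}.
Local Notation mu := (@lebesgue_measure R).
Variables (D : set R) (f : R -> R).
Hypotheses (mD : measurable D) (mf : measurable_fun D f) (f0 : forall x, D x -> 0 <= f x).
Hypotheses (f_fin : (\int[mu]_(x in D) (f x)%:E < +oo)%E) (f_pos : 0 < \int[mu]_(x in D) f x).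

Let I := \int[mu]_(x in D) f x.

Let dens : set R -> \bar R := normalized D f.

Let fE : (\int[mu]_(x in D) (f x)%:E)%E = I%:E.
Proof.
rewrite /I /Rintegral fineK// ge0_fin_numE//.
by apply: integral_ge0 => x /f0; rewrite lee_fin.
Qed.

Let I0 : 0 <= I^-1. Proof. by rewrite invr_ge0 ltW. Qed.

Let dens0 : dens set0 = 0%E.
Proof. by rewrite /dens /normalized set0I integral_set0 mule0. Qed.

Let dens_ge0 A : (0 <= dens A)%E.
Proof.
rewrite /dens /normalized mule_ge0 ?lee_fin//.
by apply: integral_ge0 => x [_ /f0]; rewrite lee_fin.
Qed.

Let dens_sigma_additive : semi_sigma_additive dens.
Proof.
move=> F mF tF mUF; rewrite /dens /normalized.
rewrite setI_bigcupl ge0_integral_bigcup//; last 4 first.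
- by move=> n; exact: (measurableI _ _ (mF n) mD).
- apply/measurable_EFinP; apply: measurable_funS mf => //.
  by move=> x [n _ []].
- by move=> x [n _ [_ /f0]]; rewrite lee_fin.
- exact: trivIset_setIr.
rewrite -nneseriesZl; last first.
  by move=> n _; apply: integral_ge0 => x [_ /f0]; rewrite lee_fin.
apply: is_cvg_ereal_nneg_natsum => n _.
rewrite mule_ge0 ?lee_fin//.
by apply: integral_ge0 => x [_ /f0]; rewrite lee_fin.
Qed.

HB.instance Definition _ := isMeasure.Build _ _ _ dens dens0 dens_ge0 dens_sigma_additive.

Let dens_setT : dens setT = 1%E.
Proof. by rewrite /dens /normalized setTI fE -EFinM mulVf// gt_eqF. Qed.

HB.instance Definition _ := @Measure_isProbability.Build _ _ R dens dens_setT.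

Import HBNNSimple.

Let integral_dens (h : R -> \bar R) : measurable_fun setT h -> (forall x, 0 <= h x)%E ->
  (\int[dens]_x h x = I^-1%:E * \int[mu]_(x in D) (h x * (f x)%:E))%E.
Proof.
move=> mh h0; pose g := nnsfun_approx measurableT mh.
have g_cvg x : (EFin \o g ^~ x) n @[n --> \oo] --> h x by exact: cvg_nnsfun_approx.
have hE x : (h x = limn (EFin \o g ^~ x))%E by apply/esym/cvg_lim.
have gle x n k : (n <= k)%N -> (g n x <= g k x).
  by move=> nk; exact/lefP/nd_nnsfun_approx.
have mEf : measurable_fun D (EFin \o f) by exact/measurable_EFinP.
have mgf n : measurable_fun D (fun x => (g n x)%:E * (f x)%:E)%E.
  by apply: emeasurable_funM => //; apply/measurable_EFinP/measurable_funTS.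
have gf0 n x : D x -> (0 <= (g n x)%:E * (f x)%:E)%E by move=> /f0 ?; rewrite mule_ge0 ?lee_fin.
have -> : (\int[dens]_x h x = limn (fun n => \int[dens]_x (g n x)%:E))%E.
  rewrite -monotone_convergence//; first by apply: eq_integral => x _; rewrite hE.
  - by move=> n; apply/measurable_EFinP.
  - by move=> n x _; rewrite lee_fin.
  - by move=> x _ a b ab; rewrite lee_fin gle.
have -> : (\int[mu]_(x in D) (h x * (f x)%:E) = limn (fun n => \int[mu]_(x in D) ((g n x)%:E * (f x)%:E)))%E.
  rewrite -monotone_convergence//; last first.
    by move=> x Dx a b ab; rewrite lee_wpmul2r ?lee_fin ?f0// gle.
  by apply: eq_integral => x _; apply/esym; apply: (cvg_lim _ (cvgeZr _ (g_cvg x))).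
rewrite -limeMl//; last first.
  apply: ereal_nondecreasing_is_cvgn => a b ab; apply: ge0_le_integral; [exact: mD|exact: gf0|exact: mgf|exact: mgf|].
  by move=> x Dx; rewrite lee_wpmul2r ?lee_fin ?f0// gle.
congr (limn _); apply/funext => n.
have mp r : measurable (g n @^-1` [set r]).
  by rewrite -[X in measurable X]setTI; exact: measurable_funPT.
have indich m r : measurable_fun setT (fun x => (r * \1_(g m @^-1` [set r]) x)%:E).
  by apply/measurable_EFinP/measurable_funM => //; exact: measurable_indic.
have ind0 r x : (0 <= (r * \1_(g n @^-1` [set r]) x)%:E)%E by exact: nnfun_muleindic_ge0.
transitivity (\int[dens]_x (\sum_(y \in range (g n)) (y * \1_(g n @^-1` [set y]) x)%:E))%E.
  by apply: eq_integral => t tE; rewrite fimfunE -fsumEFin.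
rewrite ge0_integral_fsum//.
transitivity (I^-1%:E * \int[mu]_(x in D) (\sum_(y \in range (g n))
    (y * \1_(g n @^-1` [set y]) x)%:E * (f x)%:E))%E; last first.
  congr (_ * _)%E; apply: eq_integral => x xE.
  by rewrite -ge0_mule_fsuml ?fsumEFin -?fimfunE// => y; exact: nnfun_muleindic_ge0.
rewrite ge0_integral_fsum//; last 2 first.
- by move=> y; apply: emeasurable_funM => //; exact: (measurable_funTS (indich n y)).
- by move=> y x /f0 ?; apply: mule_ge0; [exact: ind0|rewrite lee_fin].
rewrite ge0_mule_fsumr; last first.
  by move=> y; apply: integral_ge0 => x /f0 ?; apply: mule_ge0; [exact: ind0|rewrite lee_fin].
apply: eq_fsbigr => r /set_mem[t _ <-].
under eq_integral do rewrite EFinM.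
rewrite ge0_integralZl//=; last 2 first.
- by apply/measurable_EFinP; exact: measurable_indic.
- by rewrite lee_fin.
under [X in (_ = _ * X)%E]eq_integral do rewrite EFinM -muleA.
rewrite ge0_integralZl//=; last 3 first.
- apply: emeasurable_funM; last exact: mEf.
  by apply/measurable_EFinP; apply: (measurable_funTS (measurable_indic (mp _))).
- by move=> x /f0 ?; rewrite mule_ge0 ?lee_fin.
- by rewrite lee_fin.
rewrite muleCA; congr (_ * _)%E; rewrite integral_indic// setIT /= /dens /normalized; congr (_ * _)%E.
rewrite setIC integral_mkcondr; apply: eq_integral => x _.
by rewrite epatch_indic muleC.
Qed.

(** [normalized] is only a set function. It becomes a probability here, and the density formula for
    nonnegative integrands is extended from simple functions by monotone convergence. *)
Lemma normalized_law : exists Q : probability R R,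
  (forall B, Q B = normalized D f B) /\
  forall h : R -> \bar R, measurable_fun setT h -> (forall x, 0 <= h x)%E ->
    (\int[Q]_x h x = (\int[mu]_(x in D) f x)^-1%:E * \int[mu]_(x in D) (h x * (f x)%:E))%E.
Proof. by exists dens; split => // h mh h0; exact: integral_dens. Qed.

End density.

(** * Integration by parts on an increasing union of segments *)

Section integration_by_parts.
Context {R : realType}.
Local Notation mu := (@lebesgue_measure R).

(** On each segment the fundamental theorem applies to [f1 - f2], and the boundary terms of [G]
    vanish in the limit. Both integrands are nonnegative, so the two sides converge monotonically
    and the equality holds in the extended reals, before finiteness of either side is known. *)
Lemma integral_eq_primitive (u v : nat -> R) (D : set R) (f1 f2 G : R -> R) :
  (forall n, u n < v n) -> (forall n, u n.+1 <= u n) -> (forall n, v n <= v n.+1) ->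
  D = \bigcup_n `[u n, v n]%classic ->
  (forall x, D x -> derivable f1 x 1) -> (forall x, D x -> derivable f2 x 1) ->
  (forall x, D x -> is_derive x 1 G (f1 x - f2 x)) ->
  (forall x, D x -> 0 <= f1 x) -> (forall x, D x -> 0 <= f2 x) ->
  G (u n) @[n --> \oo] --> (0 : R) -> G (v n) @[n --> \oo] --> (0 : R) ->
  [/\ measurable_fun D f1, measurable_fun D f2 &
    (\int[mu]_(x in D) (f1 x)%:E = \int[mu]_(x in D) (f2 x)%:E)%E].
Proof.
move=> uv du dv DE df1 df2 dG f10 f20 Gu Gv.
have sub n x : `[u n, v n]%classic x -> D x by rewrite DE; exists n.
have cont (f : R -> R) n : (forall x, D x -> derivable f x 1) -> {within `[u n, v n], continuous f}.
  by move=> df; apply: derivable_within_continuous => x xn; exact/df/sub/xn.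
have mf (f : R -> R) n : (forall x, D x -> derivable f x 1) -> measurable_fun `[u n, v n] f.
  by move=> df; apply: subspace_continuous_measurable_fun => //; exact: cont.
have nd : nondecreasing_seq (fun n => `[u n, v n]%classic).
  apply/nondecreasing_seqP => n; rewrite subsetEset => x /=; rewrite !in_itv/= => /andP[a b].
  by rewrite (le_trans (du n))// (le_trans b).
have int (f : R -> R) n : (forall x, D x -> derivable f x 1) -> mu.-integrable `[u n, v n] (EFin \o f).
  by move=> df; apply: continuous_compact_integrable; [exact: segment_compact|exact: cont].
have lim_int (f : R -> R) : (forall x, D x -> derivable f x 1) -> (forall x, D x -> 0 <= f x) ->
    (\int[mu]_(x in `[u n, v n]) (f x)%:E)%E @[n --> \oo] --> (\int[mu]_(x in D) (f x)%:E)%E.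
  move=> df f0; rewrite DE; apply: ge0_nondecreasing_set_cvg_integral => //.
  - by move=> n; apply/measurable_EFinP; exact: mf.
  - by move=> n x /sub/f0; rewrite lee_fin.
split.
- by rewrite DE; apply/measurable_fun_bigcup => // n; exact: mf.
- by rewrite DE; apply/measurable_fun_bigcup => // n; exact: mf.
have parts n : (\int[mu]_(x in `[u n, v n]) (f1 x)%:E =
    \int[mu]_(x in `[u n, v n]) (f2 x)%:E + (G (v n) - G (u n))%:E)%E.
  have : (\int[mu]_(x in `[u n, v n]) (f1 x - f2 x)%:E = (G (v n))%:E - (G (u n))%:E)%E.
    apply: continuous_FTC2 => //.
    - apply: derivable_within_continuous => x xn.
      by apply: derivableB; [exact/df1/sub/xn|exact/df2/sub/xn].
    - have cG x : `[u n, v n]%classic x -> G y @[y --> x] --> G x.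
        move=> /sub/dG[dGx _]; exact/differentiable_continuous/derivable1_diffP.
      split.
      + by move=> x /subset_itv_oo_cc/sub/dG[].
      + apply/cvg_at_right_filter/cG => /=; by rewrite in_itv/= lexx ltW.
      + apply/cvg_at_left_filter/cG => /=; by rewrite in_itv/= lexx ltW.
    - move=> x /subset_itv_oo_cc xn; rewrite derive1E.
      exact: (@derive_val _ _ _ _ _ _ _ (dG x (sub n x xn))).
  rewrite integralB_EFin//; try exact: int.
  move=> e; rewrite EFinB -e addeC subeK//.
  by apply: integrable_fin_num => //; exact: int.
apply: (cvg_unique _ (lim_int _ df1 f10)) => //.
rewrite (_ : (fun n => _) = (fun n => \int[mu]_(x in `[u n, v n]) (f2 x)%:E + (G (v n) - G (u n))%:E)%E); last first.
  by apply/funext => n; exact: parts.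
have GD : (G (v n) - G (u n))%:E @[n --> \oo] --> (0 : R)%:E.
  by apply: cvg_EFin; [exact: nearW|rewrite -[X in _ --> X](subrr (0 : R)); exact: cvgB].
have /= := @cvgeD _ _ _ _ _ _ _ _ _ (lim_int _ df2 f20) GD.
by rewrite adde0; apply; rewrite fin_num_adde_defl.
Qed.

End integration_by_parts.

Section gamma.
Context {R : realType}.
Local Notation mu := (@lebesgue_measure R).

Lemma Rintegral_gt0 (D : set R) (f : R -> R) : measurable D -> measurable_fun D f ->
  (forall x, D x -> 0 < f x) -> (\int[mu]_(x in D) (f x)%:E < +oo)%E -> mu D != 0%E ->
  0 < \int[mu]_(x in D) f x.
Proof.
move=> mD mf f0 fin D0.
have i0 : (0 <= \int[mu]_(x in D) (f x)%:E)%E.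
  by apply: integral_ge0 => x /f0/ltW; rewrite lee_fin.
rewrite /Rintegral fine_gt0// fin andbT lt_neqAle i0 andbT; apply/eqP => /esym I0.
have : (\int[mu]_(x in D) `|(f x)%:E| = 0)%E.
  by rewrite -I0; apply: eq_integral => x /set_mem/f0/ltW ?; rewrite gee0_abs ?lee_fin.
have mEf : measurable_fun D (EFin \o f) by exact/measurable_EFinP.
move/(ae_eq_integral_abs mu mD mEf) => [N [mN N0 sN]].
move/eqP: D0; apply; apply: subset_measure0 mN _ N0 => // x Dx.
by apply: sN => /= /(_ Dx) [] /eqP; rewrite gt_eqF// f0.
Qed.

Lemma cvg0_le_inv (g : nat -> R) (C : R) :
  (forall n, 0 <= g n <= C / n.+1%:R) -> g n @[n --> \oo] --> (0 : R).
Proof.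
move=> gC; apply: (@squeeze_cvgr _ _ _ _ (fun=> 0) (fun n => C * n.+1%:R^-1)).
- by apply: nearW.
- exact: cvg_cst.
- have : (fun=> C) n * n.+1%:R^-1 @[n --> \oo] --> C * 0.
    by apply: cvgM; [exact: cvg_cst|exact: cvg_harmonic].
  by rewrite mulr0.
Qed.

(** From [ln u <= u] at [u = x / (2 * b)]: half of the exponential decay absorbs the power. *)
Lemma powR_expRN_le (b x : R) : 0 < b -> 0 < x ->
  x `^ b * expR (- x) <= expR (b * ln (2 * b)) * expR (- (x / 2)).
Proof.
move=> b0 x0; rewrite /powR gt_eqF// -!expRD ler_expR.
have : ln (x / (2 * b)) <= x / (2 * b) by rewrite ltW// ln_sublinear// divr_gt0// mulr_gt0.
rewrite ln_div ?posrE ?mulr_gt0// lerBlDr => /(ler_wpM2l (ltW b0)).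
rewrite mulrDr (_ : b * (x / (2 * b)) = x / 2); last by field; rewrite gt_eqF.
lra.
Qed.

Lemma is_derive_invX (s x : R) (K : nat) : x + s != 0 ->
  is_derive x 1 (fun y => (y + s)^-1 ^+ K) (- (K%:R * (x + s)^-1 ^+ K.+1)).
Proof.
move=> xs; have dV : is_derive x (1 : R) (fun y => (y + s)^-1) (- (x + s)^-1 ^+ 2).
  have [ds vs] := is_derive_shift x 1 s.
  apply: DeriveDef; first exact: derivableV.
  by rewrite (deriveV (f := shift s))// vs /GRing.scale/= mulr1 exprVn.
elim: K => [|K ih].
  rewrite (_ : (fun _ => _) = cst 1); last by apply/funext => y; rewrite expr0.
  by apply: is_derive_eq; rewrite mul0r oppr0.
rewrite (_ : (fun _ => _) = (fun y => (y + s)^-1) * (fun y => (y + s)^-1 ^+ K)); last first.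
  by apply/funext => y; rewrite exprS.
apply: is_derive_eq; rewrite /GRing.scale/= -natr1 !exprS; ring.
Qed.

(** The primitive is [x ^ b * exp (- x) / (x + s) ^ K]. The factor in [x + s] is there for
    normalised gammas: [s] will stand for the sum of the other variables plus a regularising
    constant. *)
Lemma gamma_ibp (b s : R) (K : nat) : 0 < b -> 0 < s ->
  let w x := (x + s)^-1 in
  let f1 x := b * x `^ (b - 1) * expR (- x) * w x ^+ K in
  let f2 x := x `^ b * expR (- x) * (w x ^+ K + K%:R * w x ^+ K.+1) in
  let D : set R := `]0, +oo[%classic in
  [/\ measurable_fun D f1, measurable_fun D f2 &
  (\int[mu]_(x in D) (f1 x)%:E = \int[mu]_(x in D) (f2 x)%:E)%E].
Proof.
move=> b0 s0 w f1 f2 D.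
have w0 x : 0 < x -> 0 < w x by move=> x0; rewrite invr_gt0 addr_gt0.
have pos x : D x -> 0 < x by rewrite /D/= in_itv/= andbT.
have xs x : 0 < x -> x + s != 0 by move=> x0; rewrite gt_eqF// addr_gt0.
have dw L x : 0 < x -> derivable (fun y => w y ^+ L) x 1.
  by move=> x0; have [] := @is_derive_invX s x L (xs _ x0).
have dp (c x : R) : 0 < x -> derivable (fun y => y `^ c) x 1.
  by move=> x0; apply: derivable_powR; rewrite in_itv/= x0.
have dexp (x : R) : is_derive x (1 : R) (fun y => expR (- y)) (- expR (- x)).
  by apply: is_derive_eq; rewrite /GRing.scale/=; ring.
have de (x : R) : derivable (fun y => expR (- y)) x (1 : R) by have [] := dexp x.
pose G x := x `^ b * expR (- x) * w x ^+ K.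
have G0 x : 0 < x -> 0 <= G x.
  by move=> x0; rewrite !mulr_ge0 ?powR_ge0 ?expR_ge0// exprn_ge0// ltW// w0.
have wle x : 0 < x -> w x ^+ K <= s^-1 ^+ K.
  move=> x0; apply: lerXn2r; rewrite ?nnegrE ?(ltW (w0 _ x0)) ?invr_ge0 ?(ltW s0)//.
  by rewrite /w lef_pV2 ?posrE ?addr_gt0// lerDr ltW.
(* Exponentially small left endpoints make the boundary term [O(1 / n)] for every [b > 0]; endpoints
   [1 / n] would only give [n ^ (- b)]. *)
apply: (@integral_eq_primitive _ (fun n => expR (- n.+1%:R)) (fun n => n.+1%:R) _ _ _ G).
- move=> n; apply: (@lt_le_trans _ _ 1); last by rewrite ler1n.
  by rewrite expR_lt1 oppr_lt0 ltr0n.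
- by move=> n; rewrite ler_expR lerN2 ler_nat.
- by move=> n; rewrite ler_nat.
- rewrite /D; apply/seteqP; split => x /=.
    rewrite in_itv/= andbT => x0; pose n := (Num.bound x + Num.bound `|ln x|)%N.
    have xn : x <= n.+1%:R.
      rewrite (le_trans (ltW (archi_boundP (ltW x0))))// ler_nat ltnW// ltnS leq_addr//.
    have lxn : - ln x <= n.+1%:R.
      rewrite (le_trans (ler_norm _))// normrN.
      by rewrite (le_trans (ltW (archi_boundP (normr_ge0 _))))// ler_nat ltnW// ltnS leq_addl.
    by exists n => //=; rewrite in_itv/= xn andbT -[leRHS]lnK ?posrE// ler_expR lerNl.
  by move=> [n _] /=; rewrite !in_itv/= andbT => /andP[+ _]; apply: lt_le_trans; exact: expR_gt0.
- move=> x /pos x0; rewrite /f1; apply: derivableM; last exact: dw.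
  by apply: derivableM => //; apply: derivableM => //; exact: dp.
- move=> x /pos x0; rewrite /f2; apply: derivableM.
    by apply: derivableM => //; exact: dp.
  apply: derivableD; first exact: dw.
  by apply: derivableM => //; exact: dw.
- move=> x /pos x0; have dK := @is_derive_invX s x K (xs _ x0).
  have dP := is_derive1_powR b x0.
  rewrite (_ : G = (fun y => y `^ b) * (fun y => expR (- y)) * (fun y => (y + s)^-1 ^+ K))//.
  apply: is_derive_eq; rewrite /f1 /f2 /GRing.scale/= /w.
  rewrite (_ : ((fun y => y `^ b) * (fun y => expR (- y))) x = x `^ b * expR (- x))//.
  have -> : x `^ b = x * x `^ (b - 1).
    have {1}-> : b = 1 + (b - 1) by ring.
    rewrite (powRD (r := 1)); last by rewrite (gt_eqF x0) implybT.
    by rewrite powRr1// ltW.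
  ring.
- move=> x /pos x0; have wx := ltW (w0 _ x0).
  by rewrite /f1 !mulr_ge0 ?powR_ge0 ?expR_ge0 ?exprn_ge0// ltW.
- move=> x /pos x0; have wx := ltW (w0 _ x0).
  by rewrite /f2 !mulr_ge0 ?powR_ge0 ?expR_ge0// addr_ge0 ?mulr_ge0 ?exprn_ge0.
- apply: (@cvg0_le_inv _ (s^-1 ^+ K / b)) => n; rewrite G0 ?expR_gt0//= /G.
  have := expR_gt0 (- n.+1%:R : R); set x := expR _ => x0.
  rewrite mulrC [X in _ <= X](_ : _ = s^-1 ^+ K * (b * n.+1%:R)^-1); last first.
    by rewrite invfM; ring.
  apply: ler_pM; rewrite ?mulr_ge0 ?powR_ge0 ?expR_ge0 ?exprn_ge0 ?wle ?(ltW (w0 _ _))//.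
  apply: (@le_trans _ _ (x `^ b)); first by rewrite ler_piMr ?powR_ge0// expR_le1 oppr_le0 ltW.
  rewrite /x -expRM mulNr mulrC expRN lef_pV2 ?posrE ?expR_gt0 ?mulr_gt0//.
  by apply: le_trans (expR_ge1Dx _); rewrite lerDr.
- apply: (@cvg0_le_inv _ (s^-1 ^+ K * (expR (b * ln (2 * b)) * 2))) => n; rewrite G0//= /G.
  rewrite mulrC -[leRHS]mulrA; apply: ler_pM; rewrite ?mulr_ge0 ?powR_ge0 ?expR_ge0 ?exprn_ge0 ?wle ?(ltW (w0 _ _))//.
  apply: (le_trans (powR_expRN_le b0 _)) => //; rewrite -mulrA ler_wpM2l ?expR_ge0//.
  rewrite expRN -[leRHS]invf_div lef_pV2 ?posrE ?expR_gt0 ?divr_gt0//.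
  by apply: le_trans (expR_ge1Dx _); rewrite lerDr.
Qed.

End gamma.

Lemma measurable_invr_ge0 {d} {T : measurableType d} {R : realType} (f : T -> R) :
  measurable_fun setT f -> (forall x, 0 <= f x) -> measurable_fun setT (fun x => (f x)^-1).
Proof.
move=> mf f0; rewrite (_ : (fun _ => _) = (fun x => f x `^ (-1))).
  exact: (measurableT_comp (measurable_powR (-1)) mf).
by apply/funext => x; rewrite powR_inv1.
Qed.

Section gamma_moments.
Context {R : realType}.
Local Notation mu := (@lebesgue_measure R).

Let D : set R := `]0, +oo[%classic.
Let mD : measurable D. Proof. exact: measurable_itv. Qed.

Let Dpos x : D x -> 0 < x. Proof. by rewrite /D/= in_itv/= andbT. Qed.

Let gdens (a : R) := fun x : R => x `^ (a - 1) * expR (- x).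

Let measurable_gdens a : 0 < a -> measurable_fun D (gdens a).
Proof.
move=> a0; have [m _ _] := gamma_ibp 0 a0 (@ltr01 R).
rewrite (_ : gdens a = fun x => a^-1 * (a * x `^ (a - 1) * expR (- x) * (x + 1)^-1 ^+ 0)).
  by apply: measurable_funM.
by apply/funext => x; rewrite expr0 mulr1 !mulrA mulVf ?gt_eqF// mul1r.
Qed.

(** For shapes above 1 the density is bounded by a multiple of the exponential density of rate
    [1 / 2]. *)
Let gdens_fin1 b : 0 < b -> (\int[mu]_(x in D) (gdens (b + 1) x)%:E < +oo)%E.
Proof.
move=> b0; pose C := expR (b * ln (2 * b)).
apply: (@le_lt_trans _ _ (\int[mu]_(x in D) ((2 * C)%:E * (exponential_pdf 2^-1 x)%:E))%E).
  apply: ge0_le_integral => //=.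
  - by move=> x _; rewrite lee_fin mulr_ge0 ?powR_ge0 ?expR_ge0.
  - by apply/measurable_EFinP; apply: measurable_gdens; rewrite addr_gt0.
  - apply: emeasurable_funM => //; apply/measurable_EFinP.
    by apply: measurable_funTS; apply: measurable_exponential_pdf.
  move=> x /Dpos x0; have -> : exponential_pdf 2^-1 x = 2^-1 * expR (- 2^-1 * x) :> R.
    by rewrite exponential_pdfE ?ltW.
  rewrite -EFinM lee_fin /gdens addrK (_ : 2 * C * _ = C * expR (- (x / 2))).
    exact: powR_expRN_le.
  by rewrite (_ : - (x / 2) = - 2^-1 * x); field.
rewrite ge0_integralZl//; last 3 first.
- by apply/measurable_EFinP; apply: measurable_funTS; apply: measurable_exponential_pdf.
- by move=> x _; rewrite lee_fin; apply: exponential_pdf_ge0.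
- by rewrite lee_fin mulr_ge0// expR_ge0.
apply: (@le_lt_trans _ _ ((2 * C)%:E * 1)%E); last by rewrite mule1 ltry.
rewrite lee_wpmul2l ?lee_fin ?mulr_ge0 ?expR_ge0//.
rewrite -(@integral_exponential_pdf R 2^-1)//; apply: ge0_subset_integral => //.
- by apply/measurable_EFinP; apply: measurable_exponential_pdf.
- by move=> x _; rewrite lee_fin; apply: exponential_pdf_ge0.
Qed.

(** Shapes below 1 have a singularity at the origin. The case [K = 0] of [gamma_ibp] holds in the
    extended reals and transfers finiteness from shape [a + 1] to shape [a]. *)
Let gdens_fin a : 0 < a -> (\int[mu]_(x in D) (gdens a x)%:E < +oo)%E.
Proof.
move=> a0; have [m1 m2 e] := gamma_ibp 0 a0 (@ltr01 R).
have e1 : (\int[mu]_(x in D) (a%:E * (gdens a x)%:E) = \int[mu]_(x in D) (gdens (a + 1) x)%:E)%E.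
  etransitivity; last (etransitivity; first exact: e).
    by apply: eq_integral => x _; rewrite expr0 mulr1 /gdens -EFinM mulrA.
  by apply: eq_integral => x _; rewrite expr0 mul0r addr0 mulr1 /gdens addrK.
have := gdens_fin1 a0; rewrite -e1 ge0_integralZl//; last 3 first.
- by apply/measurable_EFinP; exact: measurable_gdens.
- by move=> x _; rewrite lee_fin mulr_ge0 ?powR_ge0 ?expR_ge0.
- by rewrite lee_fin ltW.
set J := (X in (a%:E * X)%E); rewrite -/J; case: J => [r||] //; rewrite ?ltry//.
by rewrite gt0_muley ?lte_fin.
Qed.

(** This is E[X f(X)] = E[a f(X) + X f'(X)] for f a power of [x] times a power of [1 / (x + s)],
    with the negative part of X f' moved across so that both sides are integrals of nonnegative
    functions. The truncation [y] makes the variable nonnegative everywhere and not only almost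
    surely. *)
Lemma gamma_law_moments (a : R) : 0 <= a ->
  let y (x : R) := Num.max 0 x in exists Q : probability R R,
  [/\ forall B : set R, measurable B -> Q (y @^-1` B) = gamma_law a B &
   forall (k K : nat) (s : R), 0 < s -> let w x := (y x + s)^-1 in
    (\int[Q]_x ((a + k%:R) * (y x ^+ k * w x ^+ K))%:E =
     \int[Q]_x (y x ^+ k.+1 * w x ^+ K + K%:R * (y x ^+ k.+1 * w x ^+ K.+1))%:E)%E].
Proof.
move=> + y; have y0 x : 0 <= y x by rewrite le_max lexx.
have my : measurable_fun setT y by exact: measurable_maxr.
have mw (s : R) : 0 < s -> measurable_fun setT (fun x => (y x + s)^-1).
  move=> s0; apply: measurable_invr_ge0 => [|x]; last by rewrite addr_ge0// ltW.
  exact: measurable_funD.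
have mL (c s : R) k K : 0 < s -> measurable_fun setT (fun x => c * (y x ^+ k * (y x + s)^-1 ^+ K)).
  move=> s0; apply: measurable_funM => //; apply: measurable_funM; apply: measurable_funX => //.
  exact: mw.
have mR (s : R) k K : 0 < s -> measurable_fun setT
    (fun x => y x ^+ k * (y x + s)^-1 ^+ K + K%:R * (y x ^+ k * (y x + s)^-1 ^+ K.+1)).
  move=> s0; apply: measurable_funD; last exact: mL.
  by apply: measurable_funM; apply: measurable_funX => //; exact: mw.
rewrite le_eqVlt => /predU1P[<-|a0].
  exists (dirac (0 : R)); split => [B mB|k K s s0 w].
    rewrite /gamma_law eqxx /dirac; congr (_%:E); apply: indic_bool.
    by rewrite inE/= /y maxxx.
  have m (h : R -> R) : measurable_fun setT h -> (\int[@dirac _ R 0%R R]_x (h x)%:E = (h 0%R)%:E)%E.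
    by move=> mh; rewrite integral_dirac// ?diracT ?mul1e//; apply/measurable_EFinP.
  rewrite !m; [|exact: mR|exact: mL].
  rewrite add0r (_ : y 0 = 0) ?expr0n; last exact: maxxx.
  by case: k => [|k] /=; rewrite !(mul0r, mulr0, addr0).
have f0 x : D x -> 0 < gdens a x by move/Dpos => x0; rewrite mulr_gt0 ?powR_gt0 ?expR_gt0.
have Ipos : 0 < \int[mu]_(x in D) gdens a x.
  apply: Rintegral_gt0 => //; [exact: measurable_gdens|exact: gdens_fin|].
  by rewrite /D lebesgue_measure_itv/= ltry.
have [Q [QE intQ]] := normalized_law mD (measurable_gdens a0) (fun x h => ltW (f0 x h)) (gdens_fin a0) Ipos.
have yD x : D x -> y x = x by move/Dpos => x0; rewrite /y max_r// ltW.
exists Q; split.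
  move=> B mB; rewrite QE /gamma_law gt_eqF//; congr (_ * integral _ _ _)%E.
  by apply/seteqP; split => x [] /= + Dx; rewrite yD.
move=> k K s s0 w; have w0 x : 0 <= w x by rewrite invr_ge0 addr_ge0// ltW.
have a_ge0 := ltW a0.
rewrite !intQ; last 4 first.
- by apply/measurable_EFinP; exact: mR.
- by move=> x; rewrite lee_fin addr_ge0 ?mulr_ge0 ?exprn_ge0.
- by apply/measurable_EFinP; exact: mL.
- by move=> x; rewrite lee_fin !mulr_ge0 ?addr_ge0 ?exprn_ge0.
congr (_ * _)%E.
have ak : 0 < a + k%:R by rewrite ltr_pwDl.
(* The power [y ^+ k] is absorbed into the density, which raises the shape to [a + k]. *)
have [m1 m2 e] := gamma_ibp K ak s0.
have pD (b x : R) j : D x -> x `^ (b + j%:R) = x `^ b * x ^+ j.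
  move/Dpos => x0; rewrite powRD ?powR_mulrn ?ltW//.
  by rewrite (gt_eqF x0) implybT.
etransitivity; last (etransitivity; first exact: e).
  apply: eq_integral => x /set_mem Dx; rewrite -EFinM /gdens /w yD//.
  by rewrite [a + _ - 1]addrAC pD//; congr EFin; ring.
apply: eq_integral => x /set_mem Dx; rewrite -EFinM /gdens /w yD//.
rewrite [in LHS](_ : a + k%:R = a - 1 + k.+1%:R); last by rewrite -natr1; ring.
by rewrite pD//; congr EFin; ring.
Qed.

End gamma_moments.

Section beta_moments.
Context {R : realType}.
Local Notation mu := (@lebesgue_measure R).

Let D : set R := `]0, 1[%classic.
Let mD : measurable D. Proof. exact: measurable_itv. Qed.

Let D01 x : D x -> 0 < x < 1. Proof. by rewrite /D/= in_itv. Qed.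

Let bdens (a b : R) := fun x : R => x `^ (a - 1) * (1 - x) `^ (b - 1).

Let bdens_ge0 a b x : 0 <= bdens a b x. Proof. by rewrite mulr_ge0 ?powR_ge0. Qed.

Let I a b := (\int[mu]_(x in D) (bdens a b x)%:E)%E.

Let measurable_bdens a b : measurable_fun setT (bdens a b).
Proof.
apply: measurable_funM; first exact: measurable_powR.
by apply: (measurableT_comp (measurable_powR (b - 1))); exact: measurable_funB.
Qed.

Let mbD a b : measurable_fun D (EFin \o bdens a b).
Proof. by apply/measurable_EFinP/measurable_funTS; exact: measurable_bdens. Qed.

Let intZ (k a b : R) : 0 <= k -> (\int[mu]_(x in D) (k * bdens a b x)%:E = k%:E * I a b)%E.
Proof.
move=> k0; rewrite -ge0_integralZl//; [exact: mbD|by move=> x _; rewrite lee_fin bdens_ge0].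
Qed.

Let powR_le1 (c x : R) : 0 < c -> 0 <= x <= 1 -> x `^ c <= 1.
Proof.
move=> c0 /andP[x0 x1]; have <- : 1 `^ c = 1 :> R by rewrite powR1.
by apply: ge0_ler_powR; rewrite ?nnegrE ?(ltW c0) ?ler01.
Qed.

Let powR_pred (x b : R) : 0 < x -> x `^ b = x * x `^ (b - 1).
Proof.
move=> x0; have {1}-> : b = 1 + (b - 1) by ring.
rewrite (powRD (r := 1)); last by rewrite (gt_eqF x0) implybT.
by rewrite powRr1// ltW.
Qed.

Let split_bdens a b : (I a b = I (a + 1) b + I a (b + 1))%E.
Proof.
rewrite /I -ge0_integralD//; try by move=> x _; rewrite lee_fin bdens_ge0.
- apply: eq_integral => x /set_mem/D01/andP[x0 x1].
  rewrite -EFinD /bdens !addrK (@powR_pred x a) // (@powR_pred (1 - x) b) ?subr_gt0//.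
  by congr EFin; ring.
- exact: mbD.
- exact: mbD.
Qed.

Let ibp_bdens a b : 0 < a -> 0 < b -> (a%:E * I a (b + 1) = b%:E * I (a + 1) b)%E.
Proof.
move=> a0 b0; rewrite -(@intZ a a (b + 1) (ltW a0)) -(@intZ b (a + 1) b (ltW b0)).
have dp (c x : R) : 0 < x -> is_derive x (1 : R) (fun y => y `^ c) (c * x `^ (c - 1)).
  by move=> x0; exact: is_derive1_powR.
have dq (c x : R) : x < 1 -> is_derive x (1 : R) (fun y => (1 - y) `^ c) (- (c * (1 - x) `^ (c - 1))).
  move=> x1; have d1 : is_derive x (1 : R) (fun y => 1 - y) (-1).
    rewrite (_ : (fun y => 1 - y) = cst 1 - id)//.
    by apply: is_derive_eq; rewrite sub0r.
  have := @is_derive1_comp _ (fun y => y `^ c) (fun y => 1 - y) _ _ _ (dp c (1 - x) _) d1.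
  by rewrite subr_gt0 mulrN1; apply.
have db (c e x : R) : D x -> derivable (bdens c e) x 1.
  move/D01/andP => [x0 x1]; have [d1 _] := dp (c - 1) x x0; have [d2 _] := dq (e - 1) x x1.
  exact: (derivableM d1 d2).
pose G (x : R) := x `^ a * (1 - x) `^ b.
(* Exponentially small cut-offs, as for the gamma law, give [O(1 / n)] boundary terms for all
   positive exponents; [u n < 1 / 2] ensures that [[u n, 1 - u n]] is a proper segment. *)
pose u n : R := expR (- n.+1%:R).
have u0 n : 0 < u n by exact: expR_gt0.
have u12 n : u n < 1 / 2.
  rewrite /u expRN mul1r ltf_pV2 ?posrE ?expR_gt0//.
  apply: (@le_lt_trans _ _ (1 + 1)); first by lra.
  by apply: lt_le_trans (expR_gt1Dx _) _; rewrite ?oner_eq0// ler_expR ler1n.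
have small c n : 0 < c -> u n `^ c <= c^-1 / n.+1%:R.
  move=> c0; rewrite -invfM /u -expRM mulNr mulrC expRN lef_pV2 ?posrE ?expR_gt0 ?mulr_gt0//.
  by apply: le_trans (expR_ge1Dx _); rewrite lerDr.
have v12 n : 0 <= 1 - u n <= 1.
  by have := u12 n; have := u0 n; lra.
have u01 n : 0 <= u n <= 1.
  by have := u12 n; have := u0 n; lra.
have and3 (P1 P2 P3 : Prop) : [/\ P1, P2 & P3] -> P3 by case.
apply: and3; apply: (@integral_eq_primitive _ u (fun n => 1 - u n) D (fun x => a * bdens a (b + 1) x)
  (fun x => b * bdens (a + 1) b x) G).
- by move=> n; have := u12 n; lra.
- by move=> n; rewrite ler_expR lerN2 ler_nat.
- by move=> n; rewrite lerB// ler_expR lerN2 ler_nat.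
- rewrite /D; apply/seteqP; split => x /=; last first.
    move=> [n _] /=; rewrite !in_itv/=; have := u0 n; have := u12 n.
    by move=> ? ? /andP[? ?]; apply/andP; split; lra.
  rewrite in_itv/= => /andP[x0 x1].
  have ex (y : R) : 0 < y -> exists N, forall n, (N <= n)%N -> u n <= y.
    move=> y0; exists (Num.bound `|ln y|) => n Nn.
    rewrite -[leRHS]lnK ?posrE// ler_expR lerNl (le_trans (ler_norm _))// normrN.
    by rewrite (le_trans (ltW (archi_boundP (normr_ge0 _))))// ler_nat ltnW// ltnS.
  have [N1 h1] := ex x x0; have [|N2 h2] := ex (1 - x); first by rewrite subr_gt0.
  exists (N1 + N2)%N => //=; rewrite in_itv/= h1 ?leq_addr//=.
  by rewrite lerBrDr -lerBrDl h2// leq_addl.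
- by move=> x Dx; apply: derivableM => //; exact: db.
- by move=> x Dx; apply: derivableM => //; exact: db.
- move=> x /D01/andP[x0 x1]; have dP := dp a x x0; have dQ := dq b x x1.
  rewrite (_ : G = (fun y => y `^ a) * (fun y => (1 - y) `^ b))//.
  apply: is_derive_eq; rewrite /bdens !addrK /GRing.scale/=; ring.
- by move=> x _; rewrite mulr_ge0 ?bdens_ge0 ?ltW.
- by move=> x _; rewrite mulr_ge0 ?bdens_ge0 ?ltW.
- apply: (@cvg0_le_inv _ _ a^-1) => n; rewrite /G mulr_ge0 ?powR_ge0//=.
  by apply: le_trans (small _ _ a0); rewrite ler_piMr ?powR_ge0// powR_le1.
- apply: (@cvg0_le_inv _ _ b^-1) => n; rewrite /G mulr_ge0 ?powR_ge0//= subKr.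
  by apply: le_trans (small _ _ b0); rewrite ler_piMl ?powR_ge0// powR_le1.
Qed.

Let I_ge0 a b : (0 <= I a b)%E.
Proof. by apply: integral_ge0 => x _; rewrite lee_fin bdens_ge0. Qed.

(** The recursion of the Beta integral: the splitting [x + (1 - x) = 1] combined with integration by
    parts. It is proved in the extended reals because it is the tool that yields finiteness. *)
Let stepl a b : 0 < a -> 0 < b -> (a%:E * I a b = (a + b)%:E * I (a + 1) b)%E.
Proof.
move=> a0 b0; rewrite (split_bdens a b) (ge0_muleDr _ (I_ge0 _ _) (I_ge0 _ _)) (ibp_bdens a0 b0).
by rewrite EFinD ge0_muleDl// lee_fin ltW.
Qed.

Let stepr a b : 0 < a -> 0 < b -> (b%:E * I a b = (a + b)%:E * I a (b + 1))%E.
Proof.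
move=> a0 b0; rewrite (split_bdens a b) (ge0_muleDr _ (I_ge0 _ _) (I_ge0 _ _)) -(ibp_bdens a0 b0).
by rewrite EFinD ge0_muleDl// lee_fin ltW.
Qed.

Let fin_scale (k l : R) (x y : \bar R) : 0 < k -> (0 <= x)%E -> (k%:E * x = l%:E * y)%E ->
  (y < +oo)%E -> (0 <= y)%E -> (x < +oo)%E.
Proof.
move=> k0; case: x => [x||]//; first by rewrite ltry.
by rewrite gt0_muley ?lte_fin//; case: y => // y _ [].
Qed.

(** Once both parameters are raised by one, the density is at most 1; the two recursions bring
    finiteness back to [a] and [b]. *)
Let I_fin a b : 0 < a -> 0 < b -> (I a b < +oo)%E.
Proof.
move=> a0 b0; apply: (fin_scale a0 (I_ge0 _ _) (stepl a0 b0)) => //.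
have a1 : 0 < a + 1 by rewrite addr_gt0.
apply: (fin_scale b0 (I_ge0 _ _) (stepr a1 b0)) => //.
apply: (@le_lt_trans _ _ (\int[mu]_(x in D) (cst 1 x)))%E; last first.
  by rewrite integral_cst//= mul1e /D lebesgue_measure_itv/= lte01 -EFinB ltry.
apply: ge0_le_integral => //=; [by move=> x _; rewrite lee_fin bdens_ge0|exact: mbD|].
move=> x /D01/andP[x0 x1]; rewrite lee_fin /bdens !addrK.
by rewrite mulr_ile1 ?powR_ge0 ?powR_le1//; apply/andP; split; lra.
Qed.

(** Only the ratio of consecutive moments is recorded. It equals the probability
    [(a + q) / (a + b + q)] that an urn of weights [a] and [b] shows the first colour again after
    [q] such draws, so an induction matches the moments of an urn limit. *)
Lemma beta_law_moments (a b : R) : 0 <= a -> 0 < b ->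
  let y (x : R) := Num.max 0 (Num.min 1 x) in exists Q : probability R R,
  [/\ forall B : set R, measurable B -> Q (y @^-1` B) = beta_law a b B &
   forall q : nat, (a + b + q%:R) * Ex Q (fun x => y x ^+ q.+1) =
                   (a + q%:R) * Ex Q (fun x => y x ^+ q)].
Proof.
move=> + b0 y; have y01 x : 0 <= y x <= 1.
  by rewrite /y le_max lexx ge_max ler01 ge_min lexx.
have my : measurable_fun setT y by apply: measurable_maxr => //; exact: measurable_minr.
rewrite le_eqVlt => /predU1P[<-|a0].
  exists (dirac (0 : R)); split => [B mB|q].
    rewrite /beta_law eqxx /dirac; congr (_%:E); apply: indic_bool.
    by rewrite inE/= /y min_r// maxxx.
  have m (h : R -> R) : measurable_fun setT h -> Ex (@dirac _ R 0 R) h = h 0.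
    move=> mh; rewrite /Ex /Rintegral integral_dirac// ?diracT ?mul1e//.
    exact/measurable_EFinP.
  rewrite !m; [|exact: measurable_funX|exact: measurable_funX].
  rewrite add0r (_ : y 0 = 0); last by rewrite /y min_r// maxxx.
  by rewrite !expr0n; case: q => [|q] /=; rewrite !(mul0r, mulr0, addr0).
have f0 x : D x -> 0 < bdens a b x.
  by move/D01/andP => [x0 x1]; rewrite mulr_gt0 ?powR_gt0 ?subr_gt0.
have mb : measurable_fun D (bdens a b) by apply: measurable_funTS; exact: measurable_bdens.
have Ipos : 0 < \int[mu]_(x in D) bdens a b x.
  apply: Rintegral_gt0 => //; [exact: I_fin|].
  by rewrite /D lebesgue_measure_itv/= lte01 -EFinB subr0 oner_neq0.
have [Q [QE intQ]] := normalized_law mD mb (fun x h => ltW (f0 x h)) (I_fin a0 b0) Ipos.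
have yD x : D x -> y x = x.
  by move/D01/andP => [x0 x1]; rewrite /y min_r ?max_r// ltW.
exists Q; split.
  move=> B mB; rewrite QE /beta_law gt_eqF//; congr (_ * integral _ _ _)%E.
  by apply/seteqP; split => x [] /= + Dx; rewrite yD.
have aq q : 0 < a + q%:R by rewrite ltr_pwDl.
have If q : I (a + q%:R) b = (fine (I (a + q%:R) b))%:E.
  by rewrite fineK// ge0_fin_numE ?I_fin// I_ge0.
have ExQ q : Ex Q (fun x => y x ^+ q) = (\int[mu]_(x in D) bdens a b x)^-1 * fine (I (a + q%:R) b).
  rewrite /Ex /Rintegral intQ; last 2 first.
  - by apply/measurable_EFinP; exact: measurable_funX.
  - by move=> x; rewrite lee_fin exprn_ge0//; have /andP[] := y01 x.
  have -> : (\int[mu]_(x in D) ((y x ^+ q)%:E * (bdens a b x)%:E) = I (a + q%:R) b)%E.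
    apply: eq_integral => x /set_mem Dx; have /andP[x0 x1] := D01 Dx.
    rewrite -EFinM yD// /bdens [a + _ - 1]addrAC (powRD (r := a - 1)) ?powR_mulrn ?(ltW x0)//; last first.
      by rewrite (gt_eqF x0) implybT.
    by congr EFin; ring.
  by rewrite If.
move=> q; rewrite !ExQ mulrCA [RHS]mulrCA; congr (_ * _).
have := stepl (aq q) b0; rewrite (_ : a + q%:R + 1 = a + q.+1%:R); last by rewrite -addrA natr1.
by rewrite (If q) (If q.+1) -!EFinM => -[->] /=; rewrite (addrAC a).
Qed.

End beta_moments.

(** * Polya urns *)

Section polya_urns.
Context {R : realType} {D K : eqType} (urn : D -> K) (alpha : D -> R) (tot : K -> R).
Hypotheses (alpha_ge0 : forall d, 0 <= alpha d) (alpha_le : forall d, alpha d <= tot (urn d)).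
Hypothesis tot_gt0 : forall k, 0 < tot k.
Implicit Types (d e : D) (s phi psi : seq D).

Definition in_urn k : pred D := fun d => urn d == k.

Definition draw_prob s d : R :=
  (alpha d + (count_mem d s)%:R) / (tot (urn d) + (count (in_urn (urn d)) s)%:R).

(* The head of a list of draws is the most recent one. *)
Fixpoint draws_prob phi s : R :=
  if phi is d :: phi' then draw_prob (phi' ++ s) d * draws_prob phi' s else 1.

Let den_gt0 k n : 0 < tot k + n%:R.
Proof. by rewrite ltr_pwDl// tot_gt0. Qed.

Lemma draw_prob_ge0 s d : 0 <= draw_prob s d.
Proof. by rewrite divr_ge0 ?addr_ge0// ltW. Qed.

Lemma draw_prob_le1 s d : draw_prob s d <= 1.
Proof.
rewrite ler_pdivrMr// mul1r lerD// ler_nat.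
by apply: sub_count => e /eqP ->; rewrite /in_urn.
Qed.

Lemma draws_prob_ge0 phi s : 0 <= draws_prob phi s.
Proof. by elim: phi => [|d phi ih] //=; rewrite mulr_ge0// draw_prob_ge0. Qed.

Lemma draws_prob_le1 phi s : draws_prob phi s <= 1.
Proof.
elim: phi => [|d phi ih] //=.
by rewrite mulr_ile1// ?draw_prob_ge0 ?draw_prob_le1// draws_prob_ge0.
Qed.

Lemma draws_prob_cat phi psi s :
  draws_prob (phi ++ psi) s = draws_prob phi (psi ++ s) * draws_prob psi s.
Proof. by elim: phi => [|d phi ih] /=; rewrite ?mul1r// ih catA mulrA. Qed.

Lemma perm_draw_prob s s' d : perm_eq s s' -> draw_prob s d = draw_prob s' d.
Proof. by move=> /permP ss'; rewrite /draw_prob !ss'. Qed.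

Let draws_prob_swap d e phi s :
  draws_prob [:: d, e & phi] s = draws_prob [:: e, d & phi] s.
Proof.
rewrite /= !mulrA; congr (_ * _); rewrite /draw_prob /= /in_urn.
have [<-{e}//|de] := eqVneq d e.
rewrite !add0n; have [<-|ne] := eqVneq (urn d) (urn e); rewrite ?add0n; last by ring.
by ring.
Qed.

(** Exchangeability: swapping two consecutive draws only permutes numerators and denominators. The
    local facts [mv] and [ca] turn swaps into exchanges of adjacent blocks, which generate all
    permutations. *)
Lemma perm_draws_prob phi psi s : perm_eq phi psi -> draws_prob phi s = draws_prob psi s.
Proof.
have mv d : forall l r, draws_prob (d :: l ++ r) s = draws_prob (l ++ d :: r) s.
  elim=> [|e l ih] r //.
  transitivity (draw_prob ((d :: l ++ r) ++ s) e * draws_prob (d :: l ++ r) s).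
    exact: draws_prob_swap.
  rewrite ih /=; congr (_ * _); apply: perm_draw_prob.
  by rewrite -cat_cons perm_cat2r -cat1s perm_catCA.
have ca l1 l2 l3 : draws_prob (l1 ++ l2 ++ l3) s = draws_prob (l2 ++ l1 ++ l3) s.
  elim: l1 l2 => [|d l1 ih] l2 //=; rewrite -mv /= ih; congr (_ * _).
  by apply: perm_draw_prob; rewrite perm_cat2r perm_catCA.
move=> pp; pose P l := draws_prob phi s = draws_prob l s.
have PC l1 l2 l3 : P (l1 ++ l2 ++ l3) -> P (l2 ++ l1 ++ l3) by rewrite /P ca.
exact: (catCA_perm_ind PC pp).
Qed.

Lemma draw_prob_indep d psi s : all (fun e => urn e != urn d) psi ->
  draw_prob (psi ++ s) d = draw_prob s d.
Proof.
move=> /allP nd; rewrite /draw_prob !count_cat.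
rewrite (@eq_in_count _ (pred1 d) pred0) ?count_pred0 ?add0n; last first.
  by move=> e /nd /=; apply: contraNF => /eqP ->.
rewrite (@eq_in_count _ (in_urn _) pred0) ?count_pred0 ?add0n//.
by move=> e /nd /negPf.
Qed.

Lemma draws_prob_indep phi psi s :
  all (fun d => all (fun e => urn e != urn d) psi) phi ->
  draws_prob phi (psi ++ s) = draws_prob phi s.
Proof.
elim: phi => [|d phi ih] //= /andP[hd hphi]; rewrite ih//; congr (_ * _).
rewrite -[RHS](@draw_prob_indep d psi)//.
by apply: perm_draw_prob; rewrite perm_catCA.
Qed.

(** Further draws [phi] move a predictive probability by at most their number over the current
    content of the urn. This controls how far the draws of a list are from being independent given a
    long past. *)
Lemma draw_prob_dist d phi s :
  `|draw_prob (phi ++ s) d - draw_prob s d| <=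
  (size phi)%:R / (tot (urn d) + (count (in_urn (urn d)) s)%:R).
Proof.
rewrite /draw_prob !count_cat !natrD.
set f := (count_mem d phi)%:R; set f' := (count (in_urn (urn d)) phi)%:R.
set a := alpha d; set n := (count_mem d s)%:R; set t := tot _; set N := (count _ s)%:R.
have tN : 0 < t + N by exact: den_gt0.
have f0 : 0 <= f by []. have f'0 : 0 <= f' by [].
have ff' : f <= f' by rewrite ler_nat; apply: sub_count => e /eqP ->; rewrite /in_urn.
have fs : f' <= (size phi)%:R by rewrite ler_nat count_size.
have aN : a + n <= t + N.
  by rewrite lerD ?alpha_le// ler_nat; apply: sub_count => e /eqP ->; rewrite /in_urn.
have an0 : 0 <= a + n by rewrite addr_ge0 ?alpha_ge0// /n.
have tfN : 0 < t + (f' + N) by lra.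
have -> : (a + (f + n)) / (t + (f' + N)) - (a + n) / (t + N) =
    (f * (t + N) - f' * (a + n)) / (t + (f' + N)) / (t + N).
  by field; rewrite !gt_eqF.
rewrite normrM [X in _ * X]ger0_norm ?invr_ge0 ?(ltW tN)//; apply: ler_wpM2r; first by rewrite invr_ge0 ltW.
rewrite normrM [X in _ * X]ger0_norm ?invr_ge0 ?(ltW tfN)// ler_pdivrMr//.
by rewrite ler_norml; apply/andP; split; nra.
Qed.

(** The elementary bound [prod (1 - x_r) <= 1 / (1 + sum x_r)], where [x_r] is the probability that
    draw [r] breaks the run. A divergent sum therefore excludes an infinite run of one colour. *)
Lemma draws_prob_nseq_le q d s : alpha d < tot (urn d) ->
  draws_prob (nseq q d) s *
  (1 + \sum_(r < q) (tot (urn d) + (count (in_urn (urn d)) s)%:R - (alpha d + (count_mem d s)%:R)) /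
    (tot (urn d) + (count (in_urn (urn d)) s)%:R + r%:R)) <= 1.
Proof.
move=> ad; set T := tot _ + _; set A := alpha d + _.
have TA : 0 <= T - A.
  rewrite subr_ge0 /T /A lerD ?(ltW ad)// ler_nat.
  by apply: sub_count => e /eqP ->; rewrite /in_urn.
have T0 : 0 < T by exact: den_gt0.
elim: q => [|q ih]; first by rewrite /= big_ord0 addr0 mulr1.
rewrite big_ord_recr /=.
have -> : draw_prob (nseq q d ++ s) d = 1 - (T - A) / (T + q%:R).
  rewrite /draw_prob !count_cat !count_nseq /in_urn /= !eqxx !mul1n !natrD.
  rewrite /T /A /in_urn; field.
  by rewrite gt_eqF// -addrA -natrD den_gt0.
set P := draws_prob _ _ in ih *; set S := \sum_(i < q) _ in ih *; set x := _ / _.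
have P0 : 0 <= P by exact: draws_prob_ge0.
have x0 : 0 <= x by rewrite divr_ge0// addr_ge0// ltW.
have S0 : 0 <= S by apply: sumr_ge0 => r _; rewrite divr_ge0// addr_ge0// ltW.
have -> : (1 - x) * P * (1 + (S + x)) = P * (1 + S) - P * (x * (S + x)) by ring.
by rewrite (le_trans _ ih)// gerBl mulr_ge0// mulr_ge0// addr_ge0.
Qed.

End polya_urns.

(** * The urns driving a path *)

Section path_draws.
Context {dE} {E : measurableType dE}.
Implicit Types (s : nat -> E) (i j : E).

(* [inl (i, j)]: the successor of [i] is [j]; [inr ((i, y), b)]: a visit to [i]
   that has reached age [y.+1] ends ([b = true]) or goes on ([b = false]). *)
Definition draw : Type := ((E * E) + ((E * nat) * bool))%type.
Definition urn_of (d : draw) : E + E * nat :=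
  match d with inl (i, _) => inl i | inr (iy, _) => inr iy end.

Lemma inr_eqE (p q : E * nat) (b c : bool) :
  ((inr (p, b) : draw) == inr (q, c)) = (p == q) && (b == c).
Proof. by []. Qed.

Lemma elapsedP s t n : (forall h, (h <= n)%N -> s (t - h)%N = s t) -> (n <= t)%N ->
  (n = t \/ s (t - n.+1)%N <> s t) -> elapsed s t = n.
Proof.
move=> hs nt hn; rewrite /elapsed; apply/eqP; rewrite eqn_leq; apply/andP; split.
  apply/bigmax_leqP => k /forallP hk; rewrite leqNgt; apply/negP => nk.
  case: hn => [nE|]; first by have := ltn_ord k; lia.
  have kt := ltn_ord k; rewrite ltnS in kt.
  have n1 : (n.+1 < t.+1)%N by rewrite ltnS (leq_trans nk).
  by have := hk (Ordinal n1); rewrite /= nk /= => /eqP.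
have nt1 : (n < t.+1)%N by [].
apply: (@leq_bigmax_cond _ _ _ (Ordinal nt1)).
by apply/forallP => h; apply/implyP => hn'; rewrite hs.
Qed.

Lemma elapsed_spec s t : [/\ (elapsed s t <= t)%N,
  forall h, (h <= elapsed s t)%N -> s (t - h)%N = s t &
  elapsed s t = t \/ s (t - (elapsed s t).+1)%N <> s t].
Proof.
have [n [nt hn hs]] : exists n, [/\ (n <= t)%N, forall h, (h <= n)%N -> s (t - h)%N = s t &
    n = t \/ s (t - n.+1)%N <> s t].
  elim: t => [|t [n [nt hs hn]]]; first by exists 0%N; split; [|case|left].
  have [e|ne] := eqVneq (s t.+1) (s t).
    exists n.+1; split => // [[|h]|]; first by rewrite subn0.
      by rewrite ltnS subSS e => /hs.
    by case: hn => [->|hn]; [left|right; rewrite subSS e].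
  exists 0%N; split => // [h|]; first by rewrite leqn0 => /eqP ->; rewrite subn0.
  by right; rewrite subSS subn0; apply/eqP; rewrite eq_sym.
by rewrite (elapsedP hn nt hs).
Qed.

Lemma elapsed0 s : elapsed s 0 = 0%N.
Proof. by have [+ _ _] := elapsed_spec s 0; rewrite leqn0 => /eqP. Qed.

Lemma elapsedS s t : elapsed s t.+1 = if s t.+1 == s t then (elapsed s t).+1 else 0%N.
Proof.
have [nt hs hn] := elapsed_spec s t.
case: eqP => [e|ne]; apply: elapsedP => //.
- by case=> [|h]; rewrite ?subn0// ltnS subSS e => /hs.
- by case: hn => [->|hn]; [left|right; rewrite subSS e].
- by move=> h; rewrite leqn0 => /eqP ->; rewrite subn0.
by right; rewrite subSS subn0; exact/nesym.
Qed.

(** Each time step consumes one draw from an age urn and, if it is a jump, a more recent one from a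
    successor urn. The age index is [elapsed], that is [age] minus one. *)
Fixpoint path_draws s t : seq draw :=
  if t is t'.+1 then
    (if s t == s t' then [:: inr ((s t', elapsed s t'), false)]
     else [:: inl (s t', s t); inr ((s t', elapsed s t'), true)]) ++ path_draws s t'
  else [::].

Lemma elapsed_prefix s s' t : (forall k, (k <= t)%N -> s k = s' k) -> elapsed s t = elapsed s' t.
Proof.
elim: t => [|t ih] h; first by rewrite !elapsed0.
by rewrite !elapsedS !h// ih// => k kt; apply: h; exact: leqW.
Qed.

Lemma path_draws_prefix s s' t : (forall k, (k <= t)%N -> s k = s' k) ->
  path_draws s t = path_draws s' t.
Proof.
elim: t => [|t ih] h //=; have h' k : (k <= t)%N -> s k = s' k by move=> kt; apply: h; exact: leqW.
by rewrite !h// ih// (elapsed_prefix h').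
Qed.

Lemma transitionsS s i j t :
  transitions s i j t.+1 = (transitions s i j t + ((s t == i) && (s t.+1 == j)))%N.
Proof. by rewrite /transitions big_nat_recr//=. Qed.

Lemma count_row s i j t : i != j ->
  count_mem (inl (i, j) : draw) (path_draws s t) = transitions s i j t.
Proof.
move=> ij; elim: t => [|t ih]; first by rewrite /transitions big_geq.
rewrite transitionsS -ih /= count_cat; case: eqP => [e|ne] /=.
  rewrite addn0 addnC; congr addn; rewrite e.
  by case: eqP => //= ->; rewrite (negPf ij).
by rewrite !addn0 addnC; congr addn; rewrite /eq_op /= xpair_eqE.
Qed.

(** A completed visit with endpoints in [nat], so that a count over endpoints up to [t.+1] can be
    split off from the count up to [t]. *)
Definition visit s i a b : bool :=
  [&& (a < b)%N, all (fun h => s h == i) (iota a (b - a)),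
      (a == 0%N) || (s a.-1 != i) & s b != i].

Lemma visit_countE s i t (A : pred nat) : visit_count s i t A =
  (\sum_(b < t.+1) \sum_(a < t.+1) (visit s i a b && A (b - a)%N))%N.
Proof.
rewrite /visit_count -sum1_card pair_big /= [LHS]big_mkcond /= (reindex (fun p => (p.2, p.1))) /=; last first.
  by exists (fun p => (p.2, p.1)); case.
apply: eq_bigr => -[b a] _ /=; rewrite !inE /= /visit.
set X := [forall h, _]; set Y := all _ _.
suff -> : X = Y by case: (_ && _).
apply/forallP/allP => [h k|h k]; last by apply/implyP => /andP[ak kb]; apply: h; rewrite mem_iota; lia.
rewrite mem_iota => /andP[ak kb]; have kb' : (k < b)%N by lia.
have kt : (k < t.+1)%N by rewrite (ltn_trans kb').
by have := h (Ordinal kt); rewrite /= ak kb'.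
Qed.

(** The only visit that can be completed at time [t.+1] is the one running at time [t], which
    started at [t - elapsed s t] and has length [(elapsed s t).+1]. *)
Lemma visit_countS s i t (A : pred nat) : visit_count s i t.+1 A =
  (visit_count s i t A + [&& s t == i, s t.+1 != i & A (elapsed s t).+1])%N.
Proof.
rewrite !visit_countE big_ord_recr /=; congr addn.
  apply: eq_bigr => b _; rewrite big_ord_recr /= [X in (_ + X)%N](_ : _ = 0%N) ?addn0//.
  by rewrite /visit ltnNge ltnW.
have [nt hs hn] := elapsed_spec s t.
rewrite big_ord_recr /= [X in (_ + X)%N](_ : _ = 0%N) ?addn0; last by rewrite /visit ltnn.
have at1 : (t - elapsed s t < t.+1)%N by rewrite ltnS leq_subr.
rewrite (bigD1 (Ordinal at1)) //= big1 ?addn0; last first.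
  move=> a aN; apply/eqP; rewrite eqb0; apply/negP => /andP[/and4P[ab /allP al a0 sb] _].
  have st : s t = i by apply/eqP/al; rewrite mem_iota; have := ltn_ord a; lia.
  case: (ltngtP a (t - elapsed s t)%N) => [lt|gt|eq]; last by case/eqP: aN; exact: val_inj.
    case: hn => [e|]; first by move: lt; rewrite e subnn.
    by apply; rewrite st; apply/eqP/al; rewrite mem_iota; lia.
  move: a0 => /orP[/eqP a0|]; first by move: gt; rewrite a0.
  rewrite -st => /eqP; apply.
  have := hs (t - a.-1)%N; rewrite (_ : (t - (t - a.-1))%N = a.-1); first by apply; have := ltn_ord a; lia.
  by have := ltn_ord a; lia.
rewrite (_ : (t.+1 - (t - elapsed s t))%N = (elapsed s t).+1); last by lia.
congr nat_of_bool; rewrite andbA; congr andb; rewrite /visit /= at1 /=.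
have [st|st] /= := eqVneq (s t) i; last first.
  by apply/negP => /andP[/allP al _]; case/eqP: st; apply/eqP/al; rewrite mem_iota; lia.
have -> : all (fun h => s h == i) (iota (t - elapsed s t) (t.+1 - (t - elapsed s t))).
  apply/allP => k; rewrite mem_iota => /andP[k1 k2]; apply/eqP; rewrite -st.
  have := hs (t - k)%N; rewrite (_ : (t - (t - k))%N = k); last by lia.
  by apply; lia.
rewrite /=; have -> // : (t - elapsed s t == 0)%N || (s (t - elapsed s t).-1 != i).
case: hn => [e|h]; first by rewrite {1}e subnn eqxx.
by apply/orP; right; apply/eqP; rewrite -st -subnS.
Qed.

Lemma visit_count0 s i (A : pred nat) : visit_count s i 0 A = 0%N.
Proof. by rewrite visit_countE !big_ord1 /visit ltnn. Qed.

Lemma count_jump s i y t :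
  count_mem (inr ((i, y), true) : draw) (path_draws s t) = visit_count s i t (pred1 y.+1).
Proof.
elim: t => [|t ih]; first by rewrite visit_count0.
rewrite visit_countS -ih /= count_cat addnC; congr addn.
case: eqP => [e|ne] /=; rewrite ?addn0.
  by rewrite inr_eqE andbF e; case: eqP.
rewrite add0n inr_eqE andbT xpair_eqE; case: eqP => [st|]//=; rewrite eqSS.
by case: (eqVneq (s t.+1) i) => // e; case: ne; rewrite e st.
Qed.

(** The running visit is not yet counted by [visit_count], but it has already drawn a stay at each
    age it has passed; this is the last term. *)
Lemma count_stay s i y t :
  count_mem (inr ((i, y), false) : draw) (path_draws s t) =
  (visit_count s i t (fun n => y.+1 < n) + ((s t == i) && (y < elapsed s t)))%N.
Proof.
elim: t => [|t ih]; first by rewrite visit_count0 elapsed0 ltn0 andbF.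
rewrite visit_countS elapsedS /= count_cat ih; case: eqP => [e|ne] /=; rewrite ?addn0.
  rewrite inr_eqE andbT xpair_eqE e.
  case: (eqVneq (s t) i) => /= _; rewrite !addn0 ?add0n//.
  have -> : (y < (elapsed s t).+1)%N = (elapsed s t == y) || (y < elapsed s t)%N.
    by rewrite ltnS leq_eqVlt eq_sym.
  by case: (ltngtP y (elapsed s t)) => /=; lia.
rewrite inr_eqE andbF add0n ltn0 andbF addn0; case: (eqVneq (s t) i) => /= st; rewrite ?addn0//.
by case: (eqVneq (s t.+1) i) => // e; case: ne; rewrite e st.
Qed.

Lemma count_age (l : seq draw) i y :
  count (in_urn urn_of (inr (i, y))) l =
  (count_mem (inr ((i, y), true) : draw) l + count_mem (inr ((i, y), false) : draw) l)%N.
Proof.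
elim: l => //= d l ->.
rewrite addnACA; congr addn; rewrite /in_urn.
case: d => [[k j]|[[k x] b]] //; rewrite !inr_eqE.
rewrite (_ : (urn_of _ == _) = ((k, x) == (i, y)))//.
by case: (_ == _); case: b.
Qed.

Lemma visit_count_split s i t y :
  visit_count s i t (fun n => y <= n)%N =
  (visit_count s i t (pred1 y) + visit_count s i t (fun n => y < n)%N)%N.
Proof.
elim: t => [|t ih]; first by rewrite !visit_count0.
rewrite !visit_countS ih /= addnACA; congr addn.
case: (_ == i); case: (_ != i) => //=; rewrite leq_eqVlt eq_sym.
by case: ltngtP.
Qed.

(** Only states met by the path contribute, so the finitely supported sum is a sum over the list
    [r], where it counts the draws of the urn [inl i]. *)
Lemma count_departures {R : realType} s i t :
  \sum_(h \in [set h | h != i]) ((transitions s i h t)%:R : R) =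
  (count (in_urn urn_of (inl i)) (path_draws s t))%:R.
Proof.
pose r := [seq h <- undup [seq s k | k <- iota 0 t.+1] | h != i].
rewrite (@fsbigE _ _ _ _ _ r) ?filter_uniq ?undup_uniq//; last 2 first.
  by move=> h /=; rewrite mem_filter => /andP[].
  move=> h /= hi hr; rewrite /transitions big1_seq// => k; rewrite mem_index_iota => /andP[_ k1].
  apply/eqP; rewrite eqb0; apply/negP => /andP[_ /eqP skh]; move/negP: hr; apply.
  rewrite mem_filter hi mem_undup; apply/mapP; exists k => //; rewrite mem_iota; lia.
rewrite big_seq_cond (eq_bigl (fun h => h \in r)); last first.
  by move=> h /=; rewrite andb_idr// mem_filter => /andP[hi _]; rewrite inE.
rewrite -big_seq -natr_sum; congr (_%:R).
(* The list [r] stays fixed at horizon [t] while the induction runs over earlier times [u]. *)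
suff : forall u, (u <= t)%N ->
   (\sum_(h <- r) transitions s i h u)%N = count (in_urn urn_of (inl i)) (path_draws s u).
  by apply.
elim=> [|u ih] ut.
  by rewrite big1// => h _; rewrite /transitions big_geq.
under eq_bigr do rewrite transitionsS.
rewrite big_split /= ih ?(ltnW ut)// count_cat addnC; congr addn.
have [si|si] := eqVneq (s u) i; last first.
  rewrite big1//; case: eqP => //= _; rewrite /in_urn /= !addn0.
  by apply/esym/eqP; rewrite eqb0.
rewrite /= si; have [e|ne] := eqVneq (s u.+1) i.
  rewrite /= big1_seq// => h /andP[_]; rewrite mem_filter => /andP[hi _].
  by rewrite e eq_sym (negPf hi).
have sr : s u.+1 \in r.
  by rewrite mem_filter ne mem_undup; apply/mapP; exists u.+1 => //; rewrite mem_iota.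
rewrite (bigD1_seq (s u.+1))//=; last by rewrite filter_uniq ?undup_uniq.
rewrite eqxx big1 ?addn0 /in_urn /= ?eqxx// => h hs.
by rewrite eq_sym (negPf hs).
Qed.

End path_draws.

(** * The reinforcement kernel as a product of urn probabilities *)

Section urn_parameters.
Context {R : realType} {dE} {E : measurableType dE}.
Context (m : E -> {measure set E -> \bar R}) (c : E -> nat -> R) (F0 : E -> probability nat R).
Hypotheses (E_discrete : forall A : set E, measurable A)
  (m_pos : forall i, (0 < m i setT)%E) (m_fin : forall i, (m i setT < +oo)%E)
  (c_pos : forall i t, (0 < t)%N -> 0 < c i t)
  (F0_tail : forall i t, (0 < F0 i [set n | (t < n)%N])%E).

Definition draw_weight (d : @draw _ E) : R :=
  match d with
  | inl (i, j) => fine (m i [set j])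
  | inr ((i, y), true) => c i y.+1 * fine (F0 i [set y.+1])
  | inr ((i, y), false) => c i y.+1 * fine (F0 i [set n | (y.+1 < n)%N])
  end.

Definition urn_weight (k : E + E * nat) : R :=
  match k with
  | inl i => fine (m i setT)
  | inr (i, y) => c i y.+1 * fine (F0 i [set n | (y.+1 <= n)%N])
  end.

Lemma m_fin_num i A : m i A \is a fin_num.
Proof.
rewrite ge0_fin_numE// (le_lt_trans _ (m_fin i))//.
by apply: le_measure; rewrite ?inE.
Qed.

Lemma F0_split i y : fine (F0 i [set n | (y <= n)%N]) =
  fine (F0 i [set y]) + fine (F0 i [set n | (y < n)%N]).
Proof.
rewrite -fineD ?fin_num_measure// -measureU//; last first.
  by apply/seteqP; split => // n [/= ->]; rewrite ltnn.
congr (fine (F0 i _)); apply/seteqP; split => [n /=|n /= [->|/ltnW]//].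
by rewrite leq_eqVlt => /orP[/eqP <-|]; [left|right].
Qed.

Lemma draw_weight_ge0 d : 0 <= draw_weight d.
Proof.
by case: d => [[i j]|[[i y] []]] /=; rewrite ?mulr_ge0 ?fine_ge0// ltW// c_pos.
Qed.

Lemma stay_weight_gt0 i y : 0 < draw_weight (inr ((i, y), false)).
Proof.
by rewrite /= mulr_gt0 ?c_pos// fine_gt0// F0_tail/= -ge0_fin_numE// fin_num_measure.
Qed.

Lemma age_weight i y : urn_weight (inr (i, y)) =
  draw_weight (inr ((i, y), true)) + draw_weight (inr ((i, y), false)).
Proof. by rewrite /= F0_split mulrDr. Qed.

Lemma draw_weight_le d : draw_weight d <= urn_weight (urn_of d).
Proof.
case: d => [[i j]|[[i y] b]].
  by rewrite /= fine_le ?m_fin_num//; apply: le_measure; rewrite ?inE.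
rewrite [urn_of _]/= age_weight.
by case: b; rewrite ?lerDl ?lerDr draw_weight_ge0.
Qed.

Lemma urn_weight_gt0 k : 0 < urn_weight k.
Proof.
case: k => [i|[i y]]; first by rewrite /= fine_gt0// m_pos m_fin.
by rewrite age_weight ltr_wpDl ?draw_weight_ge0 ?stay_weight_gt0.
Qed.

Local Notation pd := (draw_prob urn_of draw_weight urn_weight).

Lemma stay_jump_prob s i y : pd s (inr ((i, y), false)) + pd s (inr ((i, y), true)) = 1.
Proof.
have h := urn_weight_gt0 (inr (i, y)).
rewrite /draw_prob [urn_of (inr (i, y, false))]/= [urn_of (inr (i, y, true))]/= -mulrDl.
rewrite count_age natrD age_weight addrACA [_%:R + _]addrC.
rewrite [X in X + _]addrC divff// gt_eqF// ltr_pwDl//.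
by rewrite -age_weight.
Qed.

(** At its own current age the running visit has not drawn yet, so the correction term of
    [count_stay] vanishes and the counts of completed visits in the kernel are exactly the contents
    of the urns. *)
Lemma rsm_kernelE s t j : rsm_kernel m c F0 s t j =
  if j == s t then pd (path_draws s t) (inr ((s t, elapsed s t), false))
  else pd (path_draws s t) (inr ((s t, elapsed s t), true)) *
       pd (path_draws s t) (inl (s t, j)).
Proof.
rewrite /rsm_kernel /age /draw_prob [urn_of (inr _)]/= [urn_of (inr (_, true))]/=.
rewrite !count_age !count_jump !count_stay eqxx ltnn addn0 -visit_count_split.
case: eqP => [//|js]; congr (_ * _).
rewrite count_row; last by rewrite eq_sym; exact/eqP.
by rewrite count_departures.
Qed.

End urn_parameters.

(** * Limits of the predictive probabilities *)

Section discrete_maps.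
Context {d} {Omega : measurableType d} {R : realType} (Pr : probability Omega R).

(** The target is a bare type, typically lists of states with no sigma-algebra, so measurability is
    required on fibres and countability through an injection into [nat]. *)
Definition discrete_map {T : Type} (H : Omega -> T) :=
  (exists g : T -> nat, injective g) /\ forall h, measurable (H @^-1` [set h]).

Lemma discrete_measurable {T : Type} (H : Omega -> T) (A : set T) :
  discrete_map H -> measurable (H @^-1` A).
Proof.
move=> [[g gI] mH].
rewrite (_ : H @^-1` A = \bigcup_n (H @^-1` [set h | A h /\ g h = n])); last first.
  apply/seteqP; split=> [w Aw|w [n _ []]//].
  by exists (g (H w)).
apply: bigcup_measurable => n _.
have [[h [Ah gh]]|nh] := pselect (exists h, A h /\ g h = n).
  rewrite (_ : [set _ | _] = [set h]); first exact: mH.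
  by apply/seteqP; split=> [h' [_ gh']|_ -> //]; apply: gI; rewrite gh'.
rewrite (_ : [set _ | _] = set0) ?preimage_set0//.
by apply/seteqP; split=> // h hh; apply: nh; exists h.
Qed.

Lemma discrete_measurable_fun {T : Type} {d'} {T' : measurableType d'}
    (H : Omega -> T) (G : T -> T') :
  discrete_map H -> measurable_fun setT (G \o H).
Proof.
by move=> dH _ B mB; rewrite setTI comp_preimage; exact: discrete_measurable.
Qed.

(** Conditioning on a countable partition: the fibres of code below [n] exhaust the space, and
    dominated convergence removes the restriction. *)
Lemma Ex_discrete {T : Type} (H : Omega -> T) f : discrete_map H -> bmf f ->
  (forall h, Ex Pr (fun w => f w * \1_(H @^-1` [set h]) w) = 0) -> Ex Pr f = 0.
Proof.
move=> dH bf f0; have [[g gI] mH] := dH; have [_ [M fM]] := bf.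
pose F n := H @^-1` [set h | (g h < n)%N].
have mF n : measurable (F n) by exact: discrete_measurable.
have bF n : bmf (fun w => f w * \1_(F n) w) by apply: bmfM => //; exact: bmf_indic.
have lim : Ex Pr (fun w => f w * \1_(F n) w) @[n --> \oo] --> Ex Pr f.
  apply: (@Ex_cvg _ _ _ _ M) => //.
  - by move=> n; have [] := bF n.
  - move=> n w; rewrite normrM -[leRHS]mulr1 ler_pM//.
    by rewrite indicE; case: (_ \in _); rewrite ?normr0 ?normr1.
  apply: aeW => w; apply: cvg_near_cst; near=> n.
  rewrite (@indic_bool _ _ _ true) ?mulr1//; split => // _.
  by near: n; exact: nbhs_infty_gt.
apply: (cvg_eq lim (cvg_cst (0 : R))).
elim=> [|n ih].
  under eq_Ex do rewrite (@indic_bool _ _ (F 0%N) false)// mulr0.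
  exact: Ex_cst.
pose A := H @^-1` [set h | g h = n].
have mA : measurable A by exact: discrete_measurable.
rewrite (_ : (fun w => _) = (fun w => f w * \1_(F n) w + f w * \1_A w)); last first.
  apply/funext => w; rewrite -mulrDr; congr (_ * _).
  rewrite (@indic_bool _ _ (F n.+1) (g (H w) < n.+1)%N)// (@indic_bool _ _ (F n) (g (H w) < n)%N)//.
  rewrite (@indic_bool _ _ A (g (H w) == n)); last by split=> [/= ->|/eqP].
  by rewrite ltnS; case: ltngtP => _; rewrite ?addr0 ?add0r.
rewrite ExD//; last by apply: bmfM => //; exact: bmf_indic.
rewrite ih add0r.
have [[h gh]|nh] := pselect (exists h, g h = n).
  rewrite (_ : A = H @^-1` [set h])//; congr (H @^-1` _).
  by apply/seteqP; split=> [h' gh'|_ -> //]; apply: gI; rewrite gh'.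
rewrite (_ : A = set0); last by apply/seteqP; split=> // w Aw; apply: nh; exists (H w).
under eq_Ex do rewrite indic0 mulr0.
exact: Ex_cst.
Unshelve. all: by end_near. Qed.

End discrete_maps.

(** * Countably additive real set functions, compared on points *)

Section countably_additive.
Context {R : realType} {E : Type}.
Implicit Types mu : set E -> R.

(** Countable additivity appears as finite additivity plus continuity along increasing sequences. In
    this form it passes to linear combinations and to expectations, with no measure to construct and
    no sign condition. *)
Definition cadd mu := [/\ mu set0 = 0,
  forall A B, A `&` B = set0 -> mu (A `|` B) = mu A + mu B &
  forall F : nat -> set E, nondecreasing_seq F -> mu (F n) @[n --> \oo] --> mu (\bigcup_n F n)].

(** The points of [A] of code below [n] increase to [A]; finite additivity adds them one by one and
    continuity concludes. This replaces summation over [E]. *)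
Lemma cadd_eq mu1 mu2 (g : E -> nat) A : injective g -> cadd mu1 -> cadd mu2 ->
  (forall j, A j -> mu1 [set j] = mu2 [set j]) -> mu1 A = mu2 A.
Proof.
move=> gI [m10 m1D m1c] [m20 m2D m2c] m12.
pose F n := [set j | A j /\ (g j < n)%N].
have ndF : nondecreasing_seq F.
  by move=> n m nm; apply/subsetPset => j /= [Aj jn]; split => //; exact: leq_trans nm.
have FA : \bigcup_n F n = A.
  by apply/seteqP; split => [j [n _ []]//|j Aj]; exists (g j).+1.
rewrite -FA; apply: (cvg_eq (m1c F ndF) (m2c F ndF)); elim=> [|n ih].
  by rewrite (_ : F 0%N = set0) ?m10 ?m20//; apply/seteqP; split => // j [].
have FS : F n.+1 = F n `|` [set j | A j /\ g j = n].
  apply/seteqP; split=> j; rewrite /F /=.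
    by rewrite ltnS leq_eqVlt => -[Aj /orP[/eqP ->|]]; [right|left].
  by case=> -[Aj]; [move/leqW|move=> ->].
have F0 : F n `&` [set j | A j /\ g j = n] = set0.
  by apply/seteqP; split => // j; rewrite /F /= => -[[_ +] [_ gj]]; rewrite gj ltnn.
rewrite FS m1D// m2D// ih; congr (_ + _).
have [[j [Aj gj]]|nj] := pselect (exists j, A j /\ g j = n).
  rewrite (_ : [set _ | _] = [set j]) ?m12//.
  by apply/seteqP; split=> [h [_ gh]|_ -> //]; apply: gI; rewrite gh.
by rewrite (_ : [set _ | _] = set0) ?m10 ?m20//; apply/seteqP; split=> // j gj; apply: nj; exists j.
Qed.

Lemma caddD mu1 mu2 : cadd mu1 -> cadd mu2 -> cadd (fun A => mu1 A + mu2 A).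
Proof.
move=> [a1 b1 c1] [a2 b2 c2]; split => [|A B AB|F ndF]; first by rewrite a1 a2 addr0.
  by rewrite b1// b2// addrACA.
by apply: cvgD; [exact: c1|exact: c2].
Qed.

Lemma caddZ k mu : cadd mu -> cadd (fun A => k * mu A).
Proof.
move=> [a1 b1 c1]; split => [|A B AB|F ndF]; first by rewrite a1 mulr0.
  by rewrite b1// mulrDr.
by apply: cvgM; [exact: cvg_cst|exact: c1].
Qed.

Lemma cadd_indic j : cadd (fun A => \1_A j : R).
Proof.
split => [|A B AB|F ndF]; first by rewrite indic0.
  rewrite !indicE in_setU; case: (boolP (j \in A)); case: (boolP (j \in B)) => //=; rewrite ?addr0 ?add0r//.
  move=> jB jA; have : (A `&` B) j by split; exact: set_mem.
  by rewrite AB.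
have [[n _ Fn]|nF] := pselect ((\bigcup_n F n) j); last first.
  have -> : \1_(\bigcup_n F n) j = 0 :> R by apply: (@indic_bool _ _ _ false); split.
  rewrite (_ : (fun n => _) = fun=> 0); first exact: cvg_cst.
  apply/funext => n; apply: (@indic_bool _ _ _ false); split => // Fn.
  by exfalso; apply: nF; exists n.
have -> : \1_(\bigcup_n F n) j = 1 :> R.
  by apply: (@indic_bool _ _ _ true); split => // _; exists n.
apply: cvg_near_cst.
near=> k; apply: (@indic_bool _ _ _ true); split => // _.
have /subsetPset : (F n <= F k)%O by apply: ndF; near: k; exact: nbhs_infty_ge.
exact.
Unshelve. all: by end_near. Qed.

End countably_additive.

Lemma cadd_measure {R : realType} {dE} {E : measurableType dE} (mu : {measure set E -> \bar R}) :
  (forall A : set E, measurable A) -> (mu setT < +oo)%E -> cadd (fun A => fine (mu A)).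
Proof.
move=> mE fmu; have fA A : mu A \is a fin_num.
  rewrite ge0_fin_numE// (le_lt_trans _ fmu)//.
  by apply: le_measure; rewrite ?inE.
split => [|A B AB|F ndF]; first by rewrite measure0.
  by rewrite measureU// fineD ?fA.
by apply: fine_cvg; rewrite fineK//; apply: nondecreasing_cvg_mu.
Qed.

Lemma cadd_Ex {d} {Omega : measurableType d} {R : realType} (Pr : probability Omega R)
    {E : Type} (mu : Omega -> set E -> R) M :
  (forall A, measurable_fun setT (mu ^~ A)) -> (forall w A, `|mu w A| <= M) ->
  {ae Pr, forall w, cadd (mu w)} -> cadd (fun A => Ex Pr (mu ^~ A)).
Proof.
move=> mmu bmu aemu.
have b A : bmf (mu ^~ A) by split => //; exists M.
split => [|A B AB|F ndF].
- rewrite -[RHS](Ex_cst Pr); apply: ae_Ex => //; first exact: bmf_cst.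
  by apply: filterS aemu => w [].
- rewrite -ExD//; apply: ae_Ex => //; first exact: bmfD.
  by apply: filterS aemu => w [_ + _]; apply.
apply: (@Ex_cvg _ _ _ _ M) => //.
by apply: filterS aemu => w [_ _]; apply.
Qed.

(** * Relations between the counts of draws of different urns *)

Section draw_counts.
Context {dE} {E : measurableType dE}.
Implicit Types (s : nat -> E) (i : E).

Lemma count_row_visits s i t :
  count (in_urn urn_of (inl i)) (path_draws s t) = visit_count s i t (fun n => 0 < n)%N.
Proof.
elim: t => [|t ih]; first by rewrite visit_count0.
rewrite visit_countS -ih /= count_cat addnC; congr addn.
have [->|ne] := eqVneq (s t.+1) (s t); first by rewrite /in_urn /=; case: eqP => // ->.
rewrite /in_urn /= !addn0 andbT (_ : (inl (s t) == inl i) = (s t == i))//.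
by case: (eqVneq (s t) i) => //= e; rewrite -e ne.
Qed.

Lemma count_age0 s i t : count (in_urn urn_of (inr (i, 0%N))) (path_draws s t) =
  (count (in_urn urn_of (inl i)) (path_draws s t) + ((s t == i) && (0 < elapsed s t)))%N.
Proof.
by rewrite count_age count_jump count_stay addnA -visit_count_split count_row_visits.
Qed.

(** A stay at index [y] is followed by a draw from the urn of index [y.+1], except when the path is
    waiting to make that draw. This lets unboundedness pass from one age to the next. *)
Lemma count_ageS s i y t :
  (count (in_urn urn_of (inr (i, y.+1))) (path_draws s t) + ((s t == i) && (elapsed s t == y.+1)) =
   count_mem (inr ((i, y), false)) (path_draws s t))%N.
Proof.
rewrite count_age count_jump !count_stay addnA -visit_count_split -addnA; congr addn.
case: (s t == i) => //=; rewrite [in RHS]leq_eqVlt eq_sym.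
by case: ltngtP.
Qed.

Lemma path_draws_add s t n : exists l, path_draws s (t + n) = l ++ path_draws s t.
Proof.
elim: n => [|n [l ih]]; first by exists [::]; rewrite addn0.
by rewrite addnS /= ih catA; eexists.
Qed.

Lemma count_path_draws_mono (P : pred draw) s t n : (t <= n)%N ->
  (count P (path_draws s t) <= count P (path_draws s n))%N.
Proof.
move=> tn; have [l] := path_draws_add s t (n - t).
by rewrite subnKC// => ->; rewrite count_cat leq_addl.
Qed.

Lemma recurrent_count s i N : recurrent_path s ->
  exists t, (N <= count (in_urn urn_of (inl i)) (path_draws s t))%N.
Proof.
move=> [tau [tau0 tauS] inf]; elim: N => [|N [t ht]]; first by exists 0%N.
have tau_ge n : (n <= tau n)%N.
  by elim: n => // n ih; have [h _ _] := tauS n; exact: leq_ltn_trans ih h.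
have [n [tn sn]] : exists n, (t <= n)%N /\ s (tau n) = i.
  apply: contrapT => hn; apply: (inf i); apply: (@sub_finite_set _ _ `I_t); last exact: finite_II.
  move=> n /= sn; rewrite ltnNge; apply/negP => tn; apply: hn; by exists n.
have [h1 h2 h3] := tauS n.
(* [u] is the last instant of the visit to [i] starting at [tau n]; the step from [u] to [u.+1]
   draws from the urn [inl i]. *)
pose u := (tau n.+1).-1.
have uE : u.+1 = tau n.+1 by rewrite prednK// (leq_ltn_trans _ h1).
have un : (tau n <= u)%N by rewrite -ltnS uE.
have su : s u = i.
  rewrite -sn; have [->//|ne] := eqVneq u (tau n).
  by apply: h3; rewrite -uE ltnSn andbT ltn_neqAle un andbT eq_sym.
exists u.+1 => /=; case: eqP => [e|_]; first by case: h2; rewrite -uE e su sn.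
rewrite /= {1}/in_urn /= su eqxx add1n ltnS (leq_trans ht)//.
by apply: leq_trans (leq_addl _ _); apply: count_path_draws_mono; rewrite (leq_trans tn)// (leq_trans (tau_ge n)).
Qed.

End draw_counts.

(** * The law of the path and the predictive martingales *)

Section reinforced_process.
Context {R : realType} {d} {Omega : measurableType d} (Pr : probability Omega R).
Context {dE} {E : measurableType dE}.
Context (E_countable : countable [set: E]) (E_discrete : forall A : set E, measurable A).
Context (l0 : E) (m : E -> {measure set E -> \bar R}) (c : E -> nat -> R)
  (F0 : E -> probability nat R).
Hypotheses (m_pos : forall i, (0 < m i setT)%E) (m_fin : forall i, (m i setT < +oo)%E)
  (m_diag : forall i, m i [set i] = 0%E) (c_pos : forall i t, (0 < t)%N -> 0 < c i t)
  (F0_tail : forall i t, (0 < F0 i [set n | (t < n)%N])%E).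
Context (S : nat -> {RV Pr >-> E}).
Hypothesis S_RSM : RSM Pr l0 m c F0 (fun t => S t).

Local Notation dw := (draw_weight m c F0).
Local Notation uw := (urn_weight m c F0).
Local Notation pd := (draw_prob urn_of dw uw).
Local Notation pds := (draws_prob urn_of dw uw).
Local Notation path w := (fun k => S k w).

Let dw_ge0 := draw_weight_ge0 m F0 c_pos.
Let dw_le := draw_weight_le F0 E_discrete m_fin c_pos.
Let uw_gt0 := urn_weight_gt0 m_pos m_fin c_pos F0_tail.

Definition cyl (s : nat -> E) t : set Omega := [set w | forall k, (k <= t)%N -> S k w = s k].

Lemma E_inj : exists g : E -> nat, injective g.
Proof. by have /countable_injP[g gI] := E_countable; exists g => x y; apply: gI; rewrite inE. Qed.

Definition hist t (w : Omega) : seq E := [seq S k w | k <- iota 0 t.+1].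

Lemma seqE_inj : exists g : seq E -> nat, injective g.
Proof.
have [g gI] := E_inj; exists (fun l => pickle (map g l)) => x y /(pcan_inj pickleK).
exact: inj_map.
Qed.

Lemma cyl0 s : cyl s 0 = S 0%N @^-1` [set s 0%N].
Proof.
apply/seteqP; split => w /=; first by apply.
by move=> h k; rewrite leqn0 => /eqP ->.
Qed.

Lemma cylS s t : cyl s t.+1 = cyl s t `&` S t.+1 @^-1` [set s t.+1].
Proof.
apply/seteqP; split=> [w h|w [h1 h2] k]; first by split=> [k kt|]; apply: h => //; exact: leqW.
by rewrite leq_eqVlt => /orP[/eqP -> //|]; rewrite ltnS => /h1.
Qed.

Lemma measurable_cyl s t : measurable (cyl s t).
Proof.
elim: t => [|t ih]; first by rewrite cyl0 -[X in measurable X]setTI; exact: measurable_funP.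
rewrite cylS; apply: measurableI => //.
by rewrite -[X in measurable X]setTI; exact: measurable_funP.
Qed.

Lemma hist_fibre t (h : seq E) : hist t @^-1` [set h] =
  if size h == t.+1 then cyl (nth l0 h) t else set0.
Proof.
apply/seteqP; split => w.
  move=> <-; rewrite /hist size_map size_iota eqxx => k kt.
  by rewrite (nth_map 0%N) ?size_iota// nth_iota.
case: eqP => // sh hw; apply: (@eq_from_nth _ l0); rewrite /hist size_map size_iota// => k kt.
by rewrite (nth_map 0%N) ?size_iota// nth_iota// add0n hw.
Qed.

Lemma hist_discrete t : discrete_map (hist t).
Proof.
split; first exact: seqE_inj.
by move=> h; rewrite hist_fibre; case: ifP => // _; exact: measurable_cyl.
Qed.

Lemma path_drawsE t w : path_draws (path w) t = path_draws (nth l0 (hist t w)) t.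
Proof.
apply: path_draws_prefix => k kt.
by rewrite /hist (nth_map 0%N) ?size_iota// nth_iota// add0n.
Qed.

Lemma measurable_hist {d'} {T' : measurableType d'} t (G : seq draw -> T') :
  measurable_fun setT (fun w => G (path_draws (path w) t)).
Proof.
rewrite (_ : (fun w => _) = (fun h => G (path_draws (nth l0 h) t)) \o hist t).
  by apply: discrete_measurable_fun; exact: hist_discrete.
by apply/funext => w /=; rewrite path_drawsE.
Qed.

Lemma bmf_pds phi t : bmf (fun w => pds phi (path_draws (path w) t)).
Proof.
apply: bmf_01; first exact: (measurable_hist t (pds phi)).
by move=> w; rewrite draws_prob_ge0 ?draws_prob_le1.
Qed.

Lemma cyl_path_draws s t w : cyl s t w -> path_draws (path w) t = path_draws s t.
Proof. by move=> h; apply: path_draws_prefix. Qed.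

(** The kernel is constant on a cylinder, so its probability multiplies along the path and becomes
    the probability of the draws recorded by the path. The last factor accounts for the prescribed
    initial state. *)
Lemma Pr_cyl s t :
  fine (Pr (cyl s t)) = pds (path_draws s t) [::] * (s 0%N == l0)%:R.
Proof.
have [S0 SS] := S_RSM; elim: t => [|t ih].
  rewrite mul1r -Ex_indic ?cyl0; last first.
    by rewrite -[X in measurable X]setTI; exact: measurable_funP.
  rewrite -[RHS](Ex_cst Pr); apply: ae_Ex; [|exact: bmf_cst|].
    by apply: bmf_indic; rewrite -[X in measurable X]setTI; exact: measurable_funP.
  apply: filterS S0 => w S0w; apply: indic_bool; rewrite /= S0w.
  by split=> [->|/eqP].
have [_ /(_ (cyl s t))] := SS t (s t.+1).
rewrite cylS setIC => ->; last first.
  rewrite (_ : cyl s t = \bigcap_(k < t.+1) (S k @^-1` [set s k])); last first.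
    by apply/seteqP; split=> w h k; rewrite /= ?ltnS => kt; apply: h.
  rewrite /sigma_join; set G := \bigcup_(_ in _) _.
  change (measurable (\bigcap_(k < t.+1) (S k @^-1` [set s k]) : set (g_sigma_algebraType G))).
  apply: bigcap_measurableType => k kt; apply: sub_sigma_algebra; exists k => //.
  by exists [set s k]; rewrite ?setTI.
have cE w : cyl s t w -> rsm_kernel m c F0 (path w) t (s t.+1) =
    pds ((if s t.+1 == s t then [:: inr ((s t, elapsed s t), false)]
     else [:: inl (s t, s t.+1); inr ((s t, elapsed s t), true)])) (path_draws s t).
  move=> cw; rewrite rsm_kernelE// cw// (cyl_path_draws cw).
  rewrite (@elapsed_prefix _ _ _ s)//; case: eqP => _; rewrite /= ?mulr1//.
  rewrite mulrC; congr (_ * _).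
under eq_integral => w cw do rewrite (cE _ (set_mem cw)).
rewrite integral_cst; last exact: measurable_cyl.
rewrite fineM// ?fin_num_measure//; last exact: measurable_cyl.
by rewrite ih mulrA [path_draws s t.+1]/= draws_prob_cat cats0.
Qed.

(* Summing over the successor [j] is summing over the colours of the urn [inl i]: the
   one-step transition of the process is harmonic for [draws_prob]. *)
Definition row_prob l i (A : set E) : R :=
  (fine (m i A) + \sum_(e <- l) (if e is inl (i', j) then (i' == i)%:R * \1_A j else 0)) /
  (uw (inl i) + (count (in_urn urn_of (inl i)) l)%:R).

Lemma row_prob1 l i j : row_prob l i [set j] = pd l (inl (i, j)).
Proof.
rewrite /row_prob /draw_prob; congr (_ / _); congr (_ + _).
elim: l => [|e l ih]; rewrite ?big_nil//= big_cons ih natrD; congr (_ + _).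
case: e => [[i' j']|[[k x] b]] //.
rewrite (@indic_bool _ _ _ (j' == j)); last by split=> [/= ->|/eqP].
rewrite [X in _ = (nat_of_bool X)%:R](_ : _ = (i' == i) && (j' == j))//.
by case: (i' == i); case: (j' == j); rewrite ?mulr1 ?mulr0 ?mul0r.
Qed.

Lemma row_probT l i : row_prob l i setT = 1.
Proof.
rewrite /row_prob.
have -> : \sum_(e <- l) (if e is inl (i', j) then (i' == i)%:R * \1_[set: E] j else 0 : R) =
    (count (in_urn urn_of (inl i)) l)%:R.
  elim: l => [|e l ih]; rewrite ?big_nil//= big_cons ih natrD; congr (_ + _).
  by case: e => [[i' j']|[[k x] b]] //; rewrite indicT mulr1.
by rewrite divff// gt_eqF// ltr_pwDl//; exact: (uw_gt0 (inl i)).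
Qed.

Lemma row_prob_cadd l i : cadd (row_prob l i).
Proof.
have : cadd (fun A => (uw (inl i) + (count (in_urn urn_of (inl i)) l)%:R)^-1 *
   (fine (m i A) + \sum_(e <- l) (if e is inl (i', j) then (i' == i)%:R * \1_A j else 0))).
  apply: caddZ; apply: caddD; first exact: cadd_measure.
  elim: l => [|e l ih].
    by split => *; rewrite ?big_nil ?addr0//; under eq_fun do rewrite big_nil; exact: cvg_cst.
  rewrite (_ : (fun A => _) = (fun A : set E => (if e is inl (i', j) then (i' == i)%:R * \1_A j else 0) +
     \sum_(e <- l) (if e is inl (i', j) then (i' == i)%:R * \1_A j else 0))); last first.
    by apply/funext => A; rewrite big_cons.
  apply: caddD => //; case: (e) => [[i' j]|_]; last first.
    by split => *; rewrite ?addr0//; exact: cvg_cst.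
  by apply: caddZ; exact: cadd_indic.
by congr cadd; apply/funext => A; rewrite mulrC.
Qed.

(** The colour [i] has weight zero in the urn of successors of [i], and it cannot be reinforced
    before it is drawn. *)
Lemma pds_diag0 phi l i : inl (i, i) \in phi -> inl (i, i) \notin l -> pds phi l = 0.
Proof.
elim: phi => // e phi ih; rewrite inE => /orP[/eqP <-|h] il /=; last by rewrite ih ?mulr0.
have [h|h] := boolP (inl (i, i) \in phi); first by rewrite ih ?mulr0.
rewrite /draw_prob /= m_diag/= add0r (count_memPn _) ?mul0r ?mul0r//.
by rewrite mem_cat negb_or h.
Qed.

Definition upd (s : nat -> E) t j : nat -> E := fun k => if (k <= t)%N then s k else j.

(** As functions of the set containing [S t.+1], both sides are countably additive, so they are
    compared at a point [j]. There the path draws the new colours before [phi], the urns after it,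
    and exchangeability identifies the two orders. *)
Lemma draws_prob_harmonic phi s t : s 0%N = l0 ->
  Ex Pr (fun w => \1_(cyl s t) w * pds phi (path_draws (path w) t.+1)) =
  pds (phi ++ path_draws s t) [::].
Proof.
move=> s0.
have [g gI] := E_inj.
pose i := s t; pose y := elapsed s t.
pose stay : draw := inr ((i, y), false); pose jump : draw := inr ((i, y), true).
pose mu1 A := Ex Pr (fun w => \1_(cyl s t) w * pds phi (path_draws (path w) t.+1) * \1_A (S t.+1 w)).
pose u := jump :: phi ++ path_draws s t.
pose mu2 A := pds (stay :: phi ++ path_draws s t) [::] * \1_A i + pds u [::] * row_prob u i A.
have bcyl : bmf (\1_(cyl s t) : Omega -> R) by apply: bmf_indic; exact: measurable_cyl.
have bphi := bmf_pds phi t.+1.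
have mS A : measurable (S t.+1 @^-1` A).
  by rewrite -[X in measurable X]setTI; apply: measurable_funPT.
have -> : Ex Pr (fun w => \1_(cyl s t) w * pds phi (path_draws (path w) t.+1)) = mu1 setT.
  by apply: eq_Ex => w; rewrite indicT mulr1.
have -> : pds (phi ++ path_draws s t) [::] = mu2 setT.
  rewrite /mu2 indicT mulr1 row_probT mulr1 /u /= -mulrDl !cats0.
  by rewrite stay_jump_prob// mul1r.
apply: (@cadd_eq _ _ _ _ g setT gI).
- apply: (@cadd_Ex _ _ _ _ _ (fun w A => \1_(cyl s t) w * pds phi (path_draws (path w) t.+1) * \1_A (S t.+1 w)) 1).
  + move=> A; apply: (bmfM (bmfM bcyl bphi) _).1.
    rewrite (_ : (fun w => _) = \1_(S t.+1 @^-1` A)); first exact: bmf_indic.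
    by apply/funext => w; rewrite !indicE; congr (_ %:R); apply/idP/idP; rewrite !inE.
  + move=> w A; rewrite !normrM; apply: mulr_ile1 => //; last first.
      by rewrite indicE; case: (_ \in _); rewrite ?normr0 ?normr1.
    apply: mulr_ile1 => //; first by rewrite indicE; case: (_ \in _); rewrite ?normr0 ?normr1.
    by rewrite ger0_norm ?draws_prob_ge0 ?draws_prob_le1.
  + by apply: aeW => w; apply: caddZ; exact: cadd_indic.
- by apply: caddD; apply: caddZ; [exact: cadd_indic|exact: row_prob_cadd].
move=> j; rewrite /mu1 /mu2 row_prob1.
have cylE w : \1_(cyl s t) w * \1_[set j] (S t.+1 w) = \1_(cyl (upd s t j) t.+1) w :> R.
  rewrite cylS (_ : cyl (upd s t j) t = cyl s t); last first.
    by apply/seteqP; split=> v h k kt; rewrite h// /upd kt.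
  by rewrite indicI /upd ltnn; congr (_ * _); rewrite !indicE; congr (_ %:R); apply/idP/idP; rewrite !inE.
have pE : path_draws (upd s t j) t.+1 = (if j == i then [:: stay] else [:: inl (i, j); jump]) ++ path_draws s t.
  rewrite /= /upd ltnn leqnn; congr (_ ++ _); last first.
    by apply: path_draws_prefix => k kt; rewrite kt.
  by rewrite (@elapsed_prefix _ _ _ s)// => k kt; rewrite kt.
transitivity (pds phi (path_draws (upd s t j) t.+1) * fine (Pr (cyl (upd s t j) t.+1))).
  rewrite -Ex_indic; last exact: measurable_cyl.
  rewrite -ExZl; last by apply: bmf_indic; exact: measurable_cyl.
  apply: eq_Ex => w; rewrite mulrAC cylE mulrC.
  have [h|h] := pselect (cyl (upd s t j) t.+1 w); first by rewrite (cyl_path_draws h).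
  by rewrite indicE memNset// !mulr0.
rewrite Pr_cyl (_ : (upd s t j 0%N == l0) = true) ?mulr1; last by rewrite /upd s0 eqxx.
have pcat P : pds phi P * pds P [::] = pds (phi ++ P) [::] by rewrite draws_prob_cat cats0.
rewrite pcat pE.
have pcons e v : pds v [::] * pd v e = pds (e :: v) [::] by rewrite /= cats0 mulrC.
rewrite pcons.
have [->|ji] := eqVneq j i.
  (* At [j = i] only the stay contributes: the successor urn gives no mass to [i]. *)
  rewrite (@pds_diag0 (inl (i, i) :: u) _ i) ?mem_head// addr0 indicE mem_set// mulr1.
  by apply: perm_draws_prob; rewrite -cat1s perm_catCA.
rewrite indicE memNset ?mulr0 ?add0r; last by move=> /= ij; rewrite ij eqxx in ji.
apply: perm_draws_prob; rewrite /u -(cat1s _ (jump :: _)) -(cat1s jump) (catA [:: _]).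
by rewrite perm_catCA.
Qed.

Local Notation post phi t := (fun w : Omega => pds phi (path_draws (path w) t)).

Lemma hist_take t n w : hist t w = take t.+1 (hist (t + n) w).
Proof. by rewrite /hist -map_take take_iota; congr map; congr iota; lia. Qed.

Lemma bmf_hist (G : seq E -> R) M t : (forall h, `|G h| <= M) -> bmf (G \o hist t).
Proof.
move=> GM; split; first exact: discrete_measurable_fun (hist_discrete t).
by exists M => w; exact: GM.
Qed.

Lemma cyl_bad s t : s 0%N != l0 -> fine (Pr (cyl s t)) = 0.
Proof. by move=> /negPf s0; rewrite Pr_cyl s0 mulr0. Qed.

(** Conditional expectation given the past is expressed by testing against bounded functions [G] of
    the history; on a fibre of the history this is [draws_prob_harmonic], or trivial when the
    cylinder does not start at [l0] and is null. *)
Lemma martingale_step (G : seq E -> R) M phi t : (forall h, `|G h| <= M) ->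
  Ex Pr (fun w => G (hist t w) * (post phi t.+1 w - post phi t w)) = 0.
Proof.
move=> GM; apply: (Ex_discrete (hist_discrete t)).
  by apply: bmfM; [exact: (bmf_hist t GM)|apply: bmfB; exact: bmf_pds].
move=> h; rewrite hist_fibre; case: eqP => [sh|_]; last first.
  by under eq_Ex do rewrite indic0 mulr0; exact: Ex_cst.
pose s := nth l0 h.
have mc := measurable_cyl s t.
have bc : bmf (\1_(cyl s t) : Omega -> R) by exact: bmf_indic.
have e w : G (hist t w) * (post phi t.+1 w - post phi t w) * \1_(cyl s t) w =
   G h * (\1_(cyl s t) w * post phi t.+1 w - pds phi (path_draws s t) * \1_(cyl s t) w).
  have [cw|ncw] := pselect (cyl s t w); last by rewrite indicE memNset// !(mulr0, mul0r) subr0 mulr0.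
  have -> : hist t w = h.
    by have := hist_fibre t h; rewrite sh eqxx => /seteqP[_]; apply.
  by rewrite (cyl_path_draws cw) indicE mem_set// !(mulr1, mul1r).
under eq_Ex do rewrite e.
rewrite ExZl; last first.
  by apply: bmfB; apply: bmfM => //; [exact: bmf_pds|exact: bmf_cst].
rewrite ExB; last 2 first.
  by apply: bmfM => //; exact: bmf_pds.
  by apply: bmfM => //; exact: bmf_cst.
rewrite ExZl// Ex_indic//.
have [s0|s0] := eqVneq (s 0%N) l0.
  by rewrite draws_prob_harmonic// Pr_cyl s0 eqxx mulr1 draws_prob_cat cats0 subrr mulr0.
rewrite cyl_bad// mulr0 subr0.
suff -> : Ex Pr (fun w => \1_(cyl s t) w * post phi t.+1 w) = 0 by rewrite mulr0.
apply/eqP; rewrite eq_le; apply/andP; split; last first.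
  by apply: Ex_ge0 => w; rewrite mulr_ge0 ?draws_prob_ge0// indicE.
rewrite -(cyl_bad t s0) -Ex_indic//; apply: le_Ex => //.
  by apply: bmfM => //; exact: bmf_pds.
move=> w; rewrite ler_piMr ?draws_prob_le1// indicE//.
Qed.

Lemma martingale (G : seq E -> R) M phi t n : (forall h, `|G h| <= M) ->
  Ex Pr (fun w => G (hist t w) * post phi (t + n) w) =
  Ex Pr (fun w => G (hist t w) * post phi t w).
Proof.
move=> GM; elim: n => [|n ih]; first by rewrite addn0.
rewrite -ih; apply/eqP; rewrite -subr_eq0 -ExB; last 2 first.
  by apply: bmfM; [exact: (bmf_hist t GM)|exact: bmf_pds].
  by apply: bmfM; [exact: (bmf_hist t GM)|exact: bmf_pds].
apply/eqP; rewrite -[RHS](@martingale_step (fun h => G (take t.+1 h)) M phi (t + n))//.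
by apply: eq_Ex => w; rewrite -hist_take addnS mulrBr.
Qed.

(** The value does not depend on [n], so it survives the passage to the limit: it is the probability
    of the path up to [t] followed by the draws [phi]. *)
Lemma cyl_martingale s phi t n :
  Ex Pr (fun w => \1_(cyl s t) w * post phi (t + n) w) =
  pds (phi ++ path_draws s t) [::] * (s 0%N == l0)%:R.
Proof.
pose G (h : seq E) : R := (asbool (forall k, (k <= t)%N -> nth l0 h k = s k))%:R.
have GE w : \1_(cyl s t) w = G (hist t w) :> R.
  apply: indic_bool; split => [h|/asboolP h].
    by apply/asboolP => k kt; rewrite /hist (nth_map 0%N) ?size_iota// nth_iota// add0n h.
  by move=> k kt; rewrite -h// /hist (nth_map 0%N) ?size_iota// nth_iota// add0n.
under eq_Ex do rewrite GE.
rewrite (@martingale G 1); last first.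
  by move=> h; rewrite /G; case: asbool; rewrite ?normr0 ?normr1.
rewrite (_ : Ex _ _ = Ex Pr (fun w => pds phi (path_draws s t) * \1_(cyl s t) w)).
  rewrite ExZl ?Ex_indic; [|exact: measurable_cyl|by apply: bmf_indic; exact: measurable_cyl].
  by rewrite Pr_cyl draws_prob_cat cats0 mulrA.
apply: eq_Ex => w; rewrite -GE.
have [cw|ncw] := pselect (cyl s t w); last by rewrite indicE memNset// !(mulr0, mul0r).
by rewrite (cyl_path_draws cw) mulrC.
Qed.

Lemma Ex_post phi t : Ex Pr (post phi t) = pds phi [::].
Proof.
rewrite -[RHS](Ex_cst Pr).
have := @martingale (fun=> 1) 1 phi 0 t (fun=> ltac:(by rewrite normr1)).
by rewrite add0n; under eq_Ex do rewrite mul1r; move=> ->; apply: eq_Ex => w; rewrite mul1r.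
Qed.

Local Notation Xt e t := (fun w : Omega => pd (path_draws (path w) t) e).

Lemma bmf_pd e t : bmf (Xt e t).
Proof.
apply: bmf_01; first exact: (measurable_hist t (fun l => pd l e)).
by move=> w; rewrite draw_prob_ge0 ?draw_prob_le1.
Qed.

(** Martingale increments are orthogonal, so squared L2 distances are differences of the second
    moments [a], which are nondecreasing and bounded by 1. Hence the sequence is L2-Cauchy. *)
Lemma theta_ex (e : draw) : exists Y : Omega -> R,
  [/\ measurable_fun setT Y, forall w, 0 <= Y w <= 1 &
    Ex Pr (fun w => `|Xt e t w - Y w|) @[t --> \oo] --> (0 : R)].
Proof.
apply: L2_cauchy_L1_limit => [t|t w|].
- exact: (bmf_pd e t).1.
- by rewrite draw_prob_ge0 ?draw_prob_le1.
pose a t := Ex Pr (fun w => Xt e t w ^+ 2).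
have ortho t n : Ex Pr (fun w => Xt e t w * Xt e (t + n) w) = a t.
  pose G h := pd (path_draws (nth l0 h) t) e.
  transitivity (Ex Pr (fun w => G (hist t w) * post [:: e] (t + n) w)).
    by apply: eq_Ex => w; rewrite /G -path_drawsE /= mulr1.
  rewrite (@martingale G 1).
    by apply: eq_Ex => w; rewrite /G -path_drawsE /= mulr1.
  by move=> h; rewrite ger0_norm ?draw_prob_ge0 ?draw_prob_le1.
have diff t n : Ex Pr (fun w => (Xt e (t + n) w - Xt e t w) ^+ 2) = a (t + n)%N - a t.
  have -> : (fun w => (Xt e (t + n) w - Xt e t w) ^+ 2) = (fun w => Xt e (t + n) w ^+ 2 +
      (Xt e t w ^+ 2 - 2 * (Xt e t w * Xt e (t + n) w))) by apply/funext => w; ring.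
  have b1 := bmfM (bmf_pd e t) (bmf_pd e (t + n)).
  have b2 k : bmf (fun w => Xt e k w ^+ 2) by apply: bmf_exp; exact: bmf_pd.
  have b3 := bmfM (bmf_cst 2) b1.
  rewrite (ExD _ (b2 _)); last exact: (bmfB (b2 _) b3).
  by rewrite (ExB _ (b2 _) b3) (ExZl _ _ b1) ortho -!/(a _); ring.
have nda t n : (t <= n)%N -> a t <= a n.
  move=> tn; rewrite -subr_ge0 -(subnKC tn) -diff; apply: Ex_ge0 => w; exact: sqr_ge0.
have a1 t : a t <= 1.
  rewrite -(Ex_cst Pr 1); apply: le_Ex; [by apply: bmf_exp; exact: bmf_pd|exact: bmf_cst|].
  by move=> w; rewrite expr_le1 ?draw_prob_ge0 ?draw_prob_le1.
have ca : cvgn a by apply: nondecreasing_is_cvgn => //; exists 1 => _ [n _ <-].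
move=> eps eps0; move/cvgrPdist_le : (ca) => /(_ _ eps0)[N _ HN].
have aN n : (N <= n)%N -> a n - a N <= eps.
  move=> Nn; have := HN N (leqnn N).
  have : a n <= limn a by exact: nondecreasing_cvgn_le.
  by rewrite /= ler_norml => + /andP[_]; lra.
exists N => n k; wlog nk : n k / (n <= k)%N.
  move=> wl Nn Nk; case: (leqP n k) => [nk|/ltnW nk]; first exact: wl.
  by rewrite (eq_Ex _ (fun w => _ : _ = (Xt e k w - Xt e n w) ^+ 2)) ?wl// => w; ring.
move=> Nn Nk; rewrite (_ : Ex _ _ = Ex Pr (fun w => (Xt e k w - Xt e n w) ^+ 2)); last first.
  by apply: eq_Ex => w; ring.
by rewrite -(subnKC nk) diff subnKC// (le_trans _ (aN k Nk))// lerB ?nda.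
Qed.

(** If an age urn is drawn without bound but has shown at most [K] stays, its predictive probability
    of a stay is bounded by a constant over its number of draws; [q] further jumps become almost
    certain. *)
Lemma jumps_cvg1 (p : nat -> E) i y K q :
  (forall N, exists t, (N <= count (in_urn urn_of (inr (i, y))) (path_draws p t))%N) ->
  (forall t, (count_mem (inr ((i, y), false) : draw) (path_draws p t) <= K)%N) ->
  pds (nseq q (inr ((i, y), true))) (path_draws p t) @[t --> \oo] --> (1 : R).
Proof.
move=> unb bK; elim: q => [|q ih] /=; first exact: cvg_cst.
rewrite -[X in _ --> X]mulr1; apply: cvgM => //.
set jump := inr (i, y, true); set stay : draw := inr ((i, y), false).
have sE t : pd (nseq q jump ++ path_draws p t) jump = 1 - pd (nseq q jump ++ path_draws p t) stay.
  by apply/eqP; rewrite eq_sym subr_eq addrC eq_sym stay_jump_prob.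
rewrite (_ : (fun t => _) = (fun t => 1 - pd (nseq q jump ++ path_draws p t) stay)); last exact/funext.
rewrite -[X in _ --> X]subr0; apply: cvgB; first exact: cvg_cst.
apply/cvgrPdist_le => e e0.
have b0 : 0 < dw stay by exact: stay_weight_gt0.
have [t0 ht0] := unb (Num.trunc ((dw stay + K%:R) / e)).+1.
near=> t; rewrite sub0r normrN ger0_norm ?draw_prob_ge0//.
have c0 : count_mem stay (nseq q jump) = 0%N by rewrite count_nseq /= inr_eqE andbF mul0n.
have c1 : count (in_urn urn_of (urn_of stay)) (nseq q jump) = q.
  by rewrite count_nseq /in_urn eqxx mul1n.
rewrite /draw_prob !count_cat c0 c1 add0n.
have ct : (Num.trunc ((dw stay + K%:R) / e)).+1%:R <=
    (count (in_urn urn_of (urn_of stay)) (path_draws p t))%:R :> R.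
  rewrite ler_nat (leq_trans ht0)//; apply: count_path_draws_mono.
  by near: t; exact: nbhs_infty_ge.
have u0 := uw_gt0 (inr (i, y)).
set D := _ + (q + _)%:R.
have D0 : (Num.trunc ((dw stay + K%:R) / e)).+1%:R <= D.
  by rewrite (le_trans ct)// /D natrD addrA lerDr addr_ge0// ltW.
rewrite ler_pdivrMr ?(lt_le_trans _ D0)//.
apply: (@le_trans _ _ (dw stay + K%:R)); first by rewrite lerD2l ler_nat.
by rewrite mulrC -ler_pdivrMr// (le_trans _ D0)// ltW// truncnS_gt.
Unshelve. all: by end_near. Qed.

(** If a run of jumps kept probability above some [e], [draws_prob_nseq_le] would bound the sums of
    [b / (T + r)] by [1 / e], and the harmonic series would converge. The positive weight [b] of a
    stay is essential here. *)
Lemma jumps_cvg0 i y : pds (nseq q (inr ((i, y), true))) [::] @[q --> \oo] --> (0 : R).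
Proof.
set jump : draw := inr ((i, y), true); pose p q := pds (nseq q jump) [::].
have b0 := stay_weight_gt0 m c_pos F0_tail i y.
have T0 := uw_gt0 (inr (i, y)).
have p0 q : 0 <= p q by exact: draws_prob_ge0.
have lt : dw jump < uw (urn_of jump) by rewrite [uw _]age_weight ltrDl.
have bd q := draws_prob_nseq_le dw_ge0 uw_gt0 q [::] lt.
have ndp : {homo p : n k / (n <= k)%N >-> k <= n}.
  apply: (@homo_leq _ _ (fun x y => y <= x)) => // [a b c' ab bc|n]; first exact: le_trans ab.
  by rewrite /p /= ler_piMl ?draws_prob_ge0 ?draw_prob_le1.
apply/cvgrPdist_le => e e0; apply: contrapT => nh.
have pe q : e < p q.
  rewrite ltNge; apply/negP => pq; apply: nh; exists q => // n /= qn.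
  by rewrite sub0r normrN -/(p n) ger0_norm// (le_trans (ndp _ _ qn)).
apply: (@dvg_harmonic R); apply: nondecreasing_is_cvgn.
  by apply/nondecreasing_seqP => n; rewrite /series/= big_nat_recr//= lerDl invr_ge0.
set T := uw (inr (i, y)) in T0; set b := dw _ in b0.
(* Chosen so that [1 / (k + 1) <= C * (b / (T + k))]. *)
pose C := (T + 1) / b; have C0 : 0 < C by rewrite divr_gt0// addr_gt0.
exists (C / e) => _ [q _ <-]; rewrite /series /=.
have TA : uw (urn_of jump) + (count (in_urn urn_of (urn_of jump)) [::])%:R -
    (dw jump + (count_mem jump [::])%:R) = b.
  by rewrite /= !addr0 -/(dw jump) -/(uw (inr (i, y))) age_weight addrC addKr.
have h1 : \sum_(0 <= k < q) (k.+1%:R^-1 : R) <= C * \sum_(r < q) b / (T + r%:R).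
  rewrite big_mkord mulr_sumr; apply: ler_sum => k _; rewrite /C.
  have k0 : 0 <= (k%:R : R) by [].
  have -> : (T + 1) / b * (b / (T + k%:R)) = (T + 1) / (T + k%:R).
    by field; rewrite !gt_eqF// ltr_pwDl.
  rewrite ler_pdivlMr ?ltr_pwDl// mulrC ler_pdivrMr// -natr1; nra.
have h2 : p q * (1 + \sum_(r < q) b / (T + r%:R)) <= 1.
  apply: le_trans (bd q); rewrite ler_wpM2l// lerD2l; apply: ler_sum => r _.
  by rewrite TA /= addr0.
have s0 : 0 <= \sum_(r < q) b / (T + r%:R).
  by apply: sumr_ge0 => r _; rewrite divr_ge0 ?(ltW b0)// addr_ge0// ltW.
apply: (le_trans h1); rewrite ler_wpM2l ?(ltW C0)//.
rewrite -[leRHS]mul1r ler_pdivlMr// mulrC; have := pe q; nra.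
Unshelve. all: by end_near. Qed.

Lemma ae_forall_state (Q : E -> Omega -> Prop) :
  (forall i, {ae Pr, forall w, Q i w}) -> {ae Pr, forall w, forall i, Q i w}.
Proof.
move=> aeQ; have [g gI] := E_inj.
have : {ae Pr, forall w, forall n, forall i, g i = n -> Q i w}.
  apply: ae_foralln => n; have [[i gi]|ni] := pselect (exists i, g i = n).
    by apply: filterS (aeQ i) => w Qi j gj; rewrite (_ : j = i)//; apply: gI; rewrite gj.
  by apply: aeW => w j gj; exfalso; apply: ni; exists j.
by apply: filterS => w h i; exact: (h (g i)).
Qed.

Definition urn_unbounded (k : E + E * nat) w :=
  forall N, exists t, (N <= count (in_urn urn_of k) (path_draws (path w) t))%N.

(** On the exceptional event [D] the posterior probability of [q] jumps tends to 1, while its mean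
    over the whole space is at all times the initial probability of [q] jumps. So that probability
    bounds the measure of [D], and it vanishes as [q] grows. *)
Lemma stays_unbounded i y : {ae Pr, forall w, urn_unbounded (inr (i, y)) w ->
  forall N, exists t, (N <= count_mem (inr ((i, y), false) : draw) (path_draws (path w) t))%N}.
Proof.
set jump : draw := inr ((i, y), true); set stay : draw := inr ((i, y), false).
pose D := [set w | urn_unbounded (inr (i, y)) w /\
  exists K, forall t, (count_mem stay (path_draws (path w) t) <= K)%N].
have mD : measurable D.
  have mc (P : pred draw) (A : set nat) t :
      measurable [set w | A (count P (path_draws (path w) t))].
    have := @measurable_hist _ nat t (count P).
    by move/(_ measurableT A (I : measurable A)); rewrite setTI.
  rewrite (_ : D = (\bigcap_N \bigcup_t [set w | (N <= count (in_urn urn_of (inr (i, y))) (path_draws (path w) t))%N])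
     `&` (\bigcup_K \bigcap_t [set w | (count_mem stay (path_draws (path w) t) <= K)%N])); last first.
    apply/seteqP; split=> w [h1].
      move=> [K hK]; split; last by exists K => // t _; exact: hK.
      by move=> N _; have [t ht] := h1 N; exists t.
    move=> [K _ hK]; split; last by exists K => t; exact: hK.
    by move=> N; have [t _ ht] := h1 N I; exists t.
  apply: measurableI.
    apply: bigcapT_measurable => N; apply: bigcupT_measurable => t.
    exact: (mc _ [set n | (N <= n)%N]).
  apply: bigcupT_measurable => K; apply: bigcapT_measurable => t.
  exact: (mc _ [set n | (n <= K)%N]).
have bD : bmf (\1_D : Omega -> R) by exact: bmf_indic.
have le q : fine (Pr D) <= pds (nseq q jump) [::].
  have cv : Ex Pr (fun w => \1_D w * post (nseq q jump) t w) @[t --> \oo] --> Ex Pr (\1_D : Omega -> R).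
    apply: (@Ex_cvg _ _ _ _ 1) => //.
    - by move=> t; apply: (bmfM bD (bmf_pds _ _)).1.
    - move=> t w; rewrite normrM mulr_ile1//; first by rewrite indicE; case: (_ \in _); rewrite ?normr0 ?normr1.
      by rewrite ger0_norm ?draws_prob_ge0 ?draws_prob_le1.
    apply: aeW => w; have [Dw|nDw] := pselect (D w); last first.
      rewrite (_ : (fun t => _) = fun=> 0) ?indicE ?memNset//; first exact: cvg_cst.
      by apply/funext => t; rewrite mul0r.
    rewrite (_ : (fun t => _) = fun t => post (nseq q jump) t w); last first.
      by apply/funext => t; rewrite indicE mem_set// mul1r.
    by rewrite indicE mem_set//; have [h1 [K hK]] := Dw; apply: (jumps_cvg1 (K := K)).
  rewrite -Ex_indic// -(cvg_lim (@Rhausdorff R) cv).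
  apply: limr_le; first by apply/cvg_ex; eexists; exact: cv.
  near=> t; rewrite -(Ex_post _ t); apply: le_Ex; [|exact: bmf_pds|].
    by apply: bmfM => //; exact: bmf_pds.
  by move=> w; rewrite ler_piMl ?draws_prob_ge0// indicE; case: (_ \in _).
have D0 : Pr D = 0%E.
  rewrite -[Pr D]fineK ?fin_num_measure//; congr (_%:E); apply/eqP; rewrite eq_le fine_ge0// andbT.
  rewrite -(cvg_lim (@Rhausdorff R) (@jumps_cvg0 i y)).
  apply: limr_ge; first by apply/cvg_ex; eexists; exact: jumps_cvg0.
  exact: nearW.
exists D; split => // w /not_implyP[h1 h2]; split => //.
apply: contrapT => h3; apply: h2 => N; apply: contrapT => h4; apply: h3; exists N => t.
by rewrite leqNgt; apply/negP => h5; apply: h4; exists t; exact: ltnW.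
Unshelve. all: by end_near. Qed.

Hypothesis S_recurrent : recurrent Pr (fun t => S t).

(** Induction on the age: each completed visit draws from the urn of index 0, and each stay, apart
    from a pending one, leads to a draw from the next urn. *)
Lemma urns_unbounded : {ae Pr, forall w, forall k, urn_unbounded k w}.
Proof.
have rows : {ae Pr, forall w, forall i, urn_unbounded (inl i) w}.
  by apply: filterS S_recurrent => w rw i N; exact: recurrent_count.
have ages : {ae Pr, forall w, forall i, forall y, urn_unbounded (inr (i, y)) w}.
  apply: ae_forall_state => i; apply: ae_foralln; elim=> [|y ih].
    apply: filterS rows => w h N; have [t ht] := h i N; exists t.
    by rewrite count_age0 (leq_trans ht)// leq_addr.
  apply: filterS2 ih (stays_unbounded i y) => w h1 h2 N.
  have [t ht] := h2 h1 N.+1; exists t.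
  by rewrite -ltnS (leq_trans ht)// -count_ageS -[leqRHS]addn1 leq_add2l; case: (_ && _).
by apply: filterS2 rows ages => w h1 h2 [i|[i y]].
Qed.

(** * Joint moments of the limits and the path *)

Section limits.
Context (theta : @draw dE E -> Omega -> R).
Hypotheses (mtheta : forall e, measurable_fun setT (theta e))
  (theta01 : forall e w, 0 <= theta e w <= 1)
  (theta_lim : forall e, Ex Pr (fun w => `|Xt e t w - theta e w|) @[t --> \oo] --> (0 : R)).

Lemma bmf_theta e : bmf (theta e).
Proof. exact: bmf_01 (mtheta e) (theta01 e). Qed.

Lemma prod_dist (I : Type) (r : seq I) (a b : I -> R) :
  (forall i, 0 <= a i <= 1) -> (forall i, 0 <= b i <= 1) ->
  `|\prod_(i <- r) a i - \prod_(i <- r) b i| <= \sum_(i <- r) `|a i - b i|.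
Proof.
move=> a01 b01; elim: r => [|i r ih]; first by rewrite !big_nil subrr normr0.
rewrite !big_cons.
have -> : a i * \prod_(j <- r) a j - b i * \prod_(j <- r) b j =
  (a i - b i) * \prod_(j <- r) a j + b i * (\prod_(j <- r) a j - \prod_(j <- r) b j) by ring.
rewrite (le_trans (ler_normD _ _))//; apply: lerD.
  by have /andP[? ?] := prod_01 r a01; rewrite normrM ler_piMr// ger0_norm.
by have /andP[? ?] := b01 i; rewrite normrM (le_trans _ ih)// ler_piMl// ger0_norm.
Qed.

(** By [draw_prob_dist], earlier draws of [phi] affect a predictive probability by at most
    [size phi] over the content of its urn, which grows without bound. This is where recurrence
    enters. *)
Lemma posterior_cvg (phi : seq (@draw dE E)) : {ae Pr, forall w,
  post phi t w - \prod_(e <- phi) Xt e t w @[t --> \oo] --> (0 : R)}.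
Proof.
apply: filterS urns_unbounded => w unb; elim: phi => [|e phi ih].
  by under eq_cvg do rewrite big_nil subrr; exact: cvg_cst.
set q := fun t => \prod_(e <- phi) Xt e t w.
apply/cvgrPdist_le => eps eps0.
have e20 : 0 < eps / 2 by rewrite divr_gt0.
have [t0 ht0] := unb (urn_of e) (Num.trunc ((size phi)%:R / (eps / 2))).+1.
near=> t; rewrite sub0r normrN big_cons -/(q t) /=.
set l := path_draws _ t.
have -> : pd (phi ++ l) e * pds phi l - pd l e * q t =
  (pd (phi ++ l) e - pd l e) * pds phi l + pd l e * (pds phi l - q t) by ring.
rewrite (le_trans (ler_normD _ _))// (splitr eps) lerD//; last first.
  rewrite normrM (@le_trans _ _ `|pds phi l - q t|)//.
    by rewrite ler_piMl// ger0_norm ?draw_prob_ge0 ?draw_prob_le1.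
  rewrite -normrN -sub0r /l; near: t; move: (eps / 2) e20; exact/cvgrPdist_le.
rewrite normrM (@le_trans _ _ `|pd (phi ++ l) e - pd l e|)//.
  by rewrite ler_piMr// ger0_norm ?draws_prob_ge0 ?draws_prob_le1.
rewrite (le_trans (draw_prob_dist dw_ge0 dw_le uw_gt0 _ _ _))//.
set D := uw _ + _; have D0 : 0 < D by rewrite ltr_pwDl.
rewrite ler_pdivrMr// mulrC -ler_pdivrMr//.
apply: (@le_trans _ _ (Num.trunc ((size phi)%:R / (eps / 2))).+1%:R); first by rewrite ltW// truncnS_gt.
apply: (@le_trans _ _ (count (in_urn urn_of (urn_of e)) l)%:R); last by rewrite /D lerDr ltW.
rewrite ler_nat (leq_trans ht0)//; apply: count_path_draws_mono.
by near: t; exact: nbhs_infty_ge.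
Unshelve. all: by end_near. Qed.

(** For [n >= t] the exact value minus the expectation on the left is [u1 n + u2 n]: the posterior
    is replaced by the product of predictive probabilities, then that product by the limits. Both
    errors vanish, while the difference does not depend on [n]. *)
Lemma theta_moment s t (phi : seq (@draw dE E)) :
  Ex Pr (fun w => \1_(cyl s t) w * \prod_(e <- phi) theta e w) =
  pds (phi ++ path_draws s t) [::] * (s 0%N == l0)%:R.
Proof.
have bc : bmf (\1_(cyl s t) : Omega -> R) by apply: bmf_indic; exact: measurable_cyl.
have bth : bmf (fun w => \prod_(e <- phi) theta e w) by apply: bmf_prod => e; exact: bmf_theta.
have bX n : bmf (fun w => \prod_(e <- phi) Xt e n w) by apply: bmf_prod => e; exact: bmf_pd.
have bd n e : bmf (fun w => `|Xt e n w - theta e w|).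
  by apply: bmf_norm; apply: bmfB; [exact: bmf_pd|exact: bmf_theta].
have pX n e w : 0 <= Xt e n w <= 1 by rewrite draw_prob_ge0 ?draw_prob_le1.
have c1 w : `|\1_(cyl s t) w : R| <= 1 by rewrite indicE; case: (_ \in _); rewrite ?normr0 ?normr1.
have lim1 : Ex Pr (fun w => \1_(cyl s t) w * (post phi n w - \prod_(e <- phi) Xt e n w))
    @[n --> \oo] --> (0 : R).
  rewrite -[X in _ --> X](Ex_cst Pr); apply: (@Ex_cvg _ _ _ _ 1).
  - by move=> n; apply: (bmfM bc (bmfB (bmf_pds _ _) (bX n))).1.
  - move=> n w; rewrite normrM mulr_ile1//.
    have /andP[h1 h2] := prod_01 phi (pX n ^~ w).
    have h3 : 0 <= pds phi (path_draws (path w) n) by exact: draws_prob_ge0.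
    have h4 : pds phi (path_draws (path w) n) <= 1 by exact: draws_prob_le1.
    by rewrite ler_norml; apply/andP; split; lra.
  - exact: bmf_cst.
  apply: filterS (posterior_cvg phi) => w h.
  by rewrite -[X in _ --> X](mulr0 (\1_(cyl s t) w)); apply: cvgM => //; exact: cvg_cst.
have lim2 : Ex Pr (fun w => \1_(cyl s t) w * (\prod_(e <- phi) Xt e n w - \prod_(e <- phi) theta e w))
    @[n --> \oo] --> (0 : R).
  have sum0 : \sum_(e <- phi) Ex Pr (fun w => `|Xt e n w - theta e w|) @[n --> \oo] --> (0 : R).
    elim: (phi) => [|e l ih]; first by under eq_cvg do rewrite big_nil; exact: cvg_cst.
    have h := cvgD (theta_lim e) ih; rewrite addr0 in h.
    rewrite (_ : (fun n => _) = (fun n => Ex Pr (fun w => `|Xt e n w - theta e w|) +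
      \sum_(e0 <- l) Ex Pr (fun w => `|Xt e0 n w - theta e0 w|))); first exact: h.
    by apply/funext => n; rewrite big_cons.
  apply/cvgrPdist_le => e e0; move/cvgrPdist_le : sum0 => /(_ e e0).
  apply: filterS => n; rewrite !sub0r !normrN => h; apply: le_trans h.
  have bb : bmf (fun w => \1_(cyl s t) w * (\prod_(e <- phi) Xt e n w - \prod_(e <- phi) theta e w)).
    by apply: bmfM => //; exact: bmfB.
  rewrite (le_trans (le_norm_Ex _ bb))// (le_trans _ (ler_norm _))// -Ex_sum//.
  apply: le_Ex; [exact: bmf_norm|exact: bmf_sum|move=> w].
  rewrite normrM (le_trans _ (prod_dist _ (pX n ^~ w) (theta01 ^~ w)))//.
  by rewrite ler_piMl.
pose u1 n := Ex Pr (fun w => \1_(cyl s t) w * (post phi n w - \prod_(e <- phi) Xt e n w)).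
pose u2 n := Ex Pr (fun w => \1_(cyl s t) w * (\prod_(e <- phi) Xt e n w - \prod_(e <- phi) theta e w)).
have lim3 : u1 n + u2 n @[n --> \oo] --> (0 : R) by rewrite -[X in _ --> X]addr0; exact: cvgD.
set C := pds _ _ * _; apply/eqP; rewrite eq_sym -subr_eq0; apply/eqP.
apply: (cvg_eq _ lim3 (fun=> erefl)); apply: cvg_near_cst; near=> n; rewrite /u1 /u2.
have tn : (t <= n)%N by near: n; exact: nbhs_infty_ge.
rewrite /C -(cyl_martingale s phi t (n - t)) subnKC//.
rewrite -[RHS]ExB; [|by apply: bmfM => //; exact: bmf_pds|exact: bmfM].
rewrite -ExD; [|by apply: bmfM => //; apply: bmfB => //; exact: bmf_pds|by apply: bmfM => //; exact: bmfB].
by apply: eq_Ex => w /=; ring.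
Unshelve. all: by end_near. Qed.

End limits.

End reinforced_process.

(** * Dirichlet laws from gamma variables *)

Section independent_gammas.
Context {R : realType}.

(** The gamma identity in coordinate [j], tested on a monomial times a power of the inverse of the
    regularised sum. The positive [s] keeps the denominator away from zero, and quantifying over it
    lets frozen coordinates be absorbed in it. *)
Definition stein {d} {O : measurableType d} (Q : probability O R) n (a : 'I_n -> R)
    (Z : 'I_n -> O -> R) := forall j (k : 'I_n -> nat) (K : nat) (s : R), 0 < s ->
  let M w := \prod_i Z i w ^+ k i in let W w := (\sum_i Z i w + s)^-1 in
  (\int[Q]_w ((a j + (k j)%:R) * (M w * W w ^+ K))%:E =
   \int[Q]_w (Z j w * M w * W w ^+ K + K%:R * (Z j w * M w * W w ^+ K.+1))%:E)%E.

Lemma eq_integral_scale {d} {T : measurableType d} (mu : probability T R) (c : R) (f g : T -> R) :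
  0 <= c -> measurable_fun setT f -> measurable_fun setT g ->
  (forall x, 0 <= f x) -> (forall x, 0 <= g x) ->
  (\int[mu]_x (f x)%:E = \int[mu]_x (g x)%:E)%E ->
  (\int[mu]_x (c * f x)%:E = \int[mu]_x (c * g x)%:E)%E.
Proof.
move=> c0 mf mg f0 g0 fg.
have scale (h : T -> R) : measurable_fun setT h -> (forall x, 0 <= h x) ->
    (\int[mu]_x (c * h x)%:E = c%:E * \int[mu]_x (h x)%:E)%E.
  move=> mh h0; under eq_integral do rewrite EFinM.
  by rewrite ge0_integralZl//; [exact/measurable_EFinP|move=> x _; rewrite lee_fin].
by rewrite !scale// fg.
Qed.

Lemma measurable_stein {d} {T : measurableType d} (c : R) (K : nat) (Y M W : T -> R) :
  measurable_fun setT Y -> measurable_fun setT M -> measurable_fun setT W ->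
  measurable_fun setT (fun w => c * (M w * W w ^+ K)) /\
  measurable_fun setT (fun w => Y w * M w * W w ^+ K + K%:R * (Y w * M w * W w ^+ K.+1)).
Proof.
move=> mY mM mW; have mYM := measurable_funM mY mM.
split; first by apply: measurable_funM => //; apply: measurable_funM => //; exact: measurable_funX.
apply: measurable_funD; first by apply: measurable_funM => //; exact: measurable_funX.
by apply: measurable_funM => //; apply: measurable_funM => //; exact: measurable_funX.
Qed.

Lemma big_seq_lift0 {V : Type} {idx : V} (op : Monoid.com_law idx) n (J : seq 'I_n.+1)
    (F : 'I_n.+1 -> V) : uniq J ->
  \big[op/idx]_(j <- J) F j = op (if ord0 \in J then F ord0 else idx)
    (\big[op/idx]_(i <- pmap (unlift ord0) J) F (lift ord0 i)).
Proof.
elim: J => [|j J ih] /=; first by rewrite !big_nil Monoid.mul1m.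
move=> /andP[jJ uJ]; rewrite big_cons ih// in_cons.
case: unliftP jJ => [i ->|->] jJ /=.
  by rewrite big_cons Monoid.mulmCA.
by rewrite ?eqxx (negbTE jJ) Monoid.mul1m.
Qed.

(** One gamma is added at a time as a new factor of a product space. For the identity in coordinate
    [j], integration is performed first in the factor carrying [j]; the other factor only shifts [s]
    and contributes a constant multiple. *)
Lemma indep_gammas n (a : 'I_n -> R) : (forall j, 0 <= a j) ->
  exists d (O : measurableType d) (Q : probability O R) (Z : 'I_n -> {RV Q >-> R}),
  [/\ indep Q (fun j => sigma_rv (Z j)),
      forall j B, measurable B -> distribution Q (Z j) B = gamma_law (a j) B,
      forall j w, 0 <= Z j w & stein Q a Z].
Proof.
elim: n a => [|n ih] a a0.
  exists _, R, (@dirac _ R 0 R), (fun j => cst 0 : {RV _ >-> R}); split=> [|[]|[]|[]]//.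
  case=> [|[]//] A _ _; rewrite big_nil (_ : \bigcap_(i in _) A i = setT) ?probability_setT//.
  by apply/seteqP; split => // x _ i.
have [d [Om [Q [Z [indZ lawZ Z0 steinZ]]]]] := ih (a \o lift ord0) (fun j => a0 _).
have [Q1 [lawQ1 steinQ1]] := gamma_law_moments (a0 ord0).
pose y (x : R) := Num.max 0 x; rewrite -/y in lawQ1 steinQ1.
have my : measurable_fun setT y by exact: measurable_maxr.
have y0 x : 0 <= y x by rewrite le_max lexx.
pose P : probability (R * Om)%type R := (Q1 \x Q)%E.
pose Z1 j (w : R * Om) : R := if unlift ord0 j is Some i then Z i w.2 else y w.1.
have mZ1 j : measurable_fun setT (Z1 j).
  rewrite /Z1; case: (unlift ord0 j) => [i|].
    by apply: (measurableT_comp (f := Z i)) => //; exact: measurable_snd.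
  by apply: (measurableT_comp my); exact: measurable_fst.
pose ZZ j : {RV P >-> R} := HB.pack (Z1 j) (isMeasurableFun.Build _ _ _ _ _ (mZ1 j)).
have ZZ0 w : Z1 ord0 w = y w.1 by rewrite /Z1 unlift_none.
have ZZl i w : Z1 (lift ord0 i) w = Z i w.2 by rewrite /Z1 liftK.
have PX (A : set R) (B : set Om) : measurable A -> measurable B -> P (A `*` B) = (Q1 A * Q B)%E.
  by move=> mA mB; exact: product_measure1E.
have mpre i A : sigma_rv (Z i) A -> measurable A.
  by move=> [B mB <-]; exact: measurable_funPT.
have [w0 _] : exists w : Om, True.
  apply: contrapT => no; have := probability_setT Q.
  rewrite (_ : setT = set0) ?measure0; last first.
    by apply/seteqP; split => // w _; apply: no; exists w.
  by move=> /esym/eqP; rewrite onee_eq0.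
exists _, (R * Om)%type, P, ZZ; split.
- move=> J A uJ sA; have memJ i : (i \in pmap (unlift ord0) J) = (lift ord0 i \in J).
    rewrite mem_pmap; apply/mapP/idP => [[j jJ]|iJ]; last by exists (lift ord0 i); rewrite ?liftK.
    by case: unliftP jJ => // l -> lJ [->].
  (* An event of a later coordinate is a cylinder over the second factor, so its slice at 0 recovers
     the base. *)
  pose A1 i := [set w | A (lift ord0 i) (0, w)].
  have sA1 i : i \in pmap (unlift ord0) J -> sigma_rv (Z i) (A1 i) /\ A (lift ord0 i) = setT `*` A1 i.
    rewrite memJ => iJ.
    have [B mB AB] := sA _ iJ; split.
      by exists B => //; rewrite /A1 -AB; apply/seteqP; split => w /=; rewrite ?ZZl//; case.
    by rewrite /A1 -AB; apply/seteqP; split => [[x w]|[x w]] /=; rewrite ?ZZl//; case.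
  have [A0 [mA0 EA0]] : exists A0, measurable A0 /\ (ord0 \in J -> A ord0 = A0 `*` setT).
    case: (boolP (ord0 \in J)) => [oJ|_]; last by exists setT.
    have [B mB AB] := sA _ oJ; exists (y @^-1` B); split.
      by rewrite -[X in measurable X]setTI; exact: my.
    by move=> _; rewrite -AB; apply/seteqP; split => [[x w]|[x w]] /=; rewrite ?ZZ0//; case.
  pose J1 := pmap (unlift ord0) J.
  have uJ1 : uniq J1 by apply: pmap_uniq uJ => j; case: unliftP => [i ->|->] //=.
  have mA1 : measurable (\bigcap_(i in [set` J1]) A1 i).
    by apply: fin_bigcap_measurable => // i /sA1[/mpre].
  have -> : \bigcap_(i in [set` J]) A i =
      (if ord0 \in J then A0 else setT) `*` (\bigcap_(i in [set` J1]) A1 i).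
    apply/seteqP; split => [[x w] h|[x w] [/= h0 h1] j /= jJ].
      split => /=; first by case: ifPn => // oJ; have := h _ oJ; rewrite EA0//= => -[].
      by move=> i iJ; have [_ e] := sA1 i iJ; have := h (lift ord0 i); rewrite e /= -memJ => /(_ iJ)[].
    case: (unliftP ord0 j) jJ => [i ->|->] jJ; last by rewrite EA0//=; rewrite jJ in h0.
    have iJ : i \in J1 by rewrite memJ.
    by have [_ ->] := sA1 i iJ; split => //=; exact: h1.
  rewrite PX//; last by case: ifP.
  rewrite indZ// ?big_seq_lift0//; last by move=> i /sA1[].
  congr (_ * _)%E.
    case: ifPn => [oJ|_]; last by rewrite probability_setT.
    by rewrite EA0// PX// probability_setT mule1.
  rewrite big_seq [RHS]big_seq; apply: eq_bigr => i iJ; have [/mpre m1 ->] := sA1 i iJ.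
  by rewrite PX// probability_setT mul1e.
- move=> j B mB; rewrite /distribution/= /pushforward.
  case: (unliftP ord0 j) => [i ->|->].
    rewrite -lawZ//.
    rewrite (_ : _ @^-1` _ = setT `*` (Z i @^-1` B)).
      rewrite PX ?probability_setT ?mul1e//.
      by rewrite -[X in measurable X]setTI; exact: measurable_funPT.
    by apply/seteqP; split => w /=; rewrite ZZl// => -[].
  rewrite -lawQ1// (_ : _ @^-1` _ = (y @^-1` B) `*` setT).
    rewrite PX ?probability_setT ?mule1//.
    by rewrite -[X in measurable X]setTI; exact: my.
  by apply/seteqP; split => w /=; rewrite ZZ0// => -[].
- by move=> j w; rewrite /= /Z1; case: unlift.
- move=> j k K s s0 M W.
  pose k1 i := k (lift ord0 i).
  pose M1 w := \prod_i Z i w ^+ k1 i; pose S1 w := \sum_i Z i w.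
  have ME w : M w = y w.1 ^+ k ord0 * M1 w.2.
    rewrite /M big_ord_recl /= ZZ0; congr (_ * _); apply: eq_bigr => i _.
    by rewrite /= ZZl.
  have SE w : \sum_i ZZ i w = y w.1 + S1 w.2.
    by rewrite big_ord_recl /= ZZ0; congr (_ + _); apply: eq_bigr => i _; rewrite /= ZZl.
  have WE w : W w = (y w.1 + (s + S1 w.2))^-1.
    by congr (_^-1); rewrite -[X in X + s]/(\sum_i ZZ i w) SE; ring.
  have WE' w : W w = (S1 w.2 + (s + y w.1))^-1.
    by rewrite WE; congr (_^-1); ring.
  have M1_0 w : 0 <= M1 w by apply: prodr_ge0 => i _; rewrite exprn_ge0.
  have S1_0 w : 0 <= S1 w by apply: sumr_ge0.
  have ZZ_0 i w : 0 <= Z1 i w by rewrite /Z1; case: unlift.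
  have W0 w : 0 <= W w.
    by rewrite invr_ge0; apply: addr_ge0; [apply: sumr_ge0 => i _; exact: ZZ_0|exact: ltW].
  have M0 w : 0 <= M w by rewrite ME mulr_ge0 ?exprn_ge0.
  have mM : measurable_fun setT M.
    by apply: measurable_prod => i _; exact: measurable_funX.
  have mW : measurable_fun setT W.
    apply: measurable_invr_ge0 => [|w]; last by rewrite -invr_ge0; exact: W0.
    by apply: measurable_funD => //; exact: measurable_sum.
  have [/measurable_EFinP mL /measurable_EFinP mR] :=
    measurable_stein (a j + (k j)%:R) K (mZ1 j) mM mW.
  have L0 w : (0 <= ((a j + (k j)%:R) * (M w * W w ^+ K))%:E)%E.
    by rewrite lee_fin !mulr_ge0 ?exprn_ge0// addr_ge0.
  have R0 w : (0 <= (Z1 j w * M w * W w ^+ K + K%:R * (Z1 j w * M w * W w ^+ K.+1))%:E)%E.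
    by rewrite lee_fin addr_ge0 ?mulr_ge0 ?exprn_ge0.
  rewrite (@fubini_tonelli1 _ _ _ _ R Q1 Q _ mL L0) (@fubini_tonelli1 _ _ _ _ R Q1 Q _ mR R0).
  case: (unliftP ord0 j) => [i|] jE; last first.
    rewrite (@fubini_tonelli _ _ _ _ R Q1 Q _ mL L0) (@fubini_tonelli _ _ _ _ R Q1 Q _ mR R0).
    apply: eq_integral => w _; rewrite /fubini_G.
    have s1 : 0 < s + S1 w by rewrite ltr_pwDl.
    have mw1 : measurable_fun setT (fun x => (y x + (s + S1 w))^-1).
      apply: measurable_invr_ge0 => [|x]; last by rewrite addr_ge0// ltW.
      exact: measurable_funD.
    have w10 x : 0 <= (y x + (s + S1 w))^-1 by rewrite invr_ge0 addr_ge0// ltW.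
    have mk : measurable_fun setT (fun x => y x ^+ k ord0) by exact: measurable_funX.
    have [m1 m2] := measurable_stein (a ord0 + (k ord0)%:R) K my mk mw1.
    have a00 := a0 ord0.
    etransitivity; last (etransitivity; first apply: (@eq_integral_scale _ _ Q1 _ _ _ (M1_0 w) m1 m2)).
    - by apply: eq_integral => x _; rewrite /= WE ME /= jE; congr EFin; ring.
    - by move=> x; rewrite !mulr_ge0 ?exprn_ge0// addr_ge0.
    - by move=> x; rewrite addr_ge0 ?mulr_ge0 ?exprn_ge0.
    - by under [RHS]eq_integral do rewrite -exprS; exact: steinQ1.
    by apply: eq_integral => x _; rewrite /= WE ME /= jE ZZ0/=; congr EFin; ring.
  apply: eq_integral => x _; rewrite /fubini_F.
  have s1 : 0 < s + y x by rewrite ltr_pwDl.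
  have mS : measurable_fun setT S1 by exact: measurable_sum.
  have mw1 : measurable_fun setT (fun w => (S1 w + (s + y x))^-1).
    apply: measurable_invr_ge0 => [|w]; last by rewrite addr_ge0// ltW.
    exact: measurable_funD.
  have w10 w : 0 <= (S1 w + (s + y x))^-1 by rewrite invr_ge0 addr_ge0// ltW.
  have mM1 : measurable_fun setT M1 by apply: measurable_prod => l _; exact: measurable_funX.
  have [m1 m2] := measurable_stein (a j + (k j)%:R) K (measurable_funPT (Z i)) mM1 mw1.
  have aj0 := a0 j; have yk0 : 0 <= y x ^+ k ord0 by rewrite exprn_ge0.
  etransitivity; last (etransitivity; first apply: (@eq_integral_scale _ _ Q _ _ _ yk0 m1 m2)).
  - by apply: eq_integral => w _; rewrite /= WE' ME /=; congr EFin; ring.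
  - by move=> w; rewrite !mulr_ge0 ?exprn_ge0// addr_ge0.
  - by move=> w; rewrite addr_ge0 ?mulr_ge0 ?exprn_ge0.
  - by have := steinZ i k1 K _ s1; rewrite /k1 jE.
  apply: eq_integral => w _; rewrite /= WE' ME /= jE ZZl/=.
  by congr EFin; ring.
Qed.

End independent_gammas.

Section dirichlet_moments.
Context {R : realType} {d} {O : measurableType d} (Q : probability O R).
Context (n : nat) (a : 'I_n -> R) (Z : 'I_n -> {RV Q >-> R}).
Hypotheses (a0 : forall j, 0 <= a j) (Z0 : forall j w, 0 <= Z j w) (stZ : stein Q a Z).

Let S w := \sum_h Z h w.
Let Vs (s : R) j w := Z j w / (S w + s).
Let V j w := Z j w / S w.
Let A := \sum_j a j.
Let tot (s : R) phi w := \prod_(r <- phi) Vs s r w.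

Let S0 w : 0 <= S w. Proof. exact: sumr_ge0. Qed.

Let Z_le j w : Z j w <= S w.
Proof. by rewrite /S (bigD1 j)//= lerDl sumr_ge0. Qed.

Let Vs01 s j w : 0 <= s -> 0 <= Vs s j w <= 1.
Proof.
move=> s0; rewrite divr_ge0 ?addr_ge0//=.
have [e|S_s] := eqVneq (S w + s) 0; first by rewrite /Vs e invr0 mulr0.
rewrite ler_pdivrMr ?lt0r ?S_s ?addr_ge0// mul1r.
by rewrite (le_trans (Z_le j w))// lerDl.
Qed.

Let mVs s j : 0 <= s -> measurable_fun setT (Vs s j).
Proof.
move=> s0; apply: measurable_funM => //; apply: measurable_invr_ge0 => [|w]; last by rewrite addr_ge0.
by apply: measurable_funD => //; exact: measurable_sum.
Qed.

Let V0 j w : Vs 0 j w = V j w. Proof. by rewrite /Vs addr0. Qed.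

Let tot01 s phi w : 0 <= s -> 0 <= tot s phi w <= 1.
Proof. by move=> s0; apply: prod_01 => i; exact: Vs01. Qed.

Let mtot s phi : 0 <= s -> measurable_fun setT (tot s phi).
Proof. by move=> s0; apply: measurable_prod => i _; exact: mVs. Qed.

Let le_tot s t phi w : 0 < s -> s <= t -> tot t phi w <= tot s phi w.
Proof.
move=> s0 st; apply: ler_prod => i _; have /andP[-> _] /= := Vs01 i w (le_trans (ltW s0) st).
by rewrite ler_wpM2l// lef_pV2 ?posrE ?ltr_wpDl ?(lt_le_trans s0)// lerD2l.
Qed.

Let cvg_tot phi w : tot n.+1%:R^-1 phi w @[n --> \oo] --> tot 0 phi w.
Proof.
have cV j : Vs n.+1%:R^-1 j w @[n --> \oo] --> Vs 0 j w.
  have [e|Sn] := eqVneq (S w) 0.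
    have Zj : Z j w = 0 by apply/le_anti; rewrite Z0 -e Z_le.
    rewrite /Vs Zj mul0r (_ : (fun n => _) = fun=> 0); first exact: cvg_cst.
    by apply/funext => k; rewrite mul0r.
  rewrite /Vs; apply: cvgM; first exact: cvg_cst.
  apply: cvgV; first by rewrite addr0.
  by apply: cvgD; [exact: cvg_cst|exact: cvg_harmonic].
elim: phi => [|j phi ih]; rewrite /tot.
  rewrite big_nil (_ : (fun n => _) = fun=> 1); first exact: cvg_cst.
  by apply/funext => k; rewrite big_nil.
rewrite big_cons (_ : (fun n => _) = fun n => Vs n.+1%:R^-1 j w * tot n.+1%:R^-1 phi w).
  by apply: cvgM => //; exact: cV.
by apply/funext => k; rewrite big_cons.
Qed.

Let stein_tot s j phi : 0 < s ->
  (\int[Q]_w ((a j + (count_mem j phi)%:R) * tot s phi w)%:E =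
   \int[Q]_w (Z j w * tot s phi w + (size phi)%:R * tot s (j :: phi) w)%:E)%E.
Proof.
move=> s0; have totE psi w : tot s psi w =
    \prod_i Z i w ^+ (count_mem i psi) * (S w + s)^-1 ^+ size psi.
  elim: psi => [|i psi ih]; first by rewrite /tot big_nil big1// expr0 mulr1.
  rewrite /tot big_cons -/(tot s psi w) ih /= exprS /Vs.
  under [in RHS]eq_bigr do rewrite exprD.
  rewrite big_split/= (_ : \prod_l Z l w ^+ (i == l) = Z i w); first by ring.
  rewrite (bigD1 i)//= eqxx expr1 big1 ?mulr1// => l.
  by rewrite eq_sym => /negbTE ->; rewrite expr0.
have := stZ j (fun i => count_mem i phi) (size phi) s0 => /= h.
etransitivity; last (etransitivity; first exact: h).
  by apply: eq_integral => w _; rewrite totE mulrA.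
apply: eq_integral => w _; rewrite !totE /=; congr EFin.
rewrite [in RHS](_ : \prod_i Z i w ^+ ((j == i) + count_mem i phi) =
    Z j w * \prod_i Z i w ^+ count_mem i phi); first by rewrite exprS; ring.
under eq_bigr do rewrite exprD.
rewrite big_split/=; congr (_ * _).
rewrite (bigD1 j)//= eqxx expr1 big1 ?mulr1// => l.
by rewrite eq_sym => /negbTE ->; rewrite expr0.
Qed.

Let e phi := Ex Q (tot 0 phi).
Let T phi j : \bar R := \int[Q]_w (Z j w * tot 0 phi w)%:E.

Let mono (g : nat -> O -> R) (h : O -> R) : (forall k, measurable_fun setT (g k)) ->
  (forall k w, 0 <= g k w) -> (forall w k l, (k <= l)%N -> g k w <= g l w) ->
  (forall w, g k w @[k --> \oo] --> h w) ->
  (\int[Q]_w (g k w)%:E)%E @[k --> \oo] --> (\int[Q]_w (h w)%:E)%E.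
Proof.
move=> mg g0 gle gh.
have -> : (\int[Q]_w (h w)%:E = \int[Q]_w limn (fun k => (g k w)%:E))%E.
  apply: eq_integral => w _; apply/esym/cvg_lim => //.
  by apply: cvg_EFin; [exact: nearW|exact: gh].
apply: cvg_monotone_convergence => //.
- by move=> k; exact/measurable_EFinP.
- by move=> k w _; rewrite lee_fin.
- by move=> w _ k l kl; rewrite lee_fin gle.
Qed.

Let btot phi : bmf (tot 0 phi).
Proof. by apply: bmf_01 => [|w]; [exact: mtot|exact: tot01]. Qed.

Let tot_ge0 s phi w : 0 <= s -> 0 <= tot s phi w.
Proof. by move=> s0; have /andP[] := tot01 phi w s0. Qed.

Let inv_le k l : (k <= l)%N -> (l.+1%:R^-1 : R) <= k.+1%:R^-1.
Proof. by move=> kl; rewrite lef_pV2 ?posrE// ler_nat. Qed.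

Let mZtot s j phi : 0 <= s -> measurable_fun setT (fun w => Z j w * tot s phi w).
Proof. by move=> s0; apply: measurable_funM => //; exact: mtot. Qed.

(** The Stein identity as [s] decreases to 0. All integrands increase, so the limit holds in the
    extended reals; the finite left side then shows that [T phi j] is finite. *)
Let step1 j phi : (((a j + (count_mem j phi)%:R) * e phi)%:E =
  T phi j + ((size phi)%:R * e (j :: phi))%:E)%E.
Proof.
pose c := a j + (count_mem j phi)%:R; have c0 : 0 <= c by rewrite addr_ge0.
have lhs : (\int[Q]_w (c * tot k.+1%:R^-1 phi w)%:E)%E @[k --> \oo] -->
    (\int[Q]_w (c * tot 0 phi w)%:E)%E.
  apply: mono => [k|k w|w k l kl|w].
  - by apply: measurable_funM => //; exact/mtot/ltW.
  - by rewrite mulr_ge0// tot_ge0// ltW.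
  - by rewrite ler_wpM2l// le_tot// inv_le.
  - by apply: cvgM; [exact: cvg_cst|exact: cvg_tot].
have rhs : (\int[Q]_w (Z j w * tot k.+1%:R^-1 phi w +
      (size phi)%:R * tot k.+1%:R^-1 (j :: phi) w)%:E)%E @[k --> \oo] -->
    (\int[Q]_w (Z j w * tot 0 phi w + (size phi)%:R * tot 0 (j :: phi) w)%:E)%E.
  apply: mono => [k|k w|w k l kl|w].
  - apply: measurable_funD; first exact/mZtot/ltW.
    by apply: measurable_funM => //; exact/mtot/ltW.
  - by rewrite addr_ge0// mulr_ge0// tot_ge0// ltW.
  - by rewrite lerD// ler_wpM2l// le_tot// inv_le.
  - by apply: cvgD; apply: cvgM; [exact: cvg_cst|exact: cvg_tot|exact: cvg_cst|exact: cvg_tot].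
have -> : ((c * e phi)%:E = \int[Q]_w (c * tot 0 phi w)%:E)%E.
  by rewrite Ex_EFin ?ExZl//; apply: bmfM => //; exact: bmf_cst.
have -> : (T phi j + ((size phi)%:R * e (j :: phi))%:E =
    \int[Q]_w (Z j w * tot 0 phi w + (size phi)%:R * tot 0 (j :: phi) w)%:E)%E.
  under [RHS]eq_integral do rewrite EFinD.
  rewrite ge0_integralD//; last 4 first.
  - by move=> w _; rewrite lee_fin mulr_ge0// tot_ge0.
  - by apply/measurable_EFinP; exact: mZtot.
  - by move=> w _; rewrite lee_fin mulr_ge0// tot_ge0.
  - by apply/measurable_EFinP; apply: measurable_funM => //; exact: mtot.
  congr (_ + _)%E; rewrite Ex_EFin ?ExZl//; apply: bmfM => //; exact: bmf_cst.
apply: (cvg_unique _ lhs) => //.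
rewrite (_ : (fun k => _) = (fun k => \int[Q]_w (Z j w * tot k.+1%:R^-1 phi w +
      (size phi)%:R * tot k.+1%:R^-1 (j :: phi) w)%:E)%E)//.
by apply/funext => k; exact: stein_tot.
Qed.

Let sum_V0 w : S w != 0 -> \sum_j Vs 0 j w = 1.
Proof. by move=> S1; rewrite -mulr_suml addr0 divff. Qed.

Let Z_eq0 j w : S w = 0 -> Z j w = 0.
Proof. by move=> Sw; apply/le_anti; rewrite Z0 -{1}Sw Z_le. Qed.

(** Sum of [step1] over [j]: the counts add up to [size phi], and the normalised variables add up to
    1, so the terms in [size phi] cancel. *)
Let step2 phi : (\sum_j T phi j = (A * e phi)%:E)%E.
Proof.
have Tfin j : T phi j = (fine (T phi j))%:E.
  by rewrite fineK//; have := step1 j phi; case: (T phi j) => // r.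
rewrite (eq_bigr _ (fun j _ => Tfin j)) sumEFin; congr EFin.
have -> : \sum_j fine (T phi j) =
    \sum_j ((a j + (count_mem j phi)%:R) * e phi - (size phi)%:R * e (j :: phi)).
  apply: eq_bigr => j _; have := step1 j phi; rewrite Tfin -EFinD => -[->].
  by rewrite addrK.
rewrite sumrB -mulr_suml big_split/= -/A -mulr_sumr mulrDl.
have -> : \sum_j (count_mem j phi)%:R = (size phi)%:R :> R.
  elim: phi {Tfin} => [|i phi ih] /=; first by rewrite big1.
  under eq_bigr do rewrite natrD; rewrite big_split/= ih (bigD1 i)//= eqxx big1.
    by rewrite addr0 nat1r.
  by move=> l; rewrite eq_sym => /negbTE ->.
suff -> : (size phi)%:R * (\sum_j e (j :: phi)) = (size phi)%:R * e phi by rewrite addrK.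
(* Where [S w = 0] the normalised variables add up to 0 by the convention on division. This is
   harmless: the factor [size phi] is 0 for empty [phi], and otherwise both integrands vanish
   there. *)
case: phi {Tfin} => [|i phi]; first by rewrite !mul0r.
congr (_ * _); rewrite -Ex_sum//; apply: eq_Ex => w.
rewrite (_ : \sum_j _ = (\sum_j Vs 0 j w) * tot 0 (i :: phi) w); last first.
  by rewrite mulr_suml; apply: eq_bigr => j _; rewrite /tot [in LHS]big_cons.
have [Sw|/sum_V0 ->] := eqVneq (S w) 0; last by rewrite mul1r.
by rewrite /tot big_cons /Vs Z_eq0// !(mul0r, mulr0).
Qed.

(** Multiplying the normalised variable by [S] gives back [Z j], also where [S w = 0]. *)
Let step3 phi j : (T phi j = \sum_i T (j :: phi) i)%E.
Proof.
rewrite /T -ge0_integral_sum//; last 2 first.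
- by move=> i; apply/measurable_EFinP; exact: mZtot.
- by move=> i w _; rewrite lee_fin mulr_ge0// tot_ge0.
apply: eq_integral => w _; rewrite sumEFin -mulr_suml -/(S w) /tot big_cons mulrA; congr (_ * _)%:E.
have [Sw|Sw] := eqVneq (S w) 0; first by rewrite Z_eq0// Sw mul0r.
by rewrite /Vs addr0 mulrC divfK.
Qed.

(** The unbounded term [T phi j] of [step1] is rewritten by [step3] and [step2] as the total
    parameter times the moment of [j :: phi]. What remains is the recursion of an urn with weights
    [a]. *)
Lemma dirichlet_moments phi j :
  [/\ forall w, 0 <= V j w <= 1, measurable_fun setT (V j) &
  (A + (size phi)%:R) * Ex Q (fun w => \prod_(r <- j :: phi) V r w) =
  (a j + (count_mem j phi)%:R) * Ex Q (fun w => \prod_(r <- phi) V r w)].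
Proof.
have VE : Vs 0 = V by apply/funext => i; apply/funext => w.
split; [by move=> w; rewrite -V0 Vs01|by rewrite -VE; exact: mVs|].
rewrite -VE; have := step1 j phi; rewrite step3 step2 -EFinD => -[].
by move=> h; rewrite mulrDl; exact/esym.
Qed.

End dirichlet_moments.

Lemma moments_law {d1 d2} {T1 : measurableType d1} {T2 : measurableType d2} {R : realType}
    (mu1 : probability T1 R) (mu2 : probability T2 R) (Z I : Type) (z : I -> Z -> R)
    (p1 : T1 -> Z) (p2 : T2 -> Z) :
  (forall i, measurable_fun setT (z i \o p1)) -> (forall i, measurable_fun setT (z i \o p2)) ->
  (forall i x, 0 <= z i (p1 x) <= 1) -> (forall i x, 0 <= z i (p2 x) <= 1) ->
  (forall s : seq I, Ex mu1 (fun x => \prod_(i <- s) z i (p1 x)) =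
                     Ex mu2 (fun x => \prod_(i <- s) z i (p2 x))) ->
  forall B, <<s \bigcup_i sigma_rv (z i) >> B -> mu1 (p1 @^-1` B) = mu2 (p2 @^-1` B).
Proof.
move=> m1 m2 z1 z2 e B sB.
have [|m1B m2B] := moments_determine (mu1 := mu1) (mu2 := mu2) m1 m2 z1 z2
  (bmf_cst 1) (bmf_cst 1) _ sB.
  by move=> s; under eq_Ex do rewrite mul1r; under [RHS]eq_Ex do rewrite mul1r.
under eq_Ex do rewrite mul1r; under [RHS]eq_Ex do rewrite mul1r.
rewrite !Ex_indic// => h.
by rewrite -[LHS]fineK ?fin_num_measure// h fineK// fin_num_measure.
Qed.

(** * Independence of the limits attached to different urns *)

Section independent_urns.
Context {R : realType} {D K : eqType} (urn : D -> K) (alpha : D -> R) (tot : K -> R).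
Context {d} {Omega : measurableType d} (Pr : probability Omega R) (theta : D -> Omega -> R).
Hypotheses (mtheta : forall e, measurable_fun setT (theta e))
  (theta01 : forall e w, 0 <= theta e w <= 1)
  (theta_moments : forall phi, Ex Pr (fun w => \prod_(e <- phi) theta e w) =
     draws_prob urn alpha tot phi [::]).

Definition gen (C : set D) : set (set Omega) := <<s \bigcup_(e in C) sigma_rv (theta e) >>.

Lemma gen_rv C e : C e -> sigma_rv (theta e) `<=` gen C.
Proof. by move=> Ce A Ae; apply: sub_sigma_algebra; exists e. Qed.

Lemma sub_gen C (G : set (set Omega)) : G `<=` gen C -> <<s G >> `<=` gen C.
Proof. by move=> GC; apply: smallest_sub => //; exact: smallest_sigma_algebra. Qed.

Lemma gen_mono C1 C2 : C1 `<=` C2 -> gen C1 `<=` gen C2.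
Proof. by move=> C12; apply: sub_gen => A [e /C12 Ce Ae]; exact: gen_rv Ae. Qed.

Lemma gen_measurable C A : gen C A -> measurable A.
Proof.
move: A; apply: smallest_sub; first exact: sigma_algebra_measurable.
move=> A [e _ [B mB <-]]; exact: mtheta.
Qed.

Let bmf_theta_prod phi : bmf (fun w => \prod_(e <- phi) theta e w).
Proof. by apply: bmf_prod => e; exact: bmf_01. Qed.

Lemma gen_moments (C : set D) (f g : Omega -> R) : bmf f -> bmf g ->
  (forall phi : seq D, (forall e, e \in phi -> C e) ->
     Ex Pr (fun w => f w * \prod_(e <- phi) theta e w) =
     Ex Pr (fun w => g w * \prod_(e <- phi) theta e w)) ->
  forall B, gen C B -> Ex Pr (fun w => f w * \1_B w) = Ex Pr (fun w => g w * \1_B w).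
Proof.
move=> bf bg fg B CB.
have h := @moments_determine _ _ _ _ _ Pr Pr Omega {e | C e} (fun i => theta (sval i)) id id.
have [||||||_ _ //] := h _ _ _ _ f g bf bg _ B.
- by move=> i; exact: mtheta.
- by move=> i; exact: mtheta.
- by move=> i; exact: theta01.
- by move=> i; exact: theta01.
- move=> s; have e k : (fun x => k x * \prod_(i <- s) theta (sval i) x) =
      (fun x => k x * \prod_(e <- map sval s) theta e x).
    by apply/funext => x; rewrite big_map.
  rewrite !e; apply: fg; elim: s {e} => // -[x Cx] s ih y /=.
  by rewrite inE => /orP[/eqP ->//|/ih].
move: B CB; apply: smallest_sub; first exact: smallest_sigma_algebra.
by move=> A [e Ce Ae]; apply: sub_sigma_algebra; exists (exist _ e Ce).
Qed.

(** Two passes of [gen_moments]: with a monomial over [C2] fixed, events of [C1] factor out; with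
    such an event fixed, events of [C2] do. On monomials this holds because distinct urns do not
    reinforce each other. *)
Lemma gen_indep2 C1 C2 : (forall d e, C1 d -> C2 e -> urn d != urn e) ->
  indep2 Pr (gen C1) (gen C2).
Proof.
move=> dis A B CA CB; have mA := gen_measurable CA; have mB := gen_measurable CB.
have b1 := bmf_indic (R := R) mA.
have fact phi psi : (forall e, e \in phi -> C1 e) -> (forall e, e \in psi -> C2 e) ->
    Ex Pr (fun w => \prod_(e <- psi) theta e w * \prod_(e <- phi) theta e w) =
    Ex Pr (fun w => Ex Pr (fun w => \prod_(e <- psi) theta e w) * \prod_(e <- phi) theta e w).
  move=> h1 h2; under eq_Ex do rewrite -big_cat.
  rewrite ExZl// !theta_moments draws_prob_cat draws_prob_indep//.
  apply/allP => e /h2 Ce; apply/allP => e' /h1 Ce'; exact: dis.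
have step psi : (forall e, e \in psi -> C2 e) ->
    Ex Pr (fun w => \1_A w * \prod_(e <- psi) theta e w) =
    Ex Pr (fun w => Ex Pr \1_A * \prod_(e <- psi) theta e w).
  move=> h2; have := @gen_moments C1 _ _ (bmf_theta_prod psi) (bmf_cst (Ex Pr (fun w => \prod_(e <- psi) theta e w)))
    (fun phi h1 => fact phi psi h1 h2) A CA.
  rewrite (ExZl Pr _ b1) (ExZl Pr _ (bmf_theta_prod psi)) => h.
  by rewrite mulrC -h; apply: eq_Ex => w; rewrite mulrC.
have := gen_moments b1 (bmf_cst _) step CB.
rewrite (ExZl Pr _ (bmf_indic mB)).
rewrite (_ : (fun w => _) = \1_(A `&` B)); last by apply/funext => w; rewrite indicI.
rewrite !Ex_indic//; last exact: measurableI.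
by move=> h; rewrite -[LHS]fineK ?h ?EFinM ?fineK// fin_num_measure//; exact: measurableI.
Qed.

Lemma gen_indep (I : choiceType) (C : I -> set D) :
  (forall i j d e, i != j -> C i d -> C j e -> urn d != urn e) ->
  indep Pr (fun i => gen (C i)).
Proof.
move=> dis J A uJ GA; elim: J uJ GA => [|i J ih] /=.
  by rewrite big_nil (_ : \bigcap_(i in _) A i = setT) ?probability_setT//; apply/seteqP; split.
move=> /andP[iJ uJ] GA; rewrite big_cons -ih//; last by move=> j jJ; apply: GA; rewrite inE jJ orbT.
rewrite (_ : \bigcap_(j in [set` i :: J]) A j = A i `&` \bigcap_(j in [set` J]) A j); last first.
  apply/seteqP; split => w /=.
    by move=> h; split => [|j jJ]; apply: h; rewrite /= inE ?eqxx// jJ orbT.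
  by move=> [Ai h] j /=; rewrite inE => /orP[/eqP ->//|]; exact: h.
(* The remaining families are merged into one set of draws, whose urns are still disjoint from those
   of [C i]. *)
apply: (@gen_indep2 (C i) (\bigcup_(j in [set` J]) C j)).
- move=> e e' Ce [j /= jJ Cje]; apply: dis Ce Cje.
  by apply: contraNneq iJ => ->.
- by apply: GA; rewrite mem_head.
- apply: (@fin_bigcap_measurable _ (g_sigma_algebraType
    (\bigcup_(e in \bigcup_(j in [set` J]) C j) sigma_rv (theta e))) _ [set` J] A) => // j /= jJ.
  apply: (@gen_mono (C j)); first by move=> e Ce; exists j.
  by apply: GA; rewrite inE jJ orbT.
Qed.

Lemma sub_indep (I : choiceType) (G H : I -> set (set Omega)) :
  (forall i, G i `<=` H i) -> indep Pr H -> indep Pr G.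
Proof. by move=> GH indH J A uJ GA; apply: indH => // i iJ; exact/GH/GA. Qed.

End independent_urns.

(** Monotonicity gives a limit at every point; it is nonnegative and has mean zero by dominated
    convergence. *)
Lemma cvg0_of_Ex {R : realType} {d} {Omega : measurableType d} (Pr : probability Omega R)
    (a : nat -> Omega -> R) : (forall n, measurable_fun setT (a n)) ->
  (forall n w, 0 <= a n w <= 1) -> (forall n w, a n.+1 w <= a n w) ->
  Ex Pr (a n) @[n --> \oo] --> (0 : R) ->
  {ae Pr, forall w, a n w @[n --> \oo] --> (0 : R)}.
Proof.
move=> ma a01 ad Ea.
have cv w : cvgn (a ^~ w).
  apply: nonincreasing_is_cvgn; first by apply/nonincreasing_seqP => n.
  by exists 0 => _ [n _ <-]; have /andP[] := a01 n w.
pose b w := limn (a ^~ w).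
have b0 w : 0 <= b w by apply: limr_ge => //; apply: nearW => n; have /andP[] := a01 n w.
have b1 w : b w <= 1 by apply: limr_le => //; apply: nearW => n; have /andP[] := a01 n w.
have bb : bmf b.
  apply: bmf_01; last by move=> w; rewrite b0 b1.
  by apply: (measurable_fun_cvg (f := b) ma) => w _; exact: cv.
have Eb : Ex Pr (a n) @[n --> \oo] --> Ex Pr b.
  apply: (@Ex_cvg _ _ _ _ 1) => // [n w|].
    by have /andP[? ?] := a01 n w; rewrite ger0_norm.
  by apply: aeW => w; exact: cv.
have /Ex_eq0 : Ex Pr b = 0 by apply: cvg_eq Eb Ea _.
move=> /(_ bb b0); apply: filterS => w bw; rewrite -[X in _ --> X]bw; exact: cv.
Qed.

(** * The random characteristic couple *)

Section discrete_kernels.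
Context {R : realType} {dT} {T : measurableType dT}.
Hypothesis T_discrete : forall A : set T, measurable A.
Context (g : T -> nat) (gI : injective g) (x0 : T).

Let e n : option T := if pselect (exists j, g j = n) is left ex then Some (projT1 (cid ex)) else None.

Let eg j : e (g j) = Some j.
Proof.
rewrite /e; case: pselect => [ex|[]]; last by exists j.
by congr Some; apply: gI; rewrite (projT2 (cid ex)).
Qed.

Let ge n j : e n = Some j -> g j = n.
Proof. by rewrite /e; case: pselect => // ex [<-]; exact: (projT2 (cid ex)). Qed.

(** The absolute value yields a measure for arbitrary weights [p]; the weights used later are
    nonnegative. *)
Definition atom_mass (p : T -> R) (n : nat) : {measure set T -> \bar R} :=
  if e n is Some j then mscale (NngNum (normr_ge0 (p j))) (dirac j) else mzero.

Definition weight_measure (p : T -> R) : {measure set T -> \bar R} := mseries (atom_mass p) 0.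

(* The point mass at [x0] is a junk value for weights of total mass different from 1. *)
Definition weight_prob (p : T -> R) : {measure set T -> \bar R} :=
  if weight_measure p setT == 1%E then weight_measure p else dirac x0.

Lemma weight_probT p : weight_prob p setT = 1%E.
Proof. by rewrite /weight_prob; case: eqP => // _; exact: diracT. Qed.

Lemma atom_massE p n A : atom_mass p n A = if e n is Some j then (`|p j| * \1_A j)%:E else 0%E.
Proof. by rewrite /atom_mass; case: (e n) => [j|] //=; rewrite EFinM. Qed.

Lemma weight_measure_lim p A :
  (\sum_(0 <= k < n) atom_mass p k A)%E @[n --> \oo] --> weight_measure p A.
Proof. by apply: is_cvg_nneseries => n _ _; exact: measure_ge0. Qed.

Lemma weight_measure1 p j : weight_measure p [set j] = `|p j|%:E.
Proof.
rewrite -[LHS]/(\sum_(0 <= k <oo) atom_mass p k [set j])%E (@nneseriesD1 _ _ (g j) xpredT)//.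
rewrite atom_massE eg indicE mem_set// mulr1 eseries0 ?adde0// => k _ /= kj.
rewrite atom_massE; case ek: (e k) => [i|//].
rewrite indicE memNset ?mulr0// => ij; move/ge: ek kj => <-.
by rewrite ij eqxx.
Qed.

Definition atoms n : seq T := pmap e (iota 0 n).

Lemma atoms_enum (h : nat -> T) n : cancel h g -> atoms n = [seq h k | k <- iota 0 n].
Proof.
by move=> hK; rewrite /atoms; elim: (iota 0 n) => // k l ih /=; rewrite -{1}[k]hK eg /= ih.
Qed.

Lemma mem_atoms n j : j \in atoms n -> (g j < n)%N.
Proof. by rewrite mem_pmap => /mapP[k kn /esym/ge ->]; move: kn; rewrite mem_iota. Qed.

Lemma sum_atoms (mu : set T -> R) n : cadd mu ->
  \sum_(j <- atoms n) mu [set j] = mu [set j | (g j < n)%N].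
Proof.
move=> [mu0 muD _]; elim: n => [|n ih].
  by rewrite big_nil (_ : [set j | _] = set0) ?mu0//; apply/seteqP; split.
rewrite /atoms -addn1 iotaD pmap_cat big_cat/= -/(atoms n) ih add0n.
have -> : [set j | (g j < n + 1)%N] = [set j | (g j < n)%N] `|` [set j | g j = n].
  apply/seteqP; split=> j /=; rewrite addn1 ltnS.
    by rewrite leq_eqVlt => /orP[/eqP|]; [right|left].
  by case=> [/ltnW|->].
rewrite muD; last by apply/seteqP; split => // j /= [+ gj]; rewrite gj ltnn.
congr (_ + _); case ek: (e n) => [j|] /=.
  rewrite big_seq1; congr mu; apply/seteqP; split => [x /= ->|x /= gx]; first exact: ge.
  by apply: gI; rewrite gx (ge ek).
rewrite big_nil (_ : [set j | _] = set0) ?mu0//; apply/seteqP; split => // j /= gj.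
by move: ek; rewrite -gj eg.
Qed.

Lemma weight_measureT p : (forall j, 0 <= p j) ->
  (\sum_(j <- atoms n) p j) @[n --> \oo] --> (1 : R) -> weight_measure p setT = 1%E.
Proof.
move=> p0 p1; have <- := cvg_lim (@ereal_hausdorff R) (weight_measure_lim (p := p) (A := setT)).
apply: (cvg_lim (@ereal_hausdorff R)).
rewrite (_ : (fun n => _) = (fun n => (\sum_(j <- atoms n) p j)%:E)).
  by apply: cvg_EFin; [exact: nearW|exact: p1].
apply/funext => n; rewrite /atoms /index_iota subn0; elim: (iota 0 n) => [|k l ih].
  by rewrite !big_nil.
rewrite big_cons ih atom_massE /=; case: (e k) => [j|] /=; last by rewrite add0e.
by rewrite big_cons indicT mulr1 ger0_norm.
Qed.

Lemma weight_prob1 p j : weight_measure p setT = 1%E -> 0 <= p j -> weight_prob p [set j] = (p j)%:E.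
Proof. by move=> pT pj; rewrite /weight_prob pT eqxx weight_measure1 ger0_norm. Qed.

Lemma measurable_weight_prob {d} {Omega : measurableType d} (q : T -> Omega -> R) A :
  (forall j, measurable_fun setT (q j)) ->
  measurable_fun setT (fun w => weight_prob (q ^~ w) A).
Proof.
move=> mq; have mm B : measurable_fun setT (fun w => weight_measure (q ^~ w) B).
  apply: (@ge0_emeasurable_sum _ _ _ _ (fun n w => atom_mass (q ^~ w) n B) xpredT) => // n _.
  rewrite (_ : (fun w => _) = (fun w => if e n is Some j then (`|q j w| * \1_B j)%:E else 0%E)).
    case: (e n) => [j|//]; apply/measurable_EFinP; apply: measurable_funM => //.
    exact: measurableT_comp.
  by apply/funext => w; rewrite atom_massE.
rewrite (_ : (fun w => _) = (fun w => if weight_measure (q ^~ w) setT == 1%E then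
    weight_measure (q ^~ w) A else dirac x0 A)).
  apply: measurable_fun_ifT => //.
  apply: (measurable_fun_bool true).
  rewrite (_ : _ @^-1` _ = (fun w => weight_measure (q ^~ w) setT) @^-1` [set 1%E]).
    by apply: mm => //; exact: emeasurable_set1.
  by apply/seteqP; split => w /= /eqP.
by apply/funext => w; rewrite /weight_prob; case: ifP.
Qed.

(** The partial sums tend to 1 in L2. Since they increase, the excess of a fixed one over 1 is
    dominated by that of every later one, so it vanishes almost surely; the deficit below 1 then
    decreases with mean tending to 0. *)
Lemma weight_measure_ae {d} {Omega : measurableType d} (Pr : probability Omega R) (q : T -> Omega -> R) :
  (forall j, measurable_fun setT (q j)) -> (forall j w, 0 <= q j w <= 1) ->
  Ex Pr (fun w => \sum_(j <- atoms n) q j w) @[n --> \oo] --> (1 : R) ->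
  Ex Pr (fun w => (\sum_(j <- atoms n) q j w) ^+ 2) @[n --> \oo] --> (1 : R) ->
  {ae Pr, forall w, weight_measure (q ^~ w) setT = 1%E}.
Proof.
move=> mq q01 E1 E2; pose s n w := \sum_(j <- atoms n) q j w.
have bs n : bmf (s n) by apply: bmf_sum => j; exact: bmf_01.
have s_mono n m w : (n <= m)%N -> s n w <= s m w.
  move=> nm; rewrite /s /atoms -(subnKC nm) iotaD pmap_cat big_cat/= lerDl.
  by apply: sumr_ge0 => j _; have /andP[] := q01 j w.
pose u n w := Num.max 0 (s n w - 1).
have bu n : bmf (u n).
  have [mD [M bM]] := bmfB (bs n) (bmf_cst 1); split; first exact: measurable_maxr.
  by exists M => w; apply: le_trans (bM w); rewrite /u /Num.max; case: ltP => h; rewrite ?normr0.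
have E3 : Ex Pr (fun w => (s m w - 1) ^+ 2) @[m --> \oo] --> (0 : R).
  rewrite (_ : (fun m => _) = fun m => Ex Pr (fun w => s m w ^+ 2) - 2 * Ex Pr (s m) + 1).
    rewrite (_ : (0 : R) = 1 - 2 * 1 + 1); last by ring.
    by apply: cvgD; [apply: cvgB => //; apply: cvgM => //; exact: cvg_cst|exact: cvg_cst].
  apply/funext => m; rewrite -[X in _ = _ + X](Ex_cst Pr 1) -ExZl// -ExB -?ExD//.
  - by apply: eq_Ex => w; ring.
  - by apply: bmfB; [exact: bmf_exp|apply: bmfM => //; exact: bmf_cst].
  - exact: bmf_cst.
  - exact: bmf_exp.
  - by apply: bmfM => //; exact: bmf_cst.
have s_le1 : {ae Pr, forall w, forall n, s n w <= 1}.
  apply: ae_foralln => n.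
  have : Ex Pr (fun w => u n w ^+ 2) = 0.
    apply/le_anti/andP; split; last by apply: Ex_ge0 => w; exact: sqr_ge0.
    apply: (ler_cvg_to (cvg_cst _) E3); near=> m; apply: le_Ex => [||w].
    - exact: bmf_exp.
    - by apply: bmf_exp; apply: bmfB => //; exact: bmf_cst.
    have nm : (n <= m)%N by near: m; exact: nbhs_infty_ge.
    rewrite /u /Num.max; case: ltP => h; last by rewrite expr0n sqr_ge0.
    by apply: lerXn2r; rewrite ?nnegrE ?(ltW h) ?lerB ?s_mono// (le_trans (ltW h))// lerB// s_mono.
  move/(Ex_eq0 (bmf_exp 2 (bu n))); move/(_ (fun w => sqr_ge0 _)).
  apply: filterS => w /eqP; rewrite sqrf_eq0 => /eqP uw.
  by rewrite -subr_le0 -uw /u le_max lexx orbT.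
have lim0 : {ae Pr, forall w, (1 - Num.min 1 (s n w)) @[n --> \oo] --> (0 : R)}.
  apply: cvg0_of_Ex => [n|n w|n w|].
  - by apply: measurable_funB => //; apply: measurable_minr => //; exact: (bs n).1.
  - rewrite subr_ge0 ge_min lexx/= lerBlDr lerDl le_min ler01/=.
    by apply: sumr_ge0 => j _; have /andP[] := q01 j w.
  - by rewrite lerB// le_min ge_min lexx/= ge_min s_mono ?orbT.
  rewrite (_ : (fun n => _) = fun n => 1 - Ex Pr (s n)).
    by rewrite -[X in _ --> X](subrr (1 : R)); apply: cvgB => //; exact: cvg_cst.
  apply/funext => n; rewrite -[X in _ = X - _](Ex_cst Pr 1) -ExB//; last exact: bmf_cst.
  apply: ae_Ex.
  - apply: bmf_01 => [|w].
      by apply: measurable_funB => //; apply: measurable_minr => //; exact: (bs n).1.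
    rewrite subr_ge0 ge_min lexx/= lerBlDr lerDl le_min ler01/=.
    by apply: sumr_ge0 => j _; have /andP[] := q01 j w.
  - by apply: bmfB => //; exact: bmf_cst.
  - by apply: filterS s_le1 => w h; rewrite min_r.
apply: filterS2 lim0 s_le1 => w h1 h2; apply: weight_measureT => [j|].
  by have /andP[] := q01 j w.
rewrite (_ : (fun n => _) = fun n => 1 - (1 - Num.min 1 (s n w))).
  by rewrite -[X in _ --> X](subr0 (1 : R)); apply: cvgB => //; exact: cvg_cst.
by apply/funext => n; rewrite subKr min_r.
Unshelve. all: by end_near. Qed.

Section kernel.
Context {d} {Omega : measurableType d} (q : T -> Omega -> R).
Hypothesis mq : forall j, measurable_fun setT (q j).

Let krn (w : Omega) : {measure set T -> \bar R} := weight_prob (q ^~ w).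

Let measurable_krn U : measurable U -> measurable_fun setT (krn ^~ U).
Proof. by move=> _; exact: measurable_weight_prob. Qed.

HB.instance Definition _ := isKernel.Build _ _ _ _ _ krn measurable_krn.

Let krnT w : krn w setT = 1%E. Proof. exact: weight_probT. Qed.

HB.instance Definition _ := Kernel_isProbability.Build _ _ _ _ _ krn krnT.

Lemma kernel_of_weights : exists K : R.-pker Omega ~> T,
  (forall w, (K w : set T -> \bar R) = weight_prob (q ^~ w)) /\
  sigma_rpm K `<=` <<s \bigcup_j sigma_rv (q j) >>.
Proof.
exists krn; split => //; apply: smallest_sub; first exact: smallest_sigma_algebra.
move=> X [A mA [B mB <-]].
pose G : set (set Omega) := \bigcup_j sigma_rv (q j).
(* Measurability is applied over the sigma-algebra generated by the weights, which is exactly the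
   second claim. *)
have := @measurable_weight_prob _ (g_sigma_algebraType G) q A.
move=> h; apply: (h _ _ _ mB) => //; first move=> j _ C mC.
by rewrite setTI; apply: sub_sigma_algebra; exists j => //; exists C => //; rewrite setTI.
Qed.

End kernel.
End discrete_kernels.

(** * The law of the random characteristic couple *)

Section prior.
Context {R : realType} {d} {Omega : measurableType d} (Pr : probability Omega R).
Context {dE} {E : measurableType dE}.
Context (E_countable : countable [set: E]) (E_discrete : forall A : set E, measurable A).
Context (l0 : E) (m : E -> {measure set E -> \bar R}) (c : E -> nat -> R)
  (F0 : E -> probability nat R).
Hypotheses (m_pos : forall i, (0 < m i setT)%E) (m_fin : forall i, (m i setT < +oo)%E)
  (m_diag : forall i, m i [set i] = 0%E) (c_pos : forall i t, (0 < t)%N -> 0 < c i t)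
  (F0_pos_int : forall i, F0 i [set 0%N] = 0%E)
  (F0_tail : forall i t, (0 < F0 i [set n | (t < n)%N])%E).

Local Notation dw := (draw_weight m c F0).
Local Notation uw := (urn_weight m c F0).
Local Notation pd := (draw_prob urn_of dw uw).
Local Notation pds := (draws_prob urn_of dw uw).

Context (theta : @draw dE E -> Omega -> R).
Hypotheses (mtheta : forall e, measurable_fun setT (theta e))
  (theta01 : forall e w, 0 <= theta e w <= 1)
  (theta_moments : forall phi : seq (@draw dE E),
     Ex Pr (fun w => \prod_(e <- phi) theta e w) = pds phi [::]).

Let btheta e : bmf (theta e). Proof. exact: bmf_01. Qed.

Let Ex1 e : Ex Pr (theta e) = pd [::] e.
Proof.
have := theta_moments [:: e]; rewrite /= mulr1 => <-.
by apply: eq_Ex => w; rewrite big_seq1.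
Qed.

Let Ex2 e f : Ex Pr (fun w => theta e w * theta f w) = pd [:: f] e * pd [::] f.
Proof.
have := theta_moments [:: e; f]; rewrite /= mulr1 => <-.
by apply: eq_Ex => w; rewrite big_cons big_seq1.
Qed.

Lemma diag_ae i : {ae Pr, forall w, theta (inl (i, i)) w = 0}.
Proof.
apply: Ex_eq0 => //; first by move=> w; have /andP[] := theta01 (inl (i, i)) w.
have /= := @pds_diag0 _ _ _ m c F0 m_diag [:: inl (i, i)] [::] i (mem_head _ _).
by rewrite Ex1 mulr1 => ->.
Qed.

(** The second moment of [theta s + theta j - 1] is a combination of one-draw and two-draw
    probabilities, and it is zero because stay and jump exhaust the urn at each draw. *)
Lemma stay_ae i y : {ae Pr, forall w,
  theta (inr ((i, y), false)) w = 1 - theta (inr ((i, y), true)) w}.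
Proof.
set s : draw := inr ((i, y), false); set j : draw := inr ((i, y), true).
have sj l : pd l s + pd l j = 1 by exact: stay_jump_prob.
have bt : bmf (fun w => theta s w + theta j w) by exact: bmfD.
have b1 : bmf (fun w => theta s w + theta j w - 1) by apply: bmfB => //; exact: bmf_cst.
have E0 : Ex Pr (fun w => (theta s w + theta j w - 1) ^+ 2) = 0.
  rewrite (_ : (fun w => _) = fun w => theta s w * theta s w + theta j w * theta s w +
    (theta s w * theta j w + theta j w * theta j w) + (1 - 2 * (theta s w + theta j w))); last first.
    by apply/funext => w; ring.
  have b2 e f : bmf (fun w => theta e w * theta f w) by exact: bmfM.
  have bc2 : bmf (fun w => 2 * (theta s w + theta j w)) by apply: bmfM => //; exact: bmf_cst.
  rewrite ExD; [|by do 2 apply: bmfD|by apply: bmfB => //; exact: bmf_cst].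
  rewrite (ExB Pr (bmf_cst 1) bc2) (ExZl Pr 2 bt) !ExD//; try exact: bmfD.
  rewrite Ex_cst !Ex2 !Ex1; have e1 l : pd l j = 1 - pd l s by rewrite -(sj l) addrAC subrr add0r.
  rewrite !e1; lra.
have := Ex_eq0 (bmf_exp 2 b1) (fun w => sqr_ge0 _) E0.
apply: filterS => w /eqP; rewrite sqrf_eq0 => /eqP; lra.
Qed.

Context (g : E -> nat) (gI : injective g).

(** The mean of a partial row sum is the row probability of [F n]. Its second moment multiplies this
    by the same probability after one draw inside [F n], namely [(m i (F n) + 1) / (M + 1)]. Both
    tend to 1. *)
Lemma row_total i : {ae Pr, forall w,
  weight_measure g (fun j => theta (inl (i, j)) w) setT = 1%E}.
Proof.
pose F n := [set j : E | (g j < n)%N].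
have ndF : nondecreasing_seq F.
  by move=> n k nk; apply/subsetPset => j /= jn; exact: leq_trans nk.
have FT : \bigcup_n F n = setT.
  by apply/seteqP; split => // j _; exists (g j).+1 => //; exact: ltnSn.
have row_lim l : row_prob m c F0 l i (F n) @[n --> \oo] --> (1 : R).
  rewrite -(row_probT m_pos m_fin c_pos F0_tail l i) -FT.
  by have [_ _ h] := row_prob_cadd E_discrete c F0 m_fin l i; exact: h.
have sumF l n : \sum_(j <- atoms g n) pd l (inl (i, j)) = row_prob m c F0 l i (F n).
  rewrite -(sum_atoms gI n (row_prob_cadd E_discrete c F0 m_fin l i)).
  by apply: eq_bigr => j _; rewrite row_prob1.
apply: weight_measure_ae => //.
- rewrite (_ : (fun n => _) = fun n => row_prob m c F0 [::] i (F n)); first exact: row_lim.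
  apply/funext => n; rewrite Ex_sum -?sumF//.
  by apply: eq_bigr => j _; exact: Ex1.
pose M := uw (inl i); have M0 : 0 < M by exact: (urn_weight_gt0 m_pos m_fin c_pos F0_tail (inl i)).
have two n : Ex Pr (fun w => (\sum_(j <- atoms g n) theta (inl (i, j)) w) ^+ 2) =
    row_prob m c F0 [::] i (F n) * ((fine (m i (F n)) + 1) / (M + 1)).
  rewrite (_ : (fun w => _) = fun w => \sum_(j' <- atoms g n) \sum_(j <- atoms g n)
      theta (inl (i, j)) w * theta (inl (i, j')) w); last first.
    apply/funext => w; rewrite expr2 mulr_sumr; apply: eq_bigr => j' _.
    by rewrite mulr_suml.
  rewrite Ex_sum; last by move=> j'; apply: bmf_sum => j; exact: bmfM.
  rewrite -sumF mulr_suml [LHS]big_seq_cond [RHS]big_seq_cond; apply: eq_bigr => j' /andP[jn _].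
  rewrite Ex_sum; last by move=> j; exact: bmfM.
  rewrite (eq_bigr _ (fun j _ => Ex2 _ _)) -mulr_suml sumF mulrC; congr (_ * _).
  rewrite /row_prob big_seq1 eqxx mul1r (@indic_bool _ _ _ true); last by split => // _; exact: mem_atoms jn.
  by rewrite /= /in_urn /= eqxx addn0.
rewrite (_ : (fun n => _) = fun n => row_prob m c F0 [::] i (F n) * ((fine (m i (F n)) + 1) / (M + 1))).
  rewrite -[X in _ --> X](mulr1 (1 : R)); apply: cvgM; first exact: row_lim.
  have M1 : (M + 1) / (M + 1) = 1 by rewrite divff// gt_eqF// addr_gt0.
  rewrite -[X in _ --> X]M1; apply: cvgM; last exact: cvg_cst.
  apply: cvgD; last exact: cvg_cst.
  have [_ _ h] := @cadd_measure R _ E (m i) E_discrete (m_fin i).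
  by have := h F ndF; rewrite FT.
by apply/funext => n; exact: two.
Qed.

(** The jump limit of index [x] is the random hazard at age [x.+1], so this is the mass that the
    random holding-time law puts beyond [t]. *)
Definition survival i t w : R := \prod_(x < t) (1 - theta (inr ((i, x : nat), true)) w).

Definition holding_weight i t w : R :=
  if t is y.+1 then theta (inr ((i, y), true)) w * survival i y w else 0.

Lemma survival01 i t w : 0 <= survival i t w <= 1.
Proof.
apply: prod_01 => x; have /andP[h0 h1] := theta01 (inr ((i, x : nat), true)) w.
by rewrite subr_ge0 h1 lerBlDr lerDl.
Qed.

Lemma survivalS i t w : survival i t.+1 w = (1 - theta (inr ((i, t), true)) w) * survival i t w.
Proof. by rewrite /survival big_ord_recr /= mulrC. Qed.

Lemma measurable_survival i t : measurable_fun setT (survival i t).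
Proof. by apply: measurable_prod => x _; exact: measurable_funB. Qed.

Lemma holding_weight01 i t w : 0 <= holding_weight i t w <= 1.
Proof.
case: t => [|y] /=; first by rewrite lexx ler01.
have /andP[h0 h1] := theta01 (inr ((i, y : nat), true)) w.
by have /andP[s0 s1] := survival01 i y w; rewrite mulr_ge0 ?mulr_ile1.
Qed.

Lemma measurable_holding_weight i t : measurable_fun setT (holding_weight i t).
Proof.
case: t => [|y]; first exact: measurable_cst.
by apply: measurable_funM => //; exact: measurable_survival.
Qed.

Lemma sum_holding_weight i n w :
  \sum_(t < n.+1) holding_weight i t w = 1 - survival i n w.
Proof.
elim: n => [|n ih].
  by rewrite big_ord_recr/= big_ord0 /survival big_ord0 addr0 subrr.
by rewrite big_ord_recr/= ih survivalS; ring.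
Qed.

Let F0T i : fine (F0 i [set n | (0 < n)%N]) = 1.
Proof.
have := F0_split F0 i 0; rewrite F0_pos_int /= add0r => <-.
by rewrite (_ : [set _ | _] = setT) ?probability_setT//; apply/seteqP; split.
Qed.

(** Almost surely this is a product of stay limits of distinct urns. The means of these limits are
    ratios of consecutive tails of [F0 i], and their product telescopes. *)
Lemma Ex_survival i n : Ex Pr (survival i n) = fine (F0 i [set k | (n < k)%N]).
Proof.
pose stays n : seq draw := [seq inr ((i, x), false) | x <- rev (iota 0 n)].
have staysS k : stays k.+1 = inr ((i, k), false) :: stays k.
  by rewrite /stays -addn1 iotaD rev_cat.
transitivity (pds (stays n) [::]).
  rewrite -theta_moments; apply: ae_Ex.
  - by apply: bmf_01; [exact: measurable_survival|exact: survival01].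
  - by apply: bmf_prod.
  have : {ae Pr, forall w, forall y, theta (inr ((i, y), false)) w = 1 - theta (inr ((i, y), true)) w}.
    by apply: ae_foralln => y; exact: stay_ae.
  apply: filterS => w h; elim: n => [|n ih]; first by rewrite /survival big_ord0 big_nil.
  by rewrite survivalS ih staysS big_cons h.
elim: n => [|n ih]; first by rewrite /= F0T.
rewrite staysS /= ih cats0 -[stays n]cats0 draw_prob_indep; last first.
  apply/allP => e /mapP[x]; rewrite mem_rev mem_iota => /andP[_ xn] -> /=.
  by apply/eqP => -[xE]; move: xn; rewrite xE ltnn.
have c0 : c i n.+1 != 0 by rewrite gt_eqF// c_pos.
have F00 : fine (F0 i [set k | (n < k)%N]) != 0.
  rewrite gt_eqF// fine_gt0// F0_tail/= (le_lt_trans (probability_le1 _ _)) ?ltry//.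
rewrite /draw_prob /= !addr0; field.
by rewrite c0 F00.
Qed.

(** The mean survival is the tail of [F0 i], which tends to 0: the random holding-time law loses no
    mass at infinity. *)
Lemma survival_ae i : {ae Pr, forall w, survival i n w @[n --> \oo] --> (0 : R)}.
Proof.
apply: cvg0_of_Ex => [n|n w|n w|].
- exact: measurable_survival.
- exact: survival01.
- rewrite survivalS ler_piMl//; first by have /andP[] := survival01 i n w.
  by have /andP[? _] := theta01 (inr ((i, n), true)) w; rewrite lerBlDr lerDl.
have [_ FD Fc] := @cadd_measure R _ nat (F0 i) (fun=> I) (le_lt_trans (probability_le1 _ measurableT) (ltry 1)).
pose G n := [set k | (k <= n)%N].
have ndG : nondecreasing_seq G.
  by move=> n k nk; apply/subsetPset => j /= jn; exact: leq_trans nk.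
have GT : \bigcup_n G n = setT.
  by apply/seteqP; split => // j _; exists j => //; exact: leqnn.
have := Fc G ndG; rewrite GT /= probability_setT /= => lim1.
rewrite (_ : (fun n => _) = fun n => 1 - fine (F0 i (G n))).
  by rewrite -[X in _ --> X](subrr (1 : R)); apply: cvgB => //; exact: cvg_cst.
apply/funext => n; rewrite Ex_survival; apply/eqP; rewrite eq_sym subr_eq addrC; apply/eqP.
rewrite -FD.
  have -> : G n `|` [set k | (n < k)%N] = setT; last by rewrite /= probability_setT.
  by apply/seteqP; split => // k _ /=; rewrite /G/=; case: leqP; [left|right].
by apply/seteqP; split => // k /= []; rewrite /G /=; case: ltnP.
Qed.

Lemma holding_total i : {ae Pr, forall w, weight_measure id (holding_weight i ^~ w) setT = 1%E}.
Proof.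
apply: filterS (survival_ae i) => w sw; apply: weight_measureT => [t|].
  by have /andP[] := holding_weight01 i t w.
have atomsE n : \sum_(t <- atoms id n) holding_weight i t w = \sum_(t < n) holding_weight i t w.
  have -> : atoms id n = [seq id k | k <- iota 0 n] by exact: atoms_enum.
  rewrite map_id -[X in iota 0 X]subn0 -/(index_iota 0 n) big_mkord.
  by [].
rewrite (_ : (fun n => _) = fun n => \sum_(t < n) holding_weight i t w); last by apply/funext.
rewrite -(cvg_shiftS _ (nbhs (1 : R))) /=.
rewrite (_ : (fun n => _) = fun n => 1 - survival i n w); last first.
  by apply/funext => n; rewrite sum_holding_weight.
have : 1 - survival i n w @[n --> \oo] --> (1 - 0 : R).
  by apply: cvgB => //; exact: cvg_cst.
by rewrite subr0.
Qed.

Lemma atoms_nat (q : nat -> R) n : \sum_(t <- atoms id n) q t = \sum_(t < n) q t.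
Proof.
have -> : atoms id n = [seq id k | k <- iota 0 n] by exact: atoms_enum.
by rewrite map_id -[X in iota 0 X]subn0 -/(index_iota 0 n) big_mkord.
Qed.

Context (P : E -> R.-pker Omega ~> E) (F : E -> R.-pker Omega ~> nat).
Hypotheses
  (PE : forall i w, (P i w : set E -> \bar R) =
     weight_prob g l0 (fun j => theta (inl (i, j)) w))
  (PS : forall i, sigma_rpm (P i) `<=` <<s \bigcup_j sigma_rv (theta (inl (i, j))) >>)
  (FE : forall i w, (F i w : set nat -> \bar R) = weight_prob id 0%N (holding_weight i ^~ w))
  (FS : forall i, sigma_rpm (F i) `<=` <<s \bigcup_t sigma_rv (holding_weight i t) >>).

Definition row_draws i : set (@draw dE E) := [set e | if e is inl (i', _) then i' = i else False].

Definition age_draws i : set (@draw dE E) := [set e | if e is inr ((i', _), _) then i' = i else False].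

Lemma P_atoms : {ae Pr, forall w, forall i j, P i w [set j] = (theta (inl (i, j)) w)%:E}.
Proof.
apply: (ae_forall_state E_countable) => i; apply: filterS (row_total i) => w tot j.
by rewrite PE weight_prob1//; have /andP[] := theta01 (inl (i, j)) w.
Qed.

Lemma F_atoms : {ae Pr, forall w, forall i t, F i w [set t] = (holding_weight i t w)%:E}.
Proof.
apply: (ae_forall_state E_countable) => i; apply: filterS (holding_total i) => w tot t.
by rewrite FE weight_prob1//; have /andP[] := holding_weight01 i t w.
Qed.

Let caddP i w : cadd (fun A => fine (P i w A)).
Proof. by apply: cadd_measure => //; rewrite prob_kernel ltry. Qed.

Let caddF i w : cadd (fun A => fine (F i w A)).
Proof. by apply: cadd_measure => //; rewrite prob_kernel ltry. Qed.

Let P01 i w A : 0 <= fine (P i w A) <= 1.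
Proof.
have PA1 : (P i w A <= 1)%E by rewrite -(prob_kernel (s := P i) w) le_measure ?inE.
have PAf : P i w A \is a fin_num by rewrite ge0_fin_numE// (le_lt_trans PA1) ?ltry.
by rewrite fine_ge0//= -lee_fin fineK.
Qed.

Let F_fin i w A : F i w A \is a fin_num.
Proof.
rewrite ge0_fin_numE// (@le_lt_trans _ _ (F i w setT))//; last by rewrite prob_kernel ltry.
by rewrite le_measure ?inE.
Qed.

Lemma F_le : {ae Pr, forall w, forall i t, F i w [set s | (s <= t)%N] = (1 - survival i t w)%:E}.
Proof.
apply: filterS F_atoms => w FA i t; rewrite -[LHS]fineK//; congr EFin.
rewrite -sum_holding_weight -(atoms_nat (holding_weight i ^~ w)).
have -> : [set s | (s <= t)%N] = [set s | (id s < t.+1)%N] by apply/seteqP; split => s.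
rewrite -(sum_atoms (g := id) _ t.+1 (caddF i w))//.
by apply: eq_bigr => s _; rewrite FA.
Qed.

Lemma F_gt : {ae Pr, forall w, forall i t, F i w [set s | (t < s)%N] = (survival i t w)%:E}.
Proof.
apply: filterS F_le => w Fle i t; rewrite -[LHS]fineK//; congr EFin.
have [_ FD _] := caddF i w.
have := FD [set s | (s <= t)%N] [set s | (t < s)%N].
have -> : [set s | (s <= t)%N] `|` [set s | (t < s)%N] = setT.
  by apply/seteqP; split => // k _ /=; case: leqP; [left|right].
rewrite prob_kernel Fle /= => h.
have {}h := h _; rewrite -[LHS](addKr (1 - survival i t w)) -h; first by ring.
by apply/seteqP; split => // k /= []; case: ltnP.
Qed.

Lemma sigma_P i : sigma_rpm (P i) `<=` gen theta (row_draws i).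
Proof.
move=> A /PS; move: A; apply: sub_gen => A [j _]; exact: gen_rv.
Qed.

Lemma sigma_F i : sigma_rpm (F i) `<=` gen theta (age_draws i).
Proof.
move=> A /FS; move: A; apply: sub_gen => A [t _ [B mB <-]].
pose G : set (set Omega) := \bigcup_(e in age_draws i) sigma_rv (theta e).
have mth e : age_draws i e -> measurable_fun setT (theta e : g_sigma_algebraType G -> R).
  move=> ae _ C mC; rewrite setTI; apply: sub_sigma_algebra; exists e => //.
  by exists C => //; rewrite setTI.
suff h : measurable_fun setT (holding_weight i t : g_sigma_algebraType G -> R).
  by have := h measurableT B mB.
case: t => [|y]; first exact: measurable_cst.
apply: measurable_funM; first exact: mth.
by apply: measurable_prod => x _; apply: measurable_funB => //; exact: mth.
Qed.

Lemma characteristic_couple_PF : characteristic_couple Pr P F.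
Proof.
have dg : {ae Pr, forall w, forall i, theta (inl (i, i)) w = 0}.
  by apply: (ae_forall_state E_countable) => i; exact: diag_ae.
have := P_atoms; have := F_atoms; apply: filterS3 dg => w h0 hF hP i.
by rewrite hP hF h0.
Qed.

Lemma indep_P : indep Pr (fun i => sigma_rpm (P i)).
Proof.
apply: (sub_indep sigma_P); apply: (gen_indep mtheta theta01 theta_moments).
by move=> i j [[a b]|//] [[a' b']|//] ij /= -> ->; apply: contra ij => /eqP[->].
Qed.

Lemma indep_F : indep Pr (fun i => sigma_rpm (F i)).
Proof.
apply: (sub_indep sigma_F); apply: (gen_indep mtheta theta01 theta_moments).
by move=> i j [//|[[a b] x]] [//|[[a' b'] x']] ij /= -> ->; apply: contra ij => /eqP[->].
Qed.

Lemma indep_PF : indep2 Pr (sigma_join setT (fun i => sigma_rpm (P i)))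
                           (sigma_join setT (fun i => sigma_rpm (F i))).
Proof.
pose C1 : set (@draw dE E) := [set e | if e is inl _ then True else False].
pose C2 : set (@draw dE E) := [set e | if e is inr _ then True else False].
have h : indep2 Pr (gen theta C1) (gen theta C2).
  by apply: (gen_indep2 mtheta theta01 theta_moments) => -[[a b]|//] [//|[[a' b'] x]].
move=> A B GA GB; apply: h.
  by move: A GA; apply: sub_gen => A [i _ /sigma_P]; apply: gen_mono => -[[a b]|//].
move: B GB; apply: sub_gen => B [i _ /sigma_F]; by apply: gen_mono => -[|[[a b] x]].
Qed.

(** The stick-breaking variables are the jump limits. Independence comes from distinct urns, and
    each law is identified by the recursion that its moments share with the Beta law. *)
Lemma beta_stacy_F i : beta_stacy Pr (c i) (F0 i) (F i).
Proof.
(* The variables are indexed by ages from 1 on, the urns from 0 on, hence [t.-1]. *)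
pose U t : {RV Pr >-> R} := HB.pack (theta (inr ((i, t.-1), true)))
  (isMeasurableFun.Build _ _ _ _ _ (mtheta (inr ((i, t.-1), true)))).
exists U; split.
- apply: (@sub_indep _ _ _ _ _ _ (fun t => gen theta [set e | e = inr ((i, t), true)])).
    by move=> t; apply: (@gen_rv _ _ _ _ theta _ (inr ((i, t), true))).
  apply: (gen_indep mtheta theta01 theta_moments) => t s e f ts -> -> /=.
  by apply: contra ts => /eqP[->].
- move=> [//|t] B _ mB; set j : draw := inr ((i, t), true).
  have b0 : 0 < c i t.+1 * fine (F0 i [set n | (t.+1 < n)%N]).
    exact: (stay_weight_gt0 m c_pos F0_tail i t).
  have a0 : 0 <= c i t.+1 * fine (F0 i [set t.+1]) by exact: (draw_weight_ge0 m F0 c_pos j).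
  have [Q [lawQ mQ]] := beta_law_moments a0 b0; set y := fun x => _ in lawQ mQ.
  rewrite -lawQ//; have y01 x : 0 <= y x <= 1.
    by rewrite /y le_max lexx ge_max ler01 ge_min lexx.
  apply: (@moments_law _ _ _ _ _ Pr Q R unit (fun _ => id) (theta j) y) => //.
  - by move=> _; exact: (mtheta j).
  - move=> _; have : measurable_fun setT y by apply: measurable_maxr => //; exact: measurable_minr.
    exact.
  - move=> s; have pw (x : R) : \prod_(u <- s) x = x ^+ size s.
      by rewrite big_const_seq iter_mulr_1 count_predT.
    under eq_Ex do rewrite pw; under [RHS]eq_Ex do rewrite pw.
    elim: (size s) => [|n ih]; first by under eq_Ex do rewrite expr0; under [RHS]eq_Ex do rewrite expr0; rewrite !Ex_cst.
    have A0 : 0 < c i t.+1 * fine (F0 i [set t.+1]) + c i t.+1 * fine (F0 i [set k | (t.+1 < k)%N]) + n%:R.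
      by rewrite ltr_pwDl// ltr_wpDl.
    apply: (mulfI (lt0r_neq0 A0)); rewrite mQ -ih.
    have pow k : Ex Pr (fun w => theta j w ^+ k) = pds (nseq k j) [::].
      rewrite -theta_moments; apply: eq_Ex => w; elim: k => [|k ihk]; first by rewrite big_nil.
      by rewrite big_cons -ihk exprS.
    rewrite !pow /= cats0 mulrA; congr (_ * _).
    rewrite /draw_prob [urn_of j]/= age_weight /= !count_nseq /= /in_urn !eqxx !mul1n.
    by rewrite mulrC divfK// gt_eqF.
  - apply: sub_sigma_algebra; exists tt => //; exists B => //; by rewrite setTI.
- apply: filterS F_gt => w h t; rewrite h; congr EFin.
  by rewrite big_add1/= big_mkord.
Qed.

Section dirichlet_row.
Context (i : E) (n : nat) (A : 'I_n -> set E).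
Hypotheses (tA : trivIset setT A) (UA : \bigcup_j A j = setT).

Let M := uw (inl i).
Let num (l : seq (@draw dE E)) B : R :=
  \sum_(e <- l) (if e is inl (i', x) then (i' == i)%:R * \1_B x else 0).
Let rowX j w := fine (P i w (A j)).
Let H (l : seq (@draw dE E)) (r : seq 'I_n) :=
  Ex Pr (fun w => \prod_(e <- l) theta e w * \prod_(j <- r) rowX j w).

Let mP B : measurable_fun setT (fun w => fine (P i w B)).
Proof. by apply: measurableT_comp => //; exact: measurable_kernel. Qed.

Let brow j : bmf (rowX j). Proof. by apply: bmf_01; [exact: mP|move=> w; exact: P01]. Qed.

Let bprod l : bmf (fun w => \prod_(e <- l) theta e w). Proof. exact: bmf_prod. Qed.

Let cadd_mix (f : Omega -> R) : bmf f -> cadd (fun B => Ex Pr (fun w => f w * fine (P i w B))).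
Proof.
move=> [mf [N Nf]]; apply: (@cadd_Ex _ _ _ Pr _ (fun w B => f w * fine (P i w B)) N) => [B|w B|].
- by apply: measurable_funM.
- have /andP[p0 p1] := P01 i w B; rewrite normrM (ger0_norm p0).
  by rewrite (le_trans _ (Nf w))// ler_piMr.
- by apply: aeW => w; apply: caddZ; exact: caddP.
Qed.

Let atom_mix (f : Omega -> R) x : bmf f ->
  Ex Pr (fun w => f w * fine (P i w [set x])) = Ex Pr (fun w => f w * theta (inl (i, x)) w).
Proof.
move=> bf; apply: ae_Ex; [apply: bmfM => //|exact: bmfM|].
  by apply: bmf_01; [exact: mP|move=> w; exact: P01].
by apply: filterS P_atoms => w h; rewrite h.
Qed.

(** Moments mixing single colours [l] with masses of blocks [r] are needed for the induction: as a
    function of the block [A k] a factor [rowX k] is countably additive, so it may be replaced by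
    the limit of one colour [x] in [A k], which then joins [l]. *)
Let H_step r : forall l j, all (in_urn urn_of (inl i)) l ->
  (M + (size l)%:R + (size r)%:R) * H l (j :: r) =
  (fine (m i (A j)) + num l (A j) + (count_mem j r)%:R) * H l r.
Proof.
have M0 : 0 < M by exact: (urn_weight_gt0 m_pos m_fin c_pos F0_tail (inl i)).
elim: r => [|k r ih] l j li.
  have HE : H l [::] = pds l [::].
    by rewrite -theta_moments; apply: eq_Ex => w; rewrite big_nil mulr1.
  have Ml : M + (size l)%:R != 0 by rewrite gt_eqF// ltr_pwDl.
  suff -> : H l [:: j] = row_prob m c F0 l i (A j) * pds l [::].
    rewrite HE !addr0 mulrA; congr (_ * _); rewrite /row_prob -/M (_ : count _ l = size l).
      by rewrite mulrC divfK.
    by apply/eqP; rewrite -all_count.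
  transitivity (Ex Pr (fun w => \prod_(e <- l) theta e w * fine (P i w (A j)))).
    by apply: eq_Ex => w; rewrite big_seq1.
  apply: (@cadd_eq _ _ _ (fun B => row_prob m c F0 l i B * pds l [::]) g _ gI (cadd_mix (bprod l))).
    rewrite (_ : (fun B => _) = fun B => pds l [::] * row_prob m c F0 l i B).
      by apply: caddZ; exact: row_prob_cadd.
    by apply/funext => B; rewrite mulrC.
  move=> x _; rewrite atom_mix//.
  have := theta_moments (inl (i, x) :: l); rewrite /= cats0 row_prob1 => <-.
  by apply: eq_Ex => w; rewrite big_cons mulrC.
pose f w := \prod_(e <- l) theta e w * \prod_(h <- r) rowX h w.
have bf : bmf f by apply: bmfM => //; exact: bmf_prod.
have bfj : bmf (fun w => f w * rowX j w) by exact: bmfM.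
have HE : H l [:: j, k & r] = Ex Pr (fun w => f w * rowX j w * fine (P i w (A k))).
  by apply: eq_Ex => w; rewrite !big_cons /f /rowX; ring.
have HE' : H l (k :: r) = Ex Pr (fun w => f w * fine (P i w (A k))).
  by apply: eq_Ex => w; rewrite !big_cons /f /rowX; ring.
rewrite HE HE'.
apply: (@cadd_eq _ _
  (fun B => (M + (size l)%:R + (size (k :: r))%:R) * Ex Pr (fun w => f w * rowX j w * fine (P i w B)))
  (fun B => (fine (m i (A j)) + num l (A j) + (count_mem j (k :: r))%:R) *
     Ex Pr (fun w => f w * fine (P i w B))) g (A k) gI).
- by apply: caddZ; exact: cadd_mix.
- by apply: caddZ; exact: cadd_mix.
move=> x Ax; rewrite !atom_mix//.
have li' : all (in_urn urn_of (inl i)) (inl (i, x) :: l) by rewrite /= li /in_urn /= eqxx.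
have := ih _ j li'; rewrite /= -!natr1 natrD.
have -> : H (inl (i, x) :: l) (j :: r) = Ex Pr (fun w => f w * rowX j w * theta (inl (i, x)) w).
  by apply: eq_Ex => w; rewrite !big_cons /f; ring.
have -> : H (inl (i, x) :: l) r = Ex Pr (fun w => f w * theta (inl (i, x)) w).
  by apply: eq_Ex => w; rewrite !big_cons /f; ring.
(* Since the blocks are disjoint, the colour [x] of block [k] reinforces block [j] only when
   [k = j]. *)
rewrite /num big_cons eqxx mul1r (@indic_bool _ _ _ (k == j)) => [h|]; last first.
  split => [Ajx|/eqP <- //]; apply/eqP; apply: (tA (i := k) (j := j)) => //.
  by exists x.
set X := Ex Pr _ in h *; set Y := Ex Pr _ in h *.
rewrite -/(num l (A j)) in h *.
rewrite (_ : _ * X = (M + ((size l)%:R + 1) + (size r)%:R) * X); last by ring.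
by rewrite h; ring.
Qed.

Lemma row_moments r j :
  [/\ measurable_fun setT (rowX j), forall w, 0 <= rowX j w <= 1 &
  (M + (size r)%:R) * Ex Pr (fun w => \prod_(k <- j :: r) rowX k w) =
  (fine (m i (A j)) + (count_mem j r)%:R) * Ex Pr (fun w => \prod_(k <- r) rowX k w)].
Proof.
split; [exact: mP|by move=> w; exact: P01|].
have := H_step r (l := [::]) j isT; rewrite /num /= big_nil !addr0 /H.
have e s : Ex Pr (fun w => \prod_(e <- [::]) theta e w * \prod_(k <- s) rowX k w) =
    Ex Pr (fun w => \prod_(k <- s) rowX k w).
  by apply: eq_Ex => w; rewrite big_nil mul1r.
by rewrite !e.
Qed.

End dirichlet_row.

(** The block masses of a row and the normalised gammas satisfy the same recursion on monomials,
    with the same total parameter, so their moments and their laws agree. *)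
Lemma dirichlet_process_P i : dirichlet_process Pr (m i) (P i).
Proof.
move=> n A mA tA UA; pose a j := fine (m i (A j)).
have a0 j : 0 <= a j by exact: fine_ge0.
have [d' [Om [Q [Z [indZ lawZ Z0 stZ]]]]] := indep_gammas a0.
have dm := dirichlet_moments a0 Z0 stZ; have rm := row_moments i tA.
have aM : \sum_j a j = uw (inl i).
  have UA' : \big[setU/set0]_(j < n) A j = setT.
    apply/seteqP; split => // x _; have [j _ Ajx] : (\bigcup_j A j) x by rewrite UA.
    by rewrite (bigD1 j)//=; left.
  have := measure_bigsetU_ord (m i) xpredT mA tA; rewrite UA' /= => ->.
  rewrite /a (eq_bigr (fun j => (fine (m i (A j)))%:E)); first by rewrite sumEFin.
  by move=> j _; rewrite fineK// m_fin_num.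
have M0 : 0 < uw (inl i) by exact: (urn_weight_gt0 m_pos m_fin c_pos F0_tail (inl i)).
exists d', Om, Q, Z; split=> // B mB.
pose V j w := Z j w / \sum_h Z h w.
apply: (@moments_law _ _ _ _ _ Pr Q (n.-tuple R) 'I_n (fun j t => tnth t j)
  (fun w => [tuple fine (P i w (A j)) | j < n]) (fun w => [tuple V j w | j < n])).
- move=> j; rewrite (_ : _ \o _ = fun w => fine (P i w (A j))).
    by have [] := rm [::] j.
  by apply/funext => w /=; rewrite tnth_mktuple.
- move=> j; rewrite (_ : _ \o _ = V j); first by have [] := dm [::] j.
  by apply/funext => w /=; rewrite tnth_mktuple.
- by move=> j w; rewrite tnth_mktuple; have [_ h _] := rm [::] j; exact: h.
- by move=> j w; rewrite tnth_mktuple; have [h _ _] := dm [::] j; exact: h.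
- move=> s.
  transitivity (Ex Pr (fun w => \prod_(j <- s) fine (P i w (A j)))).
    by apply: eq_Ex => w; apply: eq_bigr => j _; rewrite tnth_mktuple.
  transitivity (Ex Q (fun w => \prod_(j <- s) V j w)); last first.
    by apply: eq_Ex => w; apply: eq_bigr => j _; rewrite tnth_mktuple.
  elim: s => [|j s ih].
    by under eq_Ex do rewrite big_nil; under [RHS]eq_Ex do rewrite big_nil; rewrite !Ex_cst.
  have Ms : uw (inl i) + (size s)%:R != 0 by rewrite gt_eqF// ltr_pwDl.
  apply: (mulfI Ms); have [_ _ ->] := rm s j; rewrite ih -aM.
  by have [_ _ ->] := dm s j.
(* The sigma-algebra of tuples is generated by the coordinate maps. *)
- move: B mB; apply: smallest_sub; first exact: smallest_sigma_algebra.
  suff h : \big[setU/set0]_(j < n) preimage_set_system setT (fun t : n.-tuple R => tnth t j) measurable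
      `<=` \bigcup_j sigma_rv (fun t : n.-tuple R => tnth t j).
    by apply: subset_trans h _; exact: sub_sigma_algebra.
  by elim/big_ind: _ => [|X Y hX hY|j _ X]; [exact: sub0set|rewrite subUset|exists j].
Qed.

Lemma SMBS_PF : SMBS Pr m c F0 P F.
Proof.
split; [exact: indep_PF|exact: indep_P|exact: indep_F|exact: dirichlet_process_P|].
exact: beta_stacy_F.
Qed.

End prior.

(** * The conditional semi-Markov law *)

Section jump_times.
Context {dE} {E : measurableType dE}.
Implicit Types s : nat -> E.

Definition njumps s t : nat := (\sum_(k < t) (s k.+1 != s k))%N.

Definition jumps_forever s := forall n, exists t, (n <= njumps s t)%N.

(** Says that jump [n] occurs at time [t], jump 0 being time 0. It depends only on the path up to
    [t], unlike [jump_time], which inspects the whole path. *)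
Definition hits s n t : bool := (n <= njumps s t)%N && ((t == 0%N) || (njumps s t.-1 < n)%N).

(* On a path with finitely many jumps, the junk value [n] keeps the sequence strictly increasing. *)
Definition jump_time s n : nat :=
  if pselect (jumps_forever s) is left h then ex_minn (h n) else n.

Lemma njumpsS s t : njumps s t.+1 = (njumps s t + (s t.+1 != s t))%N.
Proof. by rewrite /njumps big_ord_recr. Qed.

Lemma njumps_mono s t u : (t <= u)%N -> (njumps s t <= njumps s u)%N.
Proof. by move/subnKC => <-; elim: (u - t)%N => [|k ih]; rewrite ?addn0// addnS njumpsS (leq_trans ih)// leq_addr. Qed.

Lemma njumps_le s t : (njumps s t <= t)%N.
Proof. by elim: t => [|t ih]; rewrite ?njumpsS /njumps ?big_ord0//; case: (_ != _); rewrite /= ?addn1 ?addn0 ?ltnS// leqW. Qed.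

Lemma njumps_const s t u : (t <= u)%N -> njumps s t = njumps s u -> s u = s t.
Proof.
move/subnKC => <-; elim: (u - t)%N => [|k ih]; rewrite ?addn0// addnS njumpsS => h.
have tk : (njumps s t <= njumps s (t + k))%N by rewrite njumps_mono// leq_addr.
have e : (s (t + k).+1 != s (t + k)%N) = false by apply/negbTE; move: h tk; case: (_ != _) => /=; lia.
by move: h; rewrite e addn0 => /ih <-; exact/eqP/negbFE.
Qed.

Lemma njumps_prefix s s' t : (forall k, (k <= t)%N -> s k = s' k) -> njumps s t = njumps s' t.
Proof. by move=> h; apply: eq_bigr => k _; rewrite !h ?(ltnW (ltn_ord k)). Qed.

Lemma hits_prefix s s' n t : (forall k, (k <= t)%N -> s k = s' k) -> hits s n t = hits s' n t.
Proof.
move=> h; rewrite /hits (njumps_prefix h) (@njumps_prefix s s' t.-1)// => k kt.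
by apply: h; rewrite (leq_trans kt)// leq_pred.
Qed.

Lemma hits_njumps s n t : hits s n t -> njumps s t = n.
Proof.
case: t => [|t] /andP[nt] /=; first by move: nt; rewrite {1}/njumps big_ord0 leqn0 => /eqP ->; rewrite /njumps big_ord0.
by move: nt; rewrite njumpsS; case: (_ != _) => /=; lia.
Qed.

Lemma hits_elapsed s n t : hits s n t -> elapsed s t = 0%N.
Proof.
case: t => [|t]; first by rewrite elapsed0.
move=> /andP[] /=; rewrite njumpsS elapsedS; case: eqP => //= _; lia.
Qed.

Lemma jump_timeE s n t : jumps_forever s -> hits s n t -> jump_time s n = t.
Proof.
move=> js /andP[nt h]; rewrite /jump_time; case: pselect => // js'.
case: ex_minnP => u nu minu; apply/eqP; rewrite eqn_leq minu//=.
case: t h nt => [|t] //= h nt; rewrite ltnNge; apply/negP => ut.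
by move: h; rewrite ltnNge => /negP; apply; rewrite (leq_trans nu)// njumps_mono.
Qed.

Lemma jump_time_hits s n : jumps_forever s -> hits s n (jump_time s n).
Proof.
move=> js; rewrite /jump_time; case: pselect => // js'; case: ex_minnP => u nu minu.
rewrite /hits nu/=; case: u minu nu => //= u minu nu.
by rewrite ltnNge; apply/negP => /minu; rewrite ltnn.
Qed.

Lemma jump_time_le s n t : jumps_forever s -> (jump_time s n <= t)%N = (n <= njumps s t)%N.
Proof.
move=> js; rewrite /jump_time; case: pselect => // js'; case: ex_minnP => u nu minu.
by apply/idP/idP => [ut|/minu//]; rewrite (leq_trans nu)// njumps_mono.
Qed.

Lemma jump_time0 s : jump_time s 0 = 0%N.
Proof. by rewrite /jump_time; case: pselect => // js; case: ex_minnP => u _ /(_ 0%N isT); rewrite leqn0 => /eqP. Qed.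

Lemma jump_timeS s n : (jump_time s n < jump_time s n.+1)%N.
Proof.
have [js|njs] := pselect (jumps_forever s); last first.
  by rewrite /jump_time; case: pselect.
rewrite ltnNge jump_time_le//; apply/negP.
by rewrite (hits_njumps (jump_time_hits n js)) ltnn.
Qed.

Lemma recurrent_jumps s : recurrent_path s -> jumps_forever s.
Proof.
move=> [tau [tau0 htau] _]; suff h n : (n <= njumps s (tau n))%N by move=> n; exists (tau n).
elim: n => [|n ih] //; have [tn sn cn] := htau n.
have -> : tau n.+1 = (tau n.+1).-1.+1 by rewrite prednK// (leq_ltn_trans _ tn).
rewrite njumpsS prednK ?(leq_ltn_trans _ tn)//.
have -> : s (tau n.+1).-1 = s (tau n).
  case: (ltngtP (tau n) (tau n.+1).-1) => [lt| |<- //]; last by lia.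
  by apply: cn; rewrite lt/=; lia.
have -> : s (tau n.+1) != s (tau n) by exact/eqP.
by rewrite addn1 ltnS (leq_trans ih)// njumps_mono//; lia.
Qed.

(** The path that follows [s] up to [k], remains there through time [k + t - 1], and is at [j] from
    time [k + t] on: a holding time of exactly [t] when [k] is a jump time and [j] differs from
    [s k]. *)
Definition extend s k t j : nat -> E :=
  fun u => if (u <= k)%N then s u else if (u < k + t)%N then s k else j.

Lemma extend_hits s n k t j : hits s n k -> j != s k -> (0 < t)%N ->
  hits (extend s k t j) n.+1 (k + t).
Proof.
move=> h jk t0; have E1 x : (x < t)%N -> extend s k t j (k + x) = s k.
  by move=> xt; rewrite /extend; case: ifP => xk; [congr s; lia|rewrite ltn_add2l xt].
have stay x : (x < t)%N -> njumps (extend s k t j) (k + x) = n.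
  elim: x => [|x ih] xt.
    by rewrite addn0 -(hits_njumps h); apply: njumps_prefix => u uk; rewrite /extend uk.
  by rewrite addnS njumpsS ih 1?ltnW// -addnS !E1// 1?ltnW// eqxx addn0.
case: t t0 stay E1 => // t _ stay E1; rewrite /hits addnS /= stay// ltnS leqnn andbT njumpsS stay//.
have -> : extend s k t.+1 j (k + t).+1 = j by rewrite /extend addnS ltnn leqNgt ltnS leq_addr.
by rewrite E1// jk addn1.
Qed.

Lemma path_draws_extend s n k t j : hits s n k -> j != s k ->
  path_draws (extend s k t.+1 j) (k + t.+1) =
  [:: inl (s k, j), inr ((s k, t), true) & [seq inr ((s k, x), false) | x <- rev (iota 0 t)]] ++
  path_draws s k.
Proof.
move=> h jk; have e0 := hits_elapsed h.
have E1 x : (x <= t)%N -> extend s k t.+1 j (k + x) = s k.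
  by move=> xt; rewrite /extend; case: ifP => xk; [congr s; lia|rewrite ltn_add2l ltnS xt].
have E2 : extend s k t.+1 j (k + t).+1 = j by rewrite /extend addnS ltnn leqNgt ltnS leq_addr.
have pre u : (u <= k)%N -> extend s k t.+1 j u = s u by rewrite /extend => ->.
have stay x : (x <= t)%N -> elapsed (extend s k t.+1 j) (k + x) = x /\
    path_draws (extend s k t.+1 j) (k + x) =
    [seq inr ((s k, y), false) | y <- rev (iota 0 x)] ++ path_draws s k.
  elim: x => [|x ih] xt.
    by rewrite addn0 (elapsed_prefix pre) e0 (path_draws_prefix pre).
  have io : rev (iota 0 x.+1) = x :: rev (iota 0 x) by rewrite -addn1 iotaD rev_cat.
  have [i1 i2] := ih (ltnW xt); rewrite io addnS elapsedS /= -addnS !E1 ?(ltnW xt)// eqxx i1; split=> //.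
  by rewrite i2.
have [i1 i2] := stay t (leqnn t); rewrite addnS /= E1// E2 (negbTE jk) i1 i2.
by [].
Qed.

End jump_times.

Section semi_markov_representation.
Context {R : realType} {d} {Omega : measurableType d} (Pr : probability Omega R).
Context {dE} {E : measurableType dE}.
Context (E_countable : countable [set: E]) (E_discrete : forall A : set E, measurable A).
Context (l0 : E) (m : E -> {measure set E -> \bar R}) (c : E -> nat -> R)
  (F0 : E -> probability nat R).
Hypotheses (m_pos : forall i, (0 < m i setT)%E) (m_fin : forall i, (m i setT < +oo)%E)
  (m_diag : forall i, m i [set i] = 0%E) (c_pos : forall i t, (0 < t)%N -> 0 < c i t)
  (F0_pos_int : forall i, F0 i [set 0%N] = 0%E)
  (F0_tail : forall i t, (0 < F0 i [set n | (t < n)%N])%E).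
Context (S : nat -> {RV Pr >-> E}).
Hypotheses (S_RSM : RSM Pr l0 m c F0 (fun t => S t)) (S_recurrent : recurrent Pr (fun t => S t)).

Local Notation path w := (fun k => S k w).
Local Notation dw := (draw_weight m c F0).
Local Notation uw := (urn_weight m c F0).
Local Notation pd := (draw_prob urn_of dw uw).
Local Notation pds := (draws_prob urn_of dw uw).

Let tau n w := jump_time (path w) n.
Let good := [set w | jumps_forever (path w)].

Let good_ae : {ae Pr, forall w, good w}.
Proof. by apply: filterS S_recurrent => w; exact: recurrent_jumps. Qed.

Let S0_ae : {ae Pr, forall w, S 0%N w = l0}. Proof. by have [] := S_RSM. Qed.

Let measurable_prefix (A : (nat -> E) -> Prop) t :
  (forall s s', (forall k, (k <= t)%N -> s k = s' k) -> A s -> A s') ->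
  measurable [set w | A (path w)].
Proof.
move=> AP; rewrite (_ : [set w | _] = hist S t @^-1` [set h | A (nth l0 h)]).
  exact: (discrete_measurable _ (hist_discrete E_countable E_discrete l0 S t)).
have e w k : (k <= t)%N -> nth l0 (hist S t w) k = S k w.
  by move=> kt; rewrite /hist (nth_map 0%N) ?size_iota// nth_iota// add0n.
by apply/seteqP; split => w /= Aw; apply: AP Aw => k kt; rewrite e.
Qed.

Let measurable_good : measurable good.
Proof.
rewrite (_ : good = \bigcap_n \bigcup_t [set w | (n <= njumps (path w) t)%N]).
  apply: bigcap_measurable => // n _; apply: bigcup_measurable => t _.
  by apply: (@measurable_prefix (fun s => (n <= njumps s t)%N) t) => s s' h; rewrite (njumps_prefix h).
apply/seteqP; split => w; first by move=> gw n _; have [t ht] := gw n; exists t.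
by move=> gw n; have [t _ ht] := gw n I; exists t.
Qed.

Let measurable_hits n t : measurable [set w | hits (path w) n t].
Proof. by apply: (@measurable_prefix (fun s => hits s n t) t) => s s' h; rewrite (hits_prefix n h). Qed.

Let tau_discrete n : discrete_map (tau n).
Proof.
split; first by exists id.
move=> t; rewrite (_ : _ @^-1` _ = (good `&` [set w | hits (path w) n t]) `|` (~` good `&` [set w | n = t])).
  apply: measurableU; apply: measurableI => //; first exact: measurableC.
  have [->|nt] := pselect (n = t); first by rewrite (_ : [set w | _] = setT)//; apply/seteqP; split.
  by rewrite (_ : [set w | _] = set0)//; apply/seteqP; split.
apply/seteqP; split => w /=.
  move=> <-; have [gw|gw] := pselect (good w); [left; split=> //|right; split=> //].
    exact: jump_time_hits.
  by rewrite /tau /jump_time; case: pselect.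
case=> [[gw ht]|[gw <-]]; first exact: jump_timeE.
by rewrite /tau /jump_time; case: pselect.
Qed.

Let Lf n w := S (tau n w) w.
Let Tf n w := (tau n.+1 w - tau n w)%N.
Let past n w := hist S (tau n w) w.

Let at_tau_discrete {U : Type} (H : nat -> Omega -> U) n : (forall t, discrete_map (H t)) ->
  discrete_map (fun w => H (tau n w) w).
Proof.
move=> dH; split; first by have [] := dH 0%N.
move=> h; rewrite (_ : _ @^-1` _ = \bigcup_t (tau n @^-1` [set t] `&` H t @^-1` [set h])).
  apply: bigcup_measurable => t _; apply: measurableI; first by have [_] := tau_discrete n.
  by have [_] := dH t.
by apply/seteqP; split => w /= [] => [<-|t _ [<-]//]; exists (tau n w).
Qed.

Let past_discrete n : discrete_map (past n).
Proof. by apply: (at_tau_discrete (H := hist S)) => t; exact: hist_discrete. Qed.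

Let S_discrete t : discrete_map (S t).
Proof.
split; first exact: E_inj.
by move=> h; rewrite -[X in measurable X]setTI; exact: measurable_funP.
Qed.

Let L_discrete n : discrete_map (Lf n).
Proof. exact: (at_tau_discrete (H := fun t => S t)). Qed.

Let measurable_L n : measurable_fun setT (Lf n).
Proof. exact: (discrete_measurable_fun id (L_discrete n)). Qed.

Let measurable_T n : measurable_fun setT (Tf n).
Proof.
have dp : discrete_map (fun w => (tau n w, tau n.+1 w)).
  split; first by exists pickle; exact: pcan_inj pickleK.
  move=> [a b]; rewrite (_ : _ @^-1` _ = tau n @^-1` [set a] `&` tau n.+1 @^-1` [set b]).
    by apply: measurableI; [have [_] := tau_discrete n|have [_] := tau_discrete n.+1].
  by apply/seteqP; split => w /= [-> ->].
exact: (discrete_measurable_fun (fun p => (p.2 - p.1)%N) dp).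
Qed.

Let L n : {RV Pr >-> E} := HB.pack (Lf n) (isMeasurableFun.Build _ _ _ _ _ (measurable_L n)).
Let T n : {RV Pr >-> nat} := HB.pack (Tf n) (isMeasurableFun.Build _ _ _ _ _ (measurable_T n)).

Let T_pos n w : (0 < T n w)%N. Proof. by rewrite /= /Tf subn_gt0 jump_timeS. Qed.

Let renewal_timeE n w : renewal_time (T ^~ w) n = tau n w.
Proof.
rewrite /renewal_time; elim: n => [|n ih]; first by rewrite big_geq// /tau jump_time0.
by rewrite big_nat_recr//= ih /Tf subnKC// ltnW// jump_timeS.
Qed.

(** The renewal count at [t] is the number of jumps up to [t], and the path does not move between
    that jump and [t]. *)
Let S_renewal : {ae Pr, forall w, forall t, S t w = L (renewal_count (T ^~ w) t) w}.
Proof.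
apply: filterS good_ae => w gw t.
have -> : renewal_count (T ^~ w) t = njumps (path w) t.
  rewrite /renewal_count (eq_big_nat _ _ (F2 := fun n => nat_of_bool (n <= njumps (path w) t)%N)).
    have := njumps_le (path w) t; move: (njumps _ t) => N.
    rewrite big_add1/= => /subnKC <-; elim: (t - N)%N => [|k ih].
      rewrite addn0 big_nat_cond (eq_bigr (fun=> 1%N)); last by move=> i /andP[/andP[_ ->]].
      by rewrite -big_nat_cond big_const_nat subn0 iter_addn_0 mul1n.
    by rewrite addnS big_nat_recr//= ih ltnNge leq_addr addn0.
  by move=> n _; rewrite renewal_timeE /tau jump_time_le.
have := @njumps_const _ _ (path w) (tau (njumps (path w) t) w) t; apply.
  by rewrite /tau jump_time_le.
by rewrite (hits_njumps (jump_time_hits _ gw)).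
Qed.

Context (theta : @draw dE E -> Omega -> R).
Hypotheses (mtheta : forall e, measurable_fun setT (theta e))
  (theta01 : forall e w, 0 <= theta e w <= 1)
  (theta_cyl : forall s t (phi : seq (@draw dE E)),
     Ex Pr (fun w => \1_(cyl S s t) w * \prod_(e <- phi) theta e w) =
     pds (phi ++ path_draws s t) [::] * (s 0%N == l0)%:R).

(** The cylinder at time 0 of the constant path [l0] has probability one. *)
Lemma moments_of_cyl (phi : seq (@draw dE E)) :
  Ex Pr (fun w => \prod_(e <- phi) theta e w) = pds phi [::].
Proof.
have := theta_cyl (fun=> l0) 0 phi; rewrite eqxx mulr1 cats0 => <-.
have b : bmf (fun w => \prod_(e <- phi) theta e w) by apply: bmf_prod => e; exact: bmf_01.
apply: ae_Ex => //.
  by apply: bmfM => //; apply: bmf_indic; exact: (measurable_cyl E_discrete).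
apply: filterS S0_ae => w Sw; rewrite (@indic_bool _ _ _ true) ?mul1r//.
by split=> // _ k; rewrite leqn0 => /eqP ->.
Qed.

Section one_step.
Context (s : nat -> E) (n k : nat) (j : E) (t : nat).
Hypothesis sk : hits s n k.

Let i := s k.
Let A := [set w | Lf n.+1 w = j /\ (Tf n w <= t)%N].
Let ft w := (1 - survival theta i t w) * theta (inl (i, j)) w.
Let D := good `&` cyl S s k.

Lemma tau_cyl w : D w -> tau n w = k.
Proof.
move=> [gw cw]; apply: jump_timeE => //; by rewrite (hits_prefix (s' := s)).
Qed.

Let L_neq w : D w -> Lf n.+1 w != i.
Proof.
move=> Dw; have [gw cw] := Dw; have tk := tau_cyl Dw.
apply/eqP => Li; have h := jump_time_hits n.+1 gw; rewrite -/(tau n.+1 w) in h.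
have := jump_timeS (path w) n; rewrite -/(tau n w) -/(tau n.+1 w) tk => kt.
move: h Li; rewrite /Lf; case: (tau n.+1 w) kt => // u ku h Li.
have nu : njumps (path w) u = n.
  have /eqP := hits_njumps h; move: h; rewrite /hits /= => /andP[_]; rewrite ltnS njumpsS.
  case: (_ != _) => /=; lia.
have := hits_njumps h; rewrite njumpsS nu.
have -> : S u w = S k w.
  apply: (@njumps_const _ _ (path w)); first by rewrite -ltnS.
  have := jump_time_hits n gw; rewrite -/(tau n w) tk => /hits_njumps ->.
  by rewrite nu.
by rewrite Li cw// -/i eqxx addn0 => /eqP; rewrite ltn_eqF.
Qed.

(** Given the past up to jump [n], following [extend s k x.+1 j] up to time [k + x.+1] means holding
    time [x.+1] and next state [j]. *)
Let cyl_step x w : j != i -> D w ->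
  cyl S (extend s k x.+1 j) (k + x.+1) w <-> (x == (Tf n w).-1) && (Lf n.+1 w == j).
Proof.
move=> ji Dw; have [gw cw] := Dw; have tk := tau_cyl Dw; split=> [cx|/andP[/eqP xE /eqP Lj]].
  have : hits (path w) n.+1 (k + x.+1).
    rewrite (hits_prefix (s' := extend s k x.+1 j)); first exact: extend_hits.
    by move=> u; exact: cx.
  move=> /(jump_timeE gw); rewrite -/(tau n.+1 w) => t1.
  rewrite /Tf /Lf t1 tk addKn eqxx/=; apply/eqP; rewrite cx// /extend ltnn.
  by rewrite leqNgt -[X in (X < _)%N]addn0 ltn_add2l.
have t1 : tau n.+1 w = (k + x.+1)%N.
  rewrite xE /Tf prednK ?subn_gt0 ?jump_timeS// tk subnKC// -tk.
  by rewrite ltnW// jump_timeS.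
move=> u ukx; rewrite /extend; case: ifP => uk; first exact: cw.
case: ltnP => ux.
  rewrite -(cw k)//; apply: (@njumps_const _ _ (path w)); first by rewrite ltnW// ltnNge uk.
  have nk : njumps (path w) k = n by rewrite -tk; apply: hits_njumps; exact: jump_time_hits.
  have nu : (n <= njumps (path w) u)%N by rewrite -jump_time_le// -/(tau n w) tk ltnW// ltnNge uk.
  have : ~~ (n.+1 <= njumps (path w) u)%N by rewrite -jump_time_le// -/(tau n.+1 w) t1 -ltnNge.
  by rewrite nk; lia.
by rewrite -Lj /Lf t1; congr (S _ w); lia.
Qed.

Let mA : measurable A.
Proof.
rewrite (_ : A = Lf n.+1 @^-1` [set j] `&` Tf n @^-1` [set u | (u <= t)%N]) //.
apply: measurableI; first by have [_] := L_discrete n.+1.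
by rewrite -[X in measurable X]setTI; exact: measurable_T.
Qed.

Let A_split : j != i -> {ae Pr, forall w, \1_(cyl S s k) w * \1_A w =
  \sum_(x < t) \1_(cyl S (extend s k x.+1 j) (k + x.+1)) w :> R}.
Proof.
move=> ji; apply: filterS good_ae => w gw.
have [cw|ncw] := pselect (cyl S s k w); last first.
  rewrite (@indic_bool _ _ _ false) ?mul0r; last by split.
  rewrite big1// => x _; apply: (@indic_bool _ _ _ false); split => // cx.
  exfalso; apply: ncw => u uk; rewrite cx ?(leq_trans uk) ?leq_addr//.
  by rewrite /extend uk.
have Dw : D w by [].
rewrite (@indic_bool _ _ _ true) ?mul1r; last by split.
rewrite (eq_bigr (fun x : 'I_t => ((x == (Tf n w).-1 :> nat) && (Lf n.+1 w == j))%:R)); last first.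
  by move=> x _; apply: indic_bool; exact: cyl_step.
rewrite (@indic_bool _ _ _ ((Lf n.+1 w == j) && (Tf n w <= t)%N)); last first.
  by split=> [[-> ->]|/andP[/eqP ? ?]]; rewrite ?eqxx.
case: (Lf n.+1 w == j) => /=; last by rewrite big1// => x _; rewrite andbF.
have Tp : (0 < Tf n w)%N by rewrite subn_gt0 jump_timeS.
case: leqP => Tt.
  have xt : ((Tf n w).-1 < t)%N by rewrite prednK.
  rewrite (bigD1 (Ordinal xt))//= eqxx big1 ?addr0// => x xE.
  by rewrite andbT; move: xE; rewrite -val_eqE /= => /negbTE ->.
rewrite big1// => x _; rewrite andbT ltn_eqF//.
by rewrite (leq_trans (ltn_ord x))// -ltnS prednK.
Qed.

Let xi x : seq (@draw dE E) := [:: inl (i, j), inr ((i, x), true) &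
  [seq inr ((i, y), false) | y <- rev (iota 0 x)]].

Let ft_split : {ae Pr, forall w, ft w = \sum_(x < t) \prod_(e <- xi x) theta e w}.
Proof.
have : {ae Pr, forall w, forall y, theta (inr ((i, y), false)) w = 1 - theta (inr ((i, y), true)) w}.
  by apply: ae_foralln => y; exact: (stay_ae m_pos m_fin c_pos F0_tail mtheta theta01 moments_of_cyl).
apply: filterS => w h; rewrite /ft -sum_holding_weight big_ord_recl /= add0r mulr_suml.
apply: eq_bigr => x _; rewrite /xi !big_cons mulrC /= add0n; congr (_ * (_ * _)).
elim: (x : nat) => [|y ih]; first by rewrite /survival big_ord0 big_nil.
by rewrite survivalS ih -h -addn1 iotaD rev_cat /= big_cons.
Qed.

Let bsurv : bmf (survival theta i t).
Proof. by apply: bmf_01; [exact: measurable_survival|exact: survival01]. Qed.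

Let bft : bmf ft.
Proof. by apply: bmfM; [apply: bmfB => //; exact: bmf_cst|exact: bmf_01]. Qed.

Let bcyl s' k' : bmf (\1_(cyl S s' k') : Omega -> R).
Proof. by apply: bmf_indic; exact: (measurable_cyl E_discrete). Qed.

Let bprod phi : bmf (fun w => \prod_(e <- phi) theta e w).
Proof. by apply: bmf_prod => e; exact: bmf_01. Qed.

(** Both sides split over the possible holding times [x.+1 <= t]. On the left each piece is a
    cylinder of the extended path; on the right it is the product of the limits of the draws [xi x]
    made along that extension. [theta_cyl] gives both the same value. If [j = i] both sides
    vanish. *)
Lemma one_step psi :
  Ex Pr (fun w => \1_(cyl S s k) w * \1_A w * \prod_(e <- psi) theta e w) =
  Ex Pr (fun w => \1_(cyl S s k) w * ft w * \prod_(e <- psi) theta e w).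
Proof.
have bA : bmf (\1_A : Omega -> R) by exact: bmf_indic.
have b1 : bmf (fun w => \1_(cyl S s k) w * \1_A w * \prod_(e <- psi) theta e w).
  by apply: bmfM => //; exact: bmfM.
have b2 : bmf (fun w => \1_(cyl S s k) w * ft w * \prod_(e <- psi) theta e w).
  by apply: bmfM => //; exact: bmfM.
have [ji|ji] := eqVneq j i.
  transitivity (Ex Pr (fun=> 0)); [|apply/esym]; apply: ae_Ex => //; try exact: bmf_cst.
    apply: filterS good_ae => w gw; have [cw|ncw] := pselect (cyl S s k w); last first.
      by rewrite (@indic_bool _ _ (cyl _ _ _) false) ?mul0r//; split.
    rewrite [\1_A w](@indic_bool _ _ _ false) ?mulr0 ?mul0r//; split => // -[Lj _].
    by have := @L_neq w (conj gw cw); rewrite Lj ji eqxx.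
  have := diag_ae m_diag mtheta theta01 moments_of_cyl i; apply: filterS => w h.
  by rewrite /ft ji h !mulr0 mul0r.
transitivity (\sum_(x < t) pds (psi ++ xi x ++ path_draws s k) [::] * (s 0%N == l0)%:R).
  transitivity (Ex Pr (fun w => \sum_(x < t)
      \1_(cyl S (extend s k x.+1 j) (k + x.+1)) w * \prod_(e <- psi) theta e w)).
    apply: ae_Ex => //; first by apply: bmf_sum => x; exact: bmfM.
    by apply: filterS (A_split ji) => w ->; rewrite mulr_suml.
  rewrite Ex_sum; last by move=> x; exact: bmfM.
  by apply: eq_bigr => x _; rewrite theta_cyl (path_draws_extend x sk ji).
apply/esym; transitivity (Ex Pr (fun w => \sum_(x < t)
    \1_(cyl S s k) w * \prod_(e <- psi ++ xi x) theta e w)).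
  apply: ae_Ex => //; first by apply: bmf_sum => x; exact: bmfM.
  apply: filterS ft_split => w ->; rewrite mulr_sumr mulr_suml.
  by apply: eq_bigr => x _; rewrite big_cat/= mulrAC mulrA.
rewrite Ex_sum; last by move=> x; exact: bmfM.
by apply: eq_bigr => x _; rewrite theta_cyl catA.
Qed.

Lemma one_step_gen C : gen theta setT C ->
  Ex Pr (fun w => \1_(cyl S s k) w * \1_A w * \1_C w) =
  Ex Pr (fun w => \1_(cyl S s k) w * ft w * \1_C w).
Proof.
move=> GC; apply: (gen_moments mtheta theta01 _ _ _ GC) => [||phi _].
- by apply: bmfM => //; exact: bmf_indic.
- exact: bmfM.
- exact: one_step.
Qed.

End one_step.

Context (g : E -> nat) (gI : injective g).
Context (P : E -> R.-pker Omega ~> E) (F : E -> R.-pker Omega ~> nat).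
Hypotheses
  (PE : forall i w, (P i w : set E -> \bar R) =
     weight_prob g l0 (fun j => theta (inl (i, j)) w))
  (PS : forall i, sigma_rpm (P i) `<=` <<s \bigcup_j sigma_rv (theta (inl (i, j))) >>)
  (FE : forall i w, (F i w : set nat -> \bar R) = weight_prob id 0%N (holding_weight theta i ^~ w))
  (FS : forall i, sigma_rpm (F i) `<=` <<s \bigcup_t sigma_rv (holding_weight theta i t) >>).

(** * The conditional law of one renewal step *)

Section conditional_step.
Context (n t : nat) (j : E).

Let G := renewal_history P F (fun n => L n) (fun n => T n) n.
Let A := [set w | Lf n.+1 w = j /\ (Tf n w <= t)%N].
Let f w := (F (L n w) w [set s | (s <= t)%N] * P (L n w) w [set j])%E.

Let GT : sigma_algebra setT G. Proof. exact: smallest_sigma_algebra. Qed.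

Let G_P i X : sigma_rpm (P i) X -> G X.
Proof. by move=> PX; apply: sub_sigma_algebra; left; right; exists i. Qed.

Let G_F i X : sigma_rpm (F i) X -> G X.
Proof. by move=> PX; apply: sub_sigma_algebra; right; exists i. Qed.

Let G_L k B : (k <= n)%N -> measurable B -> G (Lf k @^-1` B).
Proof.
move=> kn mB; apply: sub_sigma_algebra; left; left; left; exists k => //.
by exists B => //; rewrite setTI.
Qed.

(** The state [L n] selects the kernels. On each of the countably many events fixing it the kernels
    are fixed too, and their values are part of the history. *)
Let f_measurable B : measurable B -> G (f @^-1` B).
Proof.
move=> mB; pose GG := g_sigma_algebraType
  ((\bigcup_(k in [set k | (k <= n)%N]) sigma_rv (L k)) `|`
   (\bigcup_(k in [set k | (k < n)%N]) sigma_rv (T k)) `|`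
   (\bigcup_i sigma_rpm (P i)) `|` (\bigcup_i sigma_rpm (F i))).
have -> : f @^-1` B = \bigcup_x (Lf n @^-1` [set i | g i = x] `&` f @^-1` B).
  by apply/seteqP; split => w; [move=> Bw; exists (g (Lf n w))|move=> [x _ []]].
apply: (@bigcup_measurable _ GG) => x _.
have [[i gi]|nx] := pselect (exists i, g i = x); last first.
  rewrite (_ : _ `&` _ = set0); first exact: (@measurable0 _ GG).
  by apply/seteqP; split => // w [/= e _]; apply: nx; exists (Lf n w).
pose fi (w : GG) := (F i w [set s | (s <= t)%N] * P i w [set j])%E.
have -> : Lf n @^-1` [set i | g i = x] `&` f @^-1` B = Lf n @^-1` [set i] `&` fi @^-1` B.
  apply/seteqP; split => w [/= e]; rewrite /f /fi -gi in e *.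
    by have {}e := gI e; rewrite /= e.
  by rewrite /= e.
apply: (@measurableI _ GG); first exact: G_L.
have mfi : measurable_fun setT fi.
  apply: emeasurable_funM.
    move=> _ C mC; rewrite setTI; apply: (G_F (i := i)); apply: sub_sigma_algebra.
    by exists [set s | (s <= t)%N] => //; exists C => //; rewrite setTI.
  move=> _ C mC; rewrite setTI; apply: (G_P (i := i)); apply: sub_sigma_algebra.
  by exists [set j] => //; exists C => //; rewrite setTI.
by have := mfi measurableT B mB; rewrite setTI.
Qed.

Let kernel01 {d1} {T1 : measurableType d1} (K : R.-pker Omega ~> T1) w B : measurable B ->
  (0 <= K w B <= 1)%E.
Proof. by move=> mB; rewrite measure_ge0 -(prob_kernel (s := K) w) le_measure ?inE. Qed.

Let sub_gen_all X : ((\bigcup_i sigma_rpm (P i)) `|` (\bigcup_i sigma_rpm (F i))) X -> gen theta setT X.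
Proof.
case=> -[i _ Xi].
  by apply: (gen_mono (C1 := row_draws i)); [exact: subsetT|exact: (sigma_P PS)].
by apply: (gen_mono (C1 := age_draws i)); [exact: subsetT|exact: (sigma_F FS)].
Qed.

Let G_sub_measurable X : G X -> measurable X.
Proof.
move: X; apply: smallest_sub; first exact: sigma_algebra_measurable.
move=> X [[[[k _ [B mB <-]]|[k _ [B mB <-]]]|PX]|FX].
- exact: measurable_L.
- exact: measurable_T.
- by apply: (gen_measurable mtheta (C := setT)); apply: sub_gen_all; left.
- by apply: (gen_measurable mtheta (C := setT)); apply: sub_gen_all; right.
Qed.

Let fr w := fine (f w).

Let f01 w : (0 <= f w <= 1)%E.
Proof.
have /andP[a0 a1] := kernel01 (F (L n w)) w (B := [set s | (s <= t)%N]) I.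
have /andP[b0 b1] := kernel01 (P (L n w)) w (E_discrete [set j]).
by rewrite mule_ge0//= -[leRHS]mule1 lee_pmul.
Qed.

Let frE w : f w = (fr w)%:E.
Proof.
have /andP[a0 a1] := f01 w.
by rewrite fineK// ge0_fin_numE// (le_lt_trans a1)// ltry.
Qed.

Let bfr : bmf fr.
Proof.
apply: bmf_01 => [|w]; last by rewrite -!lee_fin -frE f01.
apply: measurableT_comp => // _ B mB; rewrite setTI.
exact: (G_sub_measurable (f_measurable mB)).
Qed.

(** Once the path is known up to jump [n], the states and holding times of the history are
    constants, so any event of the history coincides there with an event of the limits alone. *)
Let history_cyl s k X : hits s n k -> G X ->
  exists2 C, gen theta setT C & forall w, (good `&` cyl S s k) w -> (X w <-> C w).
Proof.
move=> sk; move: X.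
have sT : sigma_algebra setT (gen theta setT) by exact: smallest_sigma_algebra.
have [gen0 genC genU] := sT.
pose D := good `&` cyl S s k.
have tau_const l w w' : (l <= n)%N -> D w -> D w' -> tau l w = tau l w' /\ Lf l w = Lf l w'.
  move=> ln Dw Dw'; have [gw cw] := Dw; have [gw' cw'] := Dw'.
  have lk : (tau l w <= k)%N.
    rewrite -(tau_cyl sk Dw); elim: n ln => [|n' ih]; first by rewrite leqn0 => /eqP ->.
    rewrite leq_eqVlt => /orP[/eqP ->//|]; rewrite ltnS => /ih /leq_trans; apply.
    by rewrite ltnW// jump_timeS.
  have e : tau l w' = tau l w.
    apply: jump_timeE => //; rewrite (hits_prefix (s' := path w)); first exact: jump_time_hits.
    by move=> u ul; rewrite cw' ?cw// (leq_trans ul).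
  by split=> //; rewrite /Lf e cw ?cw'.
have constant (Y : Omega -> Prop) : (forall w w', D w -> D w' -> Y w -> Y w') ->
    exists2 C, gen theta setT C & forall w, D w -> (Y w <-> C w).
  move=> cY; have [[w0 [Dw0 Yw0]]|nY] := pselect (exists w, D w /\ Y w).
    exists setT; first by have := genC _ gen0; rewrite setD0.
    by move=> w Dw; split => // _; exact: cY Yw0.
  by exists set0 => // w Dw; split => // Yw; apply: nY; exists w.
apply: smallest_sub.
  split.
  - by exists set0.
  - move=> X [C GC XC]; exists (setT `\` C); first exact: genC.
    by move=> w Dw; split=> -[_ nX]; split=> // /(XC w Dw).
  - move=> X hX; have [C hC] := choice (fun x => let: ex_intro2 C a b := hX x in ex_intro (fun C => gen theta setT C /\ _) C (conj a b)).
    exists (\bigcup_x C x); first by apply: genU => x; have [] := hC x.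
    move=> w Dw; split=> -[x _ Xw]; exists x => //; have [_ h] := hC x; exact/(h w Dw).
move=> X [[[[l /= ln [B mB <-]]|[l /= ln [B mB <-]]]|PX]|FX].
- apply: constant => w w' Dw Dw' [_ /= h]; split=> //=.
  by have [_ <-] := tau_const l w w' ln Dw Dw'.
- apply: constant => w w' Dw Dw' [_ /= h]; split=> //=.
  have [e _] := tau_const l w w' (ltnW ln) Dw Dw'; have [e' _] := tau_const l.+1 w w' ln Dw Dw'.
  by move: h; rewrite /Tf e e'.
- by exists X => //; apply: sub_gen_all; left.
- by exists X => //; apply: sub_gen_all; right.
Qed.

Let mA : measurable A.
Proof.
rewrite (_ : A = Lf n.+1 @^-1` [set j] `&` Tf n @^-1` [set u | (u <= t)%N]) //.
apply: measurableI; first by have [_] := L_discrete n.+1.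
by rewrite -[X in measurable X]setTI; exact: measurable_T.
Qed.

(** The expectation is split along the past up to jump [n], a countable partition. On each piece [B]
    becomes an event of the limits and the kernels become [ft], so [one_step_gen] applies. *)
Let step_zero B : G B -> Ex Pr (fun w => \1_B w * (\1_A w - fr w)) = 0.
Proof.
move=> GB; have mB := G_sub_measurable GB.
have bA : bmf (\1_A : Omega -> R) by exact: bmf_indic.
have bB : bmf (\1_B : Omega -> R) by exact: bmf_indic.
have bdf : bmf (fun w => \1_B w * (\1_A w - fr w)) by apply: bmfM => //; exact: bmfB.
apply: (Ex_discrete (past_discrete n) bdf) => h.
have bpast : bmf (\1_(past n @^-1` [set h]) : Omega -> R).
  by apply: bmf_indic; have [_] := past_discrete n.
pose k := (size h).-1; pose s := nth l0 h.
(* On [good] paths the past is a nonempty list whose last entry is at jump [n]; any other list has a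
   null fibre. *)
have [/andP[/eqP hk sk]|bad] := boolP ((size h == k.+1) && hits s n k); last first.
  transitivity (Ex Pr (fun=> 0)); last exact: Ex_cst.
  apply: ae_Ex; [exact: bmfM|exact: bmf_cst|]; apply: filterS good_ae => w gw.
  rewrite [X in _ * X](@indic_bool _ _ _ false) ?mulr0//; split=> // pw.
  have sh : size h = (tau n w).+1 by rewrite -pw /past /hist size_map size_iota.
  move: bad; rewrite /k /s sh eqxx/=; rewrite (hits_prefix (s' := path w)).
    by rewrite jump_time_hits.
  move=> u ut; rewrite -pw /past /hist (nth_map 0%N) ?size_iota// nth_iota//.
have [C GC BC] := history_cyl sk GB.
have mC := gen_measurable mtheta GC.
have bC : bmf (\1_C : Omega -> R) by exact: bmf_indic.
have bcyl : bmf (\1_(cyl S s k) : Omega -> R) by apply: bmf_indic; exact: (measurable_cyl E_discrete).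
pose ft w := (1 - survival theta (s k) t w) * theta (inl (s k, j)) w.
have bft : bmf ft.
  apply: bmfM; last exact: bmf_01.
  apply: bmfB; [exact: bmf_cst|apply: bmf_01]; [exact: measurable_survival|exact: survival01].
transitivity (Ex Pr (fun w => \1_(cyl S s k) w * \1_A w * \1_C w - \1_(cyl S s k) w * ft w * \1_C w)).
  apply: ae_Ex; [exact: bmfM|by apply: bmfB; apply: bmfM => //; exact: bmfM|].
  have FL := F_le E_countable m_pos m_fin c_pos F0_pos_int F0_tail mtheta theta01 moments_of_cyl FE.
  have PA := P_atoms E_countable E_discrete m_pos m_fin c_pos F0_tail mtheta theta01 moments_of_cyl gI PE.
  apply: filterS3 good_ae FL PA => w gw Fw Pw.
  have fibre : (past n @^-1` [set h]) w <-> cyl S s k w.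
    split=> [pw|cw].
      have sh : size h = (tau n w).+1 by rewrite -pw /past /hist size_map size_iota.
      have tk : tau n w = k by rewrite /k sh.
      by have := hist_fibre l0 S k h; rewrite hk eqxx => <-; rewrite -tk.
    have tk := tau_cyl sk (conj gw cw).
    by have := hist_fibre l0 S k h; rewrite hk eqxx /past => e; rewrite /= tk; rewrite -e in cw.
  have [cw|ncw] := pselect (cyl S s k w); last first.
    rewrite [\1_(past n @^-1` _) w](@indic_bool _ _ _ false); last by split=> // /fibre.
    by rewrite [\1_(cyl S s k) w](@indic_bool _ _ _ false) ?mulr0 ?mul0r ?subrr//; split.
  rewrite [\1_(past n @^-1` _) w](@indic_bool _ _ _ true); last by split=> // _; apply/fibre.
  rewrite [\1_(cyl S s k) w](@indic_bool _ _ _ true); last by split.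
  have -> : \1_B w = \1_C w :> R.
    by apply: indic_bool; rewrite inE; apply: BC.
  have -> : fr w = ft w.
    have tk := tau_cyl sk (conj gw cw).
    by rewrite /fr /f /= /Lf tk cw// Fw Pw -EFinM.
  by rewrite !mul1r mulr1; ring.
rewrite ExB; [|by apply: bmfM => //; exact: bmfM..].
by rewrite (one_step_gen j t sk GC) subrr.
Qed.

Lemma cond_prob_step : cond_prob Pr G [set w | L n.+1 w = j /\ (T n w <= t)%N] f.
Proof.
split=> B; first exact: f_measurable.
move=> GB; have mB := G_sub_measurable GB.
have bA : bmf (\1_A : Omega -> R) by exact: bmf_indic.
have bB : bmf (\1_B : Omega -> R) by exact: bmf_indic.
have -> : (\int[Pr]_(w in B) f w = (Ex Pr (fun w => \1_B w * fr w))%:E)%E.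
  rewrite -Ex_EFin; last exact: bmfM.
  rewrite integral_mkcond; apply: eq_integral => w _; rewrite patchE frE indicE.
  by case: (w \in B); rewrite ?mul1r ?mul0r.
have := step_zero GB.
under eq_Ex do rewrite mulrBr.
rewrite ExB; [|exact: bmfM|exact: bmfM] => /eqP; rewrite subr_eq0 => /eqP <-.
rewrite (_ : (fun w => _) = \1_(A `&` B)); last by apply/funext => w; rewrite indicI/= mulrC.
rewrite Ex_indic ?fineK//; last exact: measurableI.
by rewrite fin_num_measure//; exact: measurableI.
Qed.

End conditional_step.

Lemma semi_markov_S : semi_markov Pr l0 P F (fun t => S t).
Proof.
exists L, T; split; [exact: T_pos| |exact: S_renewal].
split; last by move=> n t j _; exact: cond_prob_step.
by apply: filterS S0_ae => w; rewrite /= /Lf /tau jump_time0.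
Qed.

End semi_markov_representation.

Theorem theorem6p1 (R : realType)
    (d : measure_display) (Omega : measurableType d) (Pr : probability Omega R)
    (dE : measure_display) (E : measurableType dE)
    (E_countable : countable [set: E])
    (E_discrete : forall A : set E, measurable A)
    (l0 : E)
    (m : E -> {measure set E -> \bar R})
    (c : E -> nat -> R)
    (F0 : E -> probability nat R)
    (m_pos : forall i, (0 < m i setT)%E)
    (m_fin : forall i, (m i setT < +oo)%E)
    (m_diag : forall i, m i [set i] = 0%E)
    (c_pos : forall i t, (0 < t)%N -> 0 < c i t)
    (F0_pos_int : forall i, F0 i [set 0%N] = 0%E)
    (F0_tail : forall i t, (0 < F0 i [set n | (t < n)%N])%E)
    (S : nat -> {RV Pr >-> E})
    (S_RSM : RSM Pr l0 m c F0 (fun t => S t))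
    (S_recurrent : recurrent Pr (fun t => S t)) :
  exists (P : E -> R.-pker Omega ~> E) (F : E -> R.-pker Omega ~> nat),
    [/\ characteristic_couple Pr P F,
        semi_markov Pr l0 P F (fun t => S t) &
        SMBS Pr m c F0 P F].
Proof.
(* One limit for each draw, all on the sample space of [S], so that the couple is defined jointly
   with the path. *)
have [theta theta_prop] := choice
  (theta_ex E_countable E_discrete m_pos m_fin m_diag c_pos F0_tail S_RSM).
have mtheta e : measurable_fun setT (theta e) by have [] := theta_prop e.
have theta01 e w : 0 <= theta e w <= 1 by have [_ h _] := theta_prop e.
have theta_lim e := let: And3 _ _ h := theta_prop e in h.
have theta_cyl := theta_moment E_countable E_discrete m_pos m_fin m_diag c_pos F0_tail
  S_RSM S_recurrent mtheta theta01 theta_lim.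
have moments := moments_of_cyl E_discrete S_RSM mtheta theta01 theta_cyl.
have [g gI] := E_inj E_countable.
have [P P_prop] := choice (fun i => kernel_of_weights g l0
  (fun j => mtheta (inl (i, j)))).
have [F F_prop] := choice (fun i => @kernel_of_weights R _ nat id 0%N _ Omega _
  (measurable_holding_weight mtheta i)).
have PE i := (P_prop i).1; have PS i := (P_prop i).2.
have FE i := (F_prop i).1; have FS i := (F_prop i).2.
exists P, F; split.
- exact: (characteristic_couple_PF E_countable E_discrete m_pos m_fin m_diag c_pos F0_pos_int
    F0_tail mtheta theta01 moments gI PE FE).
- exact: (semi_markov_S E_countable E_discrete m_pos m_fin m_diag c_pos F0_pos_int F0_tail S_RSM
    S_recurrent mtheta theta01 theta_cyl gI PE PS FE FS).
- exact: (SMBS_PF E_countable E_discrete m_pos m_fin c_pos F0_pos_int F0_tail mtheta theta01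
    moments gI PE PS FE FS).
Qed.
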